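(* Let $k$ be a nonnegative integer, let $G$ be a graph, and let $g$ and $f$ be integer-valued functions on $V(G)$ such that for each $v\in V(G)$, $g(v)\le d_G(v)/2\le f(v)$ and $|f(v)-g(v)|\le k$. Assume that for a bipartition $X,Y$ of $V(G)$, $G[X,Y]$ is $(4k^2+2k)$-tree-connected and $e_G(X)+e_G(Y)\le k-1$. Then $G$ has a factor $F$ such that $d_F(v)\in\{g(v),f(v)\}$ for each vertex $v$, if there is an integer-valued function $h$ on $V(G)$ such that $h(v)\in\{g(v),f(v)\}$ for each $v\in V(G)$, $\sum_{v\in V(G)}h(v)$ is even, and $$2e_G(X)+1\ \ge\ \sum_{v\in X}h(v)-\sum_{v\in Y}h(v)\ \ge\ 0.$$
   Context: Graphs may have loops and multiple edges. A factor is a spanning subgraph; $d_H(v)$ is the degree of $v$ in $H$. $e_G(X)$ is the number of edges of $G$ with both ends in $X$. $G[X,Y]$ is the spanning bipartite subgraph of $G$ consisting of all edges with one end in $X$ and the other in $Y$. A graph is $m$-tree-connected if it contains $m$ edge-disjoint spanning trees. *)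

(* Defs.v *)
From mathcomp Require Import all_boot all_order all_algebra.

Set Implicit Arguments.
Unset Strict Implicit.
Unset Printing Implicit Defensive.

(* Finite undirected multigraphs, with loops allowed. The order of the two
   ends of an edge carries no meaning: every notion below is invariant under
   swapping them. *)
Record mgraph := MGraph {
  vertex : finType;
  edge : finType;
  ends : edge -> vertex * vertex
}.

(* A factor (spanning subgraph) of [G] is given by its set of edges. *)
Notation factor G := {set edge G}.

Section Defs.
Variable G : mgraph.
Implicit Types (F H : factor G) (X Y : {set vertex G}).

(* A loop at [v] is counted in both terms, so it contributes 2. *)
Definition degree F (v : vertex G) : nat :=
  #|[set e in F | (ends e).1 == v]| + #|[set e in F | (ends e).2 == v]|.

Definition edges_in X : nat :=
  #|[set e : edge G | ((ends e).1 \in X) && ((ends e).2 \in X)]|.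

Definition edges_between X Y : factor G :=
  [set e | ((ends e).1 \in X) && ((ends e).2 \in Y)
        || ((ends e).1 \in Y) && ((ends e).2 \in X)].

Definition bipartition X Y : Prop := X :|: Y = setT /\ [disjoint X & Y].

Definition joins (e : edge G) : rel (vertex G) :=
  fun x y => (ends e == (x, y)) || (ends e == (y, x)).

Definition adjacent F : rel (vertex G) :=
  fun x y => [exists e in F, joins e x y].

Definition connected F : Prop := forall x y, connect (adjacent F) x y.

(* A cycle v_1 e_1 v_2 e_2 ... v_n e_n v_1 is the sequence of the pairs
   (v_i, e_i); n = 1 gives a loop and n = 2 a pair of parallel edges. *)
Definition is_cycle F (c : seq (vertex G * edge G)) : bool :=
  [&& c != [::], uniq (unzip1 c), uniq (unzip2 c)
    & cycle (fun p q => (p.2 \in F) && joins p.2 p.1 q.1) c].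

Definition acyclic F : Prop := forall c, ~~ is_cycle F c.

Definition spanning_tree F : Prop := connected F /\ acyclic F.

Definition tree_connected (m : nat) H : Prop :=
  exists T : 'I_m -> factor G,
    [/\ forall i, spanning_tree (T i),
        forall i, T i \subset H
      & forall i j, i != j -> [disjoint T i & T j]].

End Defs.

(* Main.v *)
(** Write [b] for the edges between [X] and [Y] and orient an edge of a factor
    from [X] to [Y], every other edge of [b] from [Y] to [X]. The degree
    conditions then prescribe, up to a two-element choice at each vertex, the
    net outdegrees of an orientation of [b], and by Hakimi's theorem such net
    outdegrees [T] are realisable as soon as [|T(A)|] is at most the size of
    every cut [A]; the at most [k - 1] edges inside [X] and inside [Y] only
    shift [T] by a bounded amount. The choices are made in three steps.
    - Vertices with the same [f v - g v = d] are treated together, for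
      [d = 1, ..., k], with the help of [3 d] spanning trees: an orientation of
      the (doubled) trees with prescribed net outdegrees modulo [4 d], in the
      style of Lovász, Thomassen, Wu and Zhang, selects one of the two options
      at each vertex, with cut sums bounded by the cuts of these trees. A special
      vertex absorbs the running error, which stays at most [d].
    - The sum of the selected values is then corrected by replacing options by
      those of [h]; a zero-sum-free family of replacements is short, which
      bounds its effect on every cut by about [2 k ^ 2].
    - The unused trees give enough room for the cut condition, and Hakimi's
      theorem yields the factor. *)
Require Import Defs.
From mathcomp Require Import all_boot all_order all_algebra.
From mathcomp Require Import zify.
Import Order.TTheory GRing.Theory Num.Theory.
Local Open Scope ring_scope.
Set Implicit Arguments.
Unset Strict Implicit.
Unset Printing Implicit Defensive.

(** * Distance to the multiples of an even modulus; sums and cuts *)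

(** Two demands shape the orientation theorem. Residues alone do not suffice: a net outdegree has to
    be one of two given integers, so it must also lie in [[rl x, rh x]], and every reduction has to
    keep zero between the residual bounds [rl x + i x - o x] and [rh x + i x - o x]. Moreover,
    contracting a tight set fixes the direction of its boundary edges, so instances with directed
    arcs are unavoidable; these arcs are gathered at a root. The root may have degree up to [K] plus
    the norm of its imbalance, which is just what the boundary of a tight set provides.

    The number [3 d] comes from the cut condition for the modulus [4 d]: it asks for at most
    [4 d + 2 d] edges, and a cut of [3 d] doubled trees has [6 d]. Doubling also settles all
    parities. The classes use [3 k (k + 1) / 2] trees; the remaining [(5 k ^ 2 + k) / 2] trees have
    to pay for the correction of the total, at most [2 k (k - 1) + 3 k - 2] on a cut, and for the
    edges inside [X] and [Y], at most [2 k - 2]. *)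

Section Norm.
Variable k : int.
Hypothesis k_gt0 : 0 < k.
Local Notation K := (2 * k).

(** This is the least absolute value of a net flow with residue [z]; in the cut condition it is the
    part of a cut that the prescribed residue uses up. *)
Definition dist_mul (z : int) : int :=
  Order.min (z %% K)%Z (K - (z %% K)%Z).
Local Notation nrm := dist_mul.

Lemma divK z : exists q p, [/\ z = K * q + p, 0 <= p & p < K].
Proof.
exists (z %/ K)%Z, (z %% K)%Z.
by split; [rewrite mulrC -divz_eq | rewrite modz_ge0 | rewrite ltz_pmod]; lia.
Qed.

Lemma nrmE q p : 0 <= p < K -> nrm (K * q + p) = Order.min p (K - p).
Proof.
by move=> hp; rewrite /dist_mul mulrC modzMDl modz_small //; lia.
Qed.

Lemma K_mul_ge q : 1 <= q -> K <= K * q.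
Proof. by move=> hq; nia. Qed.

Lemma K_mul_le q : q <= -1 -> K * q <= - K.
Proof. by move=> hq; nia. Qed.

Lemma K_mul_pos q : - K < K * q -> 0 <= K * q.
Proof.
move=> h; have [hq|hq] := lerP 0 q; first by rewrite mulr_ge0; lia.
by have := @K_mul_le q; lia.
Qed.

Lemma K_mul_neg q : K * q < K -> K * q <= 0.
Proof. by move=> h; have := @K_mul_pos (- q); lia. Qed.

Lemma nrm_le z q : nrm z <= `|z - K * q|.
Proof.
have [q0 [p [-> p0 pK]]] := divK z; rewrite nrmE; last lia.
have -> : K * q0 + p - K * q = p - K * (q - q0) by lia.
have [h|[h|h]] : q - q0 <= -1 \/ q - q0 = 0 \/ 1 <= q - q0 by lia.
- by have := K_mul_le h; lia.
- by rewrite h; lia.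
- by have := K_mul_ge h; lia.
Qed.

Lemma nrm_ex z : exists2 q, nrm z = `|z - K * q| & nrm z <= k.
Proof.
have [q0 [p [-> p0 pK]]] := divK z; rewrite nrmE; last lia.
have [h|h] := lerP p k; [exists q0 | exists (q0 + 1)]; lia.
Qed.

Lemma nrm_lek z : nrm z <= k.
Proof. by have [q _] := nrm_ex z. Qed.

Lemma nrm_ge0 z : 0 <= nrm z.
Proof. by have [q ->] := nrm_ex z; lia. Qed.

(** The modulus is even, so passing to the nearest multiple keeps the parity. This later turns
    strict cut inequalities into a gain of two. *)
Lemma nrm_par z : exists m, nrm z = z + 2 * m.
Proof.
have [q -> _] := nrm_ex z.
have [h|h] := lerP 0 (z - K * q).
  by exists (- (k * q)); lia.
by exists (k * q - z); lia.
Qed.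

Lemma nrm_lip z z' : nrm z' <= nrm z + `|z' - z|.
Proof. by have [q -> _] := nrm_ex z; have := nrm_le z' q; lia. Qed.

Lemma nrmMD q z : nrm (z + K * q) = nrm z.
Proof.
apply/eqP; rewrite eq_le; apply/andP; split.
  by have [q0 -> _] := nrm_ex z; have := nrm_le (z + K * q) (q0 + q); lia.
by have [q0 -> _] := nrm_ex (z + K * q); have := nrm_le z (q0 - q); lia.
Qed.

Lemma nrmN z : nrm (- z) = nrm z.
Proof.
apply/eqP; rewrite eq_le; apply/andP; split.
  by have [q0 -> _] := nrm_ex z; have := nrm_le (- z) (- q0); lia.
by have [q0 -> _] := nrm_ex (- z); have := nrm_le z (- q0); lia.
Qed.

Lemma nrm_near q a : `|a| <= k -> nrm (K * q + a) = `|a|.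
Proof.
move=> ha; have [h|h] := lerP 0 a; first by rewrite nrmE; lia.
have -> : K * q + a = K * (q - 1) + (K + a) by lia.
by rewrite nrmE; lia.
Qed.

End Norm.

Section Sums.
Variable U : finType.
Implicit Types (A B C V : {set U}) (f : U -> int) (w : U -> U -> int).

Definition ind (b : bool) (c : int) : int := if b then c else 0.

Lemma indE b c : ind b c = c * Posz b.
Proof. by rewrite /ind; case: b; lia. Qed.

Definition sm f A : int := \sum_(x in A) f x.

Definition addat f x c : U -> int := fun v => f v + ind (v == x) c.

Definition addw w x y c : U -> U -> int := fun a b =>
  w a b + ind ((a == x) && (b == y)) c + ind ((a == y) && (b == x)) c.

(** Ordered pairs are counted: for symmetric [w], [cut w V V] is twice the number of edges in
    [V]. *)
Definition cut w A B : int := \sum_(x in A) sm (w x) B.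

Lemma sm0 f : sm f set0 = 0.
Proof. by rewrite /sm big_set0. Qed.

Lemma sm1 f x : sm f [set x] = f x.
Proof. by rewrite /sm big_set1. Qed.

Lemma smU f A B : [disjoint A & B] -> sm f (A :|: B) = sm f A + sm f B.
Proof.
move=> h; rewrite /sm (big_setID A) /= setUK setDUl setDv set0U.
by move: h; rewrite disjoint_sym => /setDidPl ->.
Qed.

Lemma smD1 f x A : x \in A -> sm f A = f x + sm f (A :\ x).
Proof. by move=> h; rewrite /sm (big_setD1 x). Qed.

Lemma sm_sub f A V : A \subset V -> sm f V = sm f A + sm f (V :\: A).
Proof.
move=> h; rewrite -smU; last by rewrite disjoints_subset; apply/subsetP=> x; rewrite !inE => ->.
by congr sm; apply/setP=> x; rewrite !inE; case: (boolP (x \in A)) => //= /(subsetP h) ->.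
Qed.

Lemma sm_ge0 f A : (forall x, x \in A -> 0 <= f x) -> 0 <= sm f A.
Proof. by move=> h; apply: sumr_ge0. Qed.

Lemma sm_le f g A : (forall x, x \in A -> f x <= g x) -> sm f A <= sm g A.
Proof. by move=> h; apply: ler_sum. Qed.

Lemma eq_sm f g A : {in A, f =1 g} -> sm f A = sm g A.
Proof. by move=> h; apply: eq_bigr. Qed.

Lemma smD f g A : sm (fun x => f x + g x) A = sm f A + sm g A.
Proof. by rewrite /sm big_split. Qed.

Lemma smN f A : sm (fun x => - f x) A = - sm f A.
Proof. by rewrite /sm sumrN. Qed.

Lemma smB f g A : sm (fun x => f x - g x) A = sm f A - sm g A.
Proof. by rewrite smD smN. Qed.

Lemma smM c f A : sm (fun x => c * f x) A = c * sm f A.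
Proof. by rewrite /sm mulr_sumr. Qed.

Lemma sm_ind x c A :
  sm (fun v => ind (v == x) c) A = ind (x \in A) c.
Proof.
rewrite /sm /ind; case: ifP => hx.
  rewrite (big_setD1 x) //= eqxx big1 ?addr0 // => y.
  by rewrite !inE => /andP[/negbTE -> _].
by rewrite big1 // => y hy; case: eqP => // e; rewrite -e hy in hx.
Qed.

Lemma sm_addat f x c A : sm (addat f x c) A = sm f A + ind (x \in A) c.
Proof. by rewrite smD sm_ind. Qed.

Lemma le1_sm f A x : (forall y, y \in A -> 0 <= f y) -> x \in A -> f x <= sm f A.
Proof.
move=> h hx; rewrite (smD1 _ hx) lerDl; apply: sm_ge0 => y; rewrite !inE => /andP[_].
exact: h.
Qed.

Lemma sm_pos f A : 0 < sm f A -> exists2 x, x \in A & 0 < f x.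
Proof.
move=> h; case: (pickP [pred x | (x \in A) && (0 < f x)]) => [x /andP[]|hn]; first by exists x.
suff : sm f A <= 0 by rewrite leNgt h.
by apply: sumr_le0 => x hx; have /= := hn x; rewrite hx /= => /negbT; rewrite -leNgt.
Qed.

Lemma cutC w A B : (forall x y, w x y = w y x) -> cut w A B = cut w B A.
Proof.
move=> hs; rewrite /cut /sm exchange_big /=.
by apply: eq_bigr => y _; apply: eq_bigr => x _.
Qed.

Lemma cut0r w A : cut w A set0 = 0.
Proof. by rewrite /cut big1 // => x _; apply: sm0. Qed.

Lemma cut1l w x B : cut w [set x] B = sm (w x) B.
Proof. exact: sm1. Qed.

Lemma cutUl w A B C : [disjoint A & B] -> cut w (A :|: B) C = cut w A C + cut w B C.
Proof. exact: smU. Qed.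

Lemma cutUr w A B C : [disjoint B & C] -> cut w A (B :|: C) = cut w A B + cut w A C.
Proof. by move=> h; rewrite /cut -big_split /=; apply: eq_bigr => x _; apply: smU. Qed.

Lemma cut_ge0 w A B :
  (forall x y, x \in A -> y \in B -> 0 <= w x y) -> 0 <= cut w A B.
Proof. by move=> h; apply: sm_ge0 => x hx; apply: sm_ge0 => y hy; apply: h. Qed.

Lemma eq_cut w w' A B :
  (forall x y, x \in A -> y \in B -> w x y = w' x y) -> cut w A B = cut w' A B.
Proof. by move=> h; apply: eq_sm => x hx; apply: eq_sm => y hy; apply: h. Qed.

Lemma cut_addw w x y c A B :
  cut (addw w x y c) A B = cut w A B + ind ((x \in A) && (y \in B)) c
                                     + ind ((y \in A) && (x \in B)) c.
Proof.
have h a b : \sum_(z in A) sm (fun t => ind ((z == a) && (t == b)) c) B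
    = ind ((a \in A) && (b \in B)) c.
  transitivity (sm (fun z => ind (z == a) (ind (b \in B) c)) A); last first.
    by rewrite sm_ind /ind; case: (a \in A).
  apply: eq_bigr => z _; case: (z == a); first exact: sm_ind.
  by rewrite /sm big1.
by rewrite /cut -!h -!big_split /=; apply: eq_bigr => z _; rewrite -!smD.
Qed.

End Sums.

(** * Rooted instances of the modular orientation problem *)

Ltac lia_ind := rewrite ?indE; repeat match goal with
  |- context [Posz (nat_of_bool ?b)] => generalize (Posz (nat_of_bool b)); intro end; lia.

Section Instances.
Variables (k : int) (U : finType).
Hypothesis k_gt0 : 0 < k.
Local Notation K := (2 * k).
Local Notation nrm := (dist_mul k).
Implicit Types (A B V ex : {set U}) (o i rl rh : U -> int) (w a : U -> U -> int).

(* In an instance [V w o i rl rh], the free edges on [V] have multiplicities [w],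
   and [o x] (resp. [i x]) arcs from (resp. to) an auxiliary root vertex are
   attached to [x]. A solution orients the free edges so that the net outdegree
   at each [x] lies between [rl x] and [rh x] and is [rl x] modulo [2 * k]; the
   root arcs only enter the hypotheses that make the induction work. *)
Definition net a V x : int := sm (fun y => a x y - a y x) V.

Definition solvable V w rl rh := exists a : U -> U -> int,
  [/\ forall x y, 0 <= a x y,
      forall x y, x \in V -> y \in V -> a x y + a y x = w x y
    & forall x, x \in V ->
        rl x <= net a V x <= rh x /\ exists q, net a V x = rl x + K * q].

Definition deg V w o i A : int := cut w A (V :\: A) + sm o A + sm i A.

Definition low r o i A : int := sm r A + sm i A - sm o A.

(* [ex] is empty or a singleton, which is exempt from the cut condition. *)
Record base V w o i rl rh ex : Prop := Base {
  b_sym : forall x y, w x y = w y x;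
  b_diag : forall x, w x x = 0;
  b_w0 : forall x y, 0 <= w x y;
  b_o0 : forall x, 0 <= o x;
  b_i0 : forall x, 0 <= i x;
  b_str : forall x, x \in V -> rl x + i x <= o x <= rh x + i x;
  b_gap : forall x, x \in V -> exists q, rh x = rl x + K * q;
  b_par : forall A, A \subset V -> exists m, deg V w o i A = low rl o i A + 2 * m;
  b_cut : forall A, A \subset V -> A != set0 -> A != V -> A != ex ->
            K + nrm (low rl o i A) <= deg V w o i A;
  b_sum : exists q, sm rl V = K * q;
  b_ex : ex = set0 \/ exists u, [/\ u \in V, ex = [set u], rl u + i u = o u
                                  & rh u + i u = o u]
}.

(* If the root sends out at least [K] arcs more than it receives, some vertex has
   to take the excess; this is what the one-vertex case needs. *)
Definition dom V o i rl := sm o V - sm i V < K \/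
  exists x, [/\ x \in V, sm o V - sm i V - K <= o x
              & rl x + i x - o x < K - (sm o V - sm i V)].

Record rooted V o i rl rh : Prop := Rooted {
  r_root : sm o V + sm i V <= K + nrm (sm o V - sm i V);
  r_out : dom V o i rl;
  r_in : dom V i o (fun x => - rh x)
}.

(** The margin two is what one elementary operation can cost on such a set. *)
Definition slack V w o i rl := forall A, A \subset V -> (1 < #|A|)%N -> A != V ->
  K + nrm (low rl o i A) + 2 <= deg V w o i A.

(** An edge weighs 4 and a root arc 2, so that trading an edge for a root arc, or dropping a root
    arc, is a decrease even if the imbalance grows by one. The last term pays for relabelling root
    arcs. *)
Definition mu V w o i : nat :=
  absz (2 * cut w V V + 2 * (sm o V + sm i V) + `|sm o V - sm i V|).

Lemma sm_gap V rl rh A : (forall x, x \in V -> exists q, rh x = rl x + K * q) ->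
  A \subset V -> exists q, sm rh A = sm rl A + K * q.
Proof.
move=> h; elim: {A}_.+1 {-2}A (ltnSn #|A|) => // n IH A hn hA.
have [->|[x hx]] := set_0Vmem A; first by exists 0; rewrite !sm0; lia.
have [q hq] : exists q, sm rh (A :\ x) = sm rl (A :\ x) + K * q.
  apply: IH; first by move: hn; rewrite (cardsD1 x) hx.
  by apply: subset_trans hA; apply: subD1set.
have [q' hq'] := h x (subsetP hA _ hx).
by exists (q + q'); rewrite !(smD1 _ hx) hq hq'; lia.
Qed.

Lemma degN V w o i A : deg V w i o A = deg V w o i A.
Proof. by rewrite /deg; lia. Qed.

(** Reversing every arc exchanges [o] with [i] and turns negated upper bounds into lower ones. Each
    one-sided step thus yields its dual. *)
Lemma base_mirror V w o i rl rh ex : base V w o i rl rh ex ->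
  base V w i o (fun x => - rh x) (fun x => - rl x) ex.
Proof.
case=> h1 h2 h3 h4 h5 h6 h7 h8 h9 [q h10] h11.
have lowE A : A \subset V -> exists q, low (fun x => - rh x) i o A = - low rl o i A + K * q.
  move=> hA; have [q' hq'] := sm_gap h7 hA.
  by exists (- q'); rewrite /low smN hq'; lia.
split=> //.
- by move=> x /h6; lia.
- by move=> x /h7[p ->]; exists p; lia.
- move=> A hA; have [m hm] := h8 A hA; have [p hp] := lowE A hA.
  by rewrite degN hm hp; exists (low rl o i A + m - k * p); lia.
- move=> A hA h h' h''; have [p ->] := lowE A hA.
  by rewrite nrmMD // nrmN // degN; apply: h9.
- have [p hp] := sm_gap h7 (subxx V).
  by exists (- q - p); rewrite smN hp h10; lia.
- case: h11 => [->|[u [hu hex hl hh]]]; [by left | right; exists u].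
  by split=> //; lia.
Qed.

Lemma rooted_mirror V o i rl rh : rooted V o i rl rh ->
  rooted V i o (fun x => - rh x) (fun x => - rl x).
Proof.
case=> h1 h2 h3; split=> //.
  by rewrite addrC -opprB nrmN.
case: h2 => [h|[x [hx h h']]]; [by left | right; exists x; split=> //].
by lia.
Qed.

Lemma mu_mirror V w o i : mu V w i o = mu V w o i.
Proof. by rewrite /mu; clear; lia. Qed.

Lemma slack_mirror V w o i rl rh :
  (forall x, x \in V -> exists q, rh x = rl x + K * q) ->
  slack V w o i rl -> slack V w i o (fun x => - rh x).
Proof.
move=> hg h A hA hc hn; have := h A hA hc hn; rewrite degN.
have [q hq] := sm_gap hg hA.
have -> : low (fun x => - rh x) i o A = - low rl o i A + K * (- q).
  by rewrite /low smN hq; lia.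
by rewrite nrmMD // nrmN.
Qed.

Lemma solvable_mirror V w rl rh : (forall x, x \in V -> exists q, rh x = rl x + K * q) ->
  solvable V w (fun x => - rh x) (fun x => - rl x) -> solvable V w rl rh.
Proof.
move=> hg [a [ha0 haw han]]; exists (fun x y => a y x); split=> //.
  by move=> x y hx hy; rewrite addrC haw.
move=> x hx; have [h [q hq]] := han x hx; have [p hp] := hg x hx.
have -> : net (fun x y => a y x) V x = - net a V x.
  by rewrite /net -smN; apply: eq_sm => y _; lia.
by split; [lia | exists (p - q); lia].
Qed.

Lemma net_addat a V x y c z : x != y -> x \in V -> y \in V ->
  net (fun s t => a s t + ind ((s == x) && (t == y)) (c)) V z
  = net a V z + ind (z == x) c - ind (z == y) c.
Proof.
move=> hxy hx hy; rewrite /net.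
transitivity (sm (fun t => (a z t - a t z) + ind (t == y) (ind (z == x) c)
   - ind (t == x) (ind (z == y) c)) V).
  apply: eq_sm => t _; rewrite /ind.
  by case: (z == x); case: (z == y); case: (t == x); case: (t == y) => /=; lia.
by rewrite smB smD !sm_ind hx hy.
Qed.

Lemma solve_E V w rl rh x y : x != y -> x \in V -> y \in V ->
  solvable V (addw w x y (-1)) (addat (addat rl x (-1)) y 1) (addat (addat rh x (-1)) y 1) ->
  solvable V w rl rh.
Proof.
move=> hxy hx hy [a [ha0 haw han]].
exists (fun s t => a s t + ind ((s == x) && (t == y)) (1)); split.
- by move=> s t; have := ha0 s t; rewrite /ind; case: ifP => _; lia.
- move=> s t hs ht; have := haw s t hs ht; rewrite /addw; clear.
  by rewrite [(t == x) && _]andbC; lia_ind.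
- move=> z hz; rewrite net_addat //; have [h [q hq]] := han z hz.
  move: h hq; rewrite /addat /ind; clear.
  by case: (z == x); case: (z == y) => /= h hq; (split; [lia | exists q; lia]).
Qed.

Lemma solvable_weaken V w rl rh rl' rh' :
  (forall x, x \in V -> [/\ rl x <= rl' x, rh' x <= rh x & exists q, rl' x = rl x + K * q]) ->
  solvable V w rl' rh' -> solvable V w rl rh.
Proof.
move=> h [a [ha0 haw han]]; exists a; split=> // x hx.
have [h1 [q hq]] := han x hx; have [h2 h3 [p hp]] := h x hx.
by split; [lia | exists (p + q); lia].
Qed.

(** Some copy of the edge [y z] is directed one way or the other; rerouting it through [u] changes
    no net outdegree. *)
Lemma solve_lift V w rl rh u y z : u \in V -> y \in V -> z \in V ->
  u != y -> u != z -> y != z -> (forall x y, 0 <= w x y) ->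
  1 <= w u y -> 1 <= w u z ->
  solvable V (addw (addw (addw w u y (-1)) u z (-1)) y z 1) rl rh -> solvable V w rl rh.
Proof.
move=> hu hy hz nuy nuz nyz hw wy wz [a [ha0 haw han]].
wlog h1 : y z hy hz nuy nuz nyz wy wz haw / 1 <= a y z.
  move=> H; have := haw y z hy hz; rewrite /addw !eqxx /= => e.
  have nyu : (y == u) = false by rewrite eq_sym (negbTE nuy).
  have nzu : (z == u) = false by rewrite eq_sym (negbTE nuz).
  move: e; rewrite /ind nyu nzu (negbTE nyz) /= ?andbF /= => e.
  have [h|h] : 1 <= a y z \/ 1 <= a z y.
    by have := hw y z; have := ha0 y z; have := ha0 z y; lia.
  - exact: (H y z).
  - apply: (H z y) => //; first by rewrite eq_sym.
    move=> s t hs ht; rewrite haw // /addw; clear.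
    by lia_ind.
set a1 := fun s t => a s t + ind ((s == y) && (t == z)) (-1).
set a2 := fun s t => a1 s t + ind ((s == y) && (t == u)) (1).
exists (fun s t => a2 s t + ind ((s == u) && (t == z)) (1)); split.
- move=> s t; rewrite /a2 /a1 /ind; have := ha0 s t; move: h1; clear.
  have [/andP[/eqP -> /eqP ->]|_] := boolP ((s == y) && (t == z)).
    by case: ifP => _; case: ifP => _; lia.
  by case: ifP => _; case: ifP => _; lia.
- move=> s t hs ht; have := haw s t hs ht; rewrite /a2 /a1 /addw; clear.
  rewrite [(t == y) && (s == z)]andbC [(t == y) && (s == u)]andbC.
  rewrite [(t == u) && (s == z)]andbC .
  by lia_ind.
- have nyu : y != u by rewrite eq_sym.
  move=> x hx; rewrite net_addat // /a2 net_addat // /a1 net_addat //.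
  have [h [q hq]] := han x hx.
  have -> : forall n : int, n + ind (x == y) (-1) - ind (x == z) (-1) + ind (x == y) 1
     - ind (x == u) 1 + ind (x == u) 1 - ind (x == z) 1 = n by move=> n; clear; lia_ind.
  by split=> //; exists q.
Qed.

End Instances.

(** * Operations on a single edge or arc *)

Section Ops.
Variables (k : int) (U : finType).
Hypothesis k_gt0 : 0 < k.
Local Notation K := (2 * k).
Local Notation nrm := (dist_mul k).
Local Notation base := (@base k U).
Local Notation slack := (@slack k U).
Implicit Types (A B V ex : {set U}) (o i rl rh : U -> int) (w : U -> U -> int) (a b : int).

Lemma single_or A : A != set0 -> (1 < #|A|)%N \/ exists x, A = [set x].
Proof.
rewrite -card_gt0 => h; have [h1|h1] := ltnP 1 #|A|; [by left | right].
by apply/cards1P; rewrite eqn_leq h h1.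
Qed.

Lemma deg1 V w o i x : deg V w o i [set x] = sm (w x) (V :\ x) + o x + i x.
Proof. by rewrite /deg cut1l !sm1. Qed.

Lemma low1 r o i x : low r o i [set x] = r x + i x - o x.
Proof. by rewrite /low !sm1. Qed.

Lemma deg_E V w o i x y ax ay A : x \in V -> y \in V ->
  deg V (addw w x y (-1)) (addat (addat o x ax) y ay) i A
  = deg V w o i A + ind ((x \in A) && (y \notin A)) (-1)
    + ind ((y \in A) && (x \notin A)) (-1) + ind (x \in A) ax + ind (y \in A) ay.
Proof.
move=> hx hy; rewrite /deg cut_addw !sm_addat !inE hx hy !andbT.
by move: (ind _ _) (ind _ _) (ind _ _) (ind _ _) => *; lia.
Qed.

Lemma low_E r o i x y ax ay A :
  low (addat (addat r x (-1)) y 1) (addat (addat o x ax) y ay) i A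
  = low r o i A + ind (x \in A) (- 1 - ax) + ind (y \in A) (1 - ay).
Proof. by rewrite /low !sm_addat /ind; case: (x \in A); case: (y \in A); lia. Qed.

(** A copy of [x y] is directed from [x] to [y] and removed. With [ax = -1] it continues an arc from
    the root to [x], which is used up; with [ay = 1] it survives at [y] as an arc from the root. In
    either case the residual demand at that end is unchanged. *)
Lemma opE_base V w o i rl rh ex x y ax ay :
  base V w o i rl rh ex -> slack V w o i rl ->
  x \in V -> y \in V -> x != y -> 1 <= w x y ->
  (ax = 0 \/ ax = -1) -> (ay = 0 \/ ay = 1) -> 0 <= o x + ax ->
  (ex = set0 \/ ex = [set x] /\ ax = -1) ->
  rl x + i x - o x - 1 - ax <= 0 <= rh x + i x - o x - 1 - ax ->
  rl y + i y - o y + 1 - ay <= 0 <= rh y + i y - o y + 1 - ay ->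
  (ex != [set x] -> K + nrm (rl x + i x - o x - 1 - ax) <= deg V w o i [set x] - 1 + ax) ->
  K + nrm (rl y + i y - o y + 1 - ay) <= deg V w o i [set y] - 1 + ay ->
  base V (addw w x y (-1)) (addat (addat o x ax) y ay) i
    (addat (addat rl x (-1)) y 1) (addat (addat rh x (-1)) y 1) ex.
Proof.
case=> h1 h2 h3 h4 h5 h6 h7 h8 h9 [q h10] h11 hsl hx hy nxy wxy hax hay hox hex sx sy cx cy.
have nyx : (y == x) = false by rewrite eq_sym (negbTE nxy).
split=> //.
- move=> s t; rewrite /addw h1 [(t == x) && _]andbC [(t == y) && _]andbC.
  by move: (ind _ _) (ind _ _) => *; lia.
- move=> s; rewrite /addw h2 /ind.
  by case: eqP => [->|_] /=; rewrite ?(negbTE nxy) ?andbF //.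
- move=> s t; rewrite /addw /ind; have := h3 s t.
  have [/andP[/eqP -> /eqP ->]|_] := boolP ((s == x) && (t == y)).
    by rewrite (negbTE nxy) /=; move: wxy; clear; lia.
  have [/andP[/eqP -> /eqP ->]|_] := boolP ((s == y) && (t == x)).
    by move: wxy; rewrite h1; clear; lia.
  by clear; lia.
- move=> s; rewrite /addat /ind; have := h4 s.
  case: (s =P x) => [->|_]; last by case: (s == y); move: hay; clear; lia.
  by rewrite (negbTE nxy); move: hox; clear; lia.
- move=> s hs; have := h6 s hs; rewrite /addat /ind.
  case: (s =P x) => [->|_]; first by rewrite (negbTE nxy); move: sx; clear; lia.
  case: (s =P y) => [->|_]; first by move: sy; clear; lia.
  by clear; lia.
- move=> s /h7[p hp]; exists p; rewrite /addat hp; move: (ind _ _) (ind _ _) => *; lia.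
- move=> A hA; have [m hm] := h8 A hA; rewrite deg_E // low_E hm; clear -hax hay.
  rewrite /ind; case: (x \in A); case: (y \in A) => /=.
  + by exists (m + ax + ay); lia.
  + by exists (m + ax); lia.
  + by exists (m - 1 + ay); lia.
  + by exists m; lia.
- move=> A hA hA0 hAV hAex; rewrite deg_E // low_E.
  (* The loss of degree and the change of [low] amount together to at most two, the margin of
     [slack]; singletons are covered by the explicit hypotheses. *)
  have [hc|[z ez]] := single_or hA0.
    have hs := hsl A hA hc hAV.
    set l' := _ + ind _ (1 - _); have := nrm_lip k_gt0 (low rl o i A) l'.
    move: hs; rewrite /l'; clear -hax hay; rewrite /ind.
    by case: (x \in A); case: (y \in A) => /=; lia.
  have := h9 A hA hA0 hAV hAex; rewrite ez !inE.
  move: hAex; rewrite ez => hAex.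
  case: (x =P z) => [e|_] /=.
    rewrite -e in hAex *; rewrite nyx /ind /= low1 => _.
    have := cx; rewrite eq_sym => /(_ hAex).
    have -> : rl x + i x - o x + (-1 - ax) + 0 = rl x + i x - o x - 1 - ax by clear; lia.
    by clear; lia.
  case: (y =P z) => [e|_] /= .
    rewrite -e /ind /= low1 => _; move: cy.
    have -> : rl y + i y - o y + 0 + (1 - ay) = rl y + i y - o y + 1 - ay by clear; lia.
    by clear; lia.
  by rewrite /ind /= !addr0.
- exists q; rewrite !sm_addat hx hy /ind h10; clear; lia.
- case: hex => [->|[eex eax]]; first by left.
  case: h11 => [->|[u [hu e el eh]]]; [by left | right; exists x].
  have eu : u = x by apply/set1P; rewrite -eex e set11.
  by rewrite eex /addat /ind eqxx (negbTE nxy) -eu; split=> //; move: el eh; rewrite ?eax; clear; lia.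
Qed.

Lemma deg_L V w o i v a b A :
  deg V w (addat o v a) (addat i v b) A = deg V w o i A + ind (v \in A) (a + b).
Proof. by rewrite /deg !sm_addat /ind; case: (v \in A); lia. Qed.

Lemma low_L r o i v a b A :
  low r (addat o v a) (addat i v b) A = low r o i A + ind (v \in A) (b - a).
Proof. by rewrite /low !sm_addat /ind; case: (v \in A); lia. Qed.

Lemma opL_base V w o i rl rh ex v a b :
  base V w o i rl rh ex -> 0 <= o v + a -> 0 <= i v + b ->
  rl v + i v + b <= o v + a <= rh v + i v + b ->
  (forall A, A \subset V -> v \in A -> A != V -> A != ex ->
     K + nrm (low rl o i A + (b - a)) <= deg V w o i A + (a + b)) ->
  (ex = set0 \/ ex = [set v] /\ a = b) ->
  base V w (addat o v a) (addat i v b) rl rh ex.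
Proof.
case=> h1 h2 h3 h4 h5 h6 h7 h8 h9 h10 h11 hov hiv hs hc hex; split=> //.
- move=> s; rewrite /addat /ind; case: (s =P v) => [->//|_]; rewrite addr0; exact: h4.
- move=> s; rewrite /addat /ind; case: (s =P v) => [->//|_]; rewrite addr0; exact: h5.
- move=> s hsV; have := h6 s hsV; rewrite /addat /ind.
  by case: (s =P v) => [->|_]; [move: hs | ]; clear; lia.
- move=> A hA; have [m hm] := h8 A hA; rewrite deg_L low_L hm; clear; rewrite /ind.
  by case: (v \in A); [exists (m + a); lia | exists m; lia].
- move=> A hA hA0 hAV hAex; rewrite deg_L low_L /ind; case: (boolP (v \in A)) => hv.
    exact: hc.
  by rewrite !addr0; apply: h9.
- case: hex => [->|[eex eab]]; first by left.
  case: h11 => [->|[u [hu e el eh]]]; [by left | right; exists u; split=> //];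
  have -> : u = v by apply/set1P; rewrite -eex e set11.
    have eu : u = v by apply/set1P; rewrite -eex e set11.
    by rewrite /addat /ind eqxx -eu; move: el eab; clear; lia.
  have eu : u = v by apply/set1P; rewrite -eex e set11.
  by rewrite /addat /ind eqxx -eu; move: eh eab; clear; lia.
Qed.

(** A residual demand divisible by [K] can be fixed at zero, since all conditions on sets only see
    it modulo [K]. The vertex is then exempt from the cut condition, so all its edges may be lifted
    away. *)
Lemma exempt_base V w o i rl rh u : base V w o i rl rh set0 -> u \in V ->
  (exists q, rl u + i u - o u = K * q) ->
  base V w o i (addat rl u (o u - i u - rl u)) (addat rh u (o u - i u - rh u)) [set u].
Proof.
case=> h1 h2 h3 h4 h5 h6 h7 h8 h9 [p h10] h11 hu [q hq].
have lowE A : low (addat rl u (o u - i u - rl u)) o i A = low rl o i A + K * (ind (u \in A) (- q)).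
  by rewrite /low sm_addat /ind; case: (u \in A); move: hq; clear; lia.
split=> //.
- move=> s hs; have := h6 s hs; rewrite /addat /ind; case: (s =P u) => [->|_]; clear; lia.
- move=> s /[dup] hs /h7[m hm]; rewrite /addat /ind; case: (s =P u) => [->|_].
    by exists 0; clear; lia.
  by exists m; move: hm; clear; lia.
- move=> A hA; have [m hm] := h8 A hA; exists (m - k * ind (u \in A) (- q)).
  by rewrite lowE hm; move: (ind _ _); clear => *; lia.
- by move=> A hA hA0 hAV _; rewrite lowE nrmMD //; apply: h9.
- by exists (p - q); rewrite sm_addat hu /ind h10; move: hq; clear; lia.
- right; exists u; split=> //; rewrite /addat /ind eqxx; clear; lia.
Qed.

(** Lifting lowers only the cuts that separate [u] from both [y] and [z], by two. The slack covers
    the larger sets, and the one singleton concerned, that of [u], is exempt. *)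
Lemma lift_base V w o i rl rh u y z :
  base V w o i rl rh [set u] -> slack V w o i rl -> u \in V -> y \in V -> z \in V ->
  u != y -> u != z -> y != z -> 1 <= w u y -> 1 <= w u z ->
  base V (addw (addw (addw w u y (-1)) u z (-1)) y z 1) o i rl rh [set u].
Proof.
case=> h1 h2 h3 h4 h5 h6 h7 h8 h9 h10 h11 hsl hu hy hz nuy nuz nyz wy wz.
have degE A : deg V (addw (addw (addw w u y (-1)) u z (-1)) y z 1) o i A
  = deg V w o i A + (ind ((u \in A) && (y \notin A)) (-1) + ind ((y \in A) && (u \notin A)) (-1)
   + ind ((u \in A) && (z \notin A)) (-1) + ind ((z \in A) && (u \notin A)) (-1)
   + ind ((y \in A) && (z \notin A)) 1 + ind ((z \in A) && (y \notin A)) 1).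
  rewrite /deg !cut_addw !inE hu hy hz !andbT.
  by move: (ind _ _) (ind _ _) (ind _ _) (ind _ _) (ind _ _) (ind _ _) => *; clear; lia.
have nyu : (y == u) = false by rewrite eq_sym (negbTE nuy).
have nzu : (z == u) = false by rewrite eq_sym (negbTE nuz).
have nzy : (z == y) = false by rewrite eq_sym (negbTE nyz).
split=> //.
- move=> s t; rewrite /addw h1.
  rewrite [(t == u) && (s == y)]andbC [(t == y) && (s == u)]andbC [(t == u) && (s == z)]andbC.
  rewrite [(t == z) && (s == u)]andbC [(t == y) && (s == z)]andbC [(t == z) && (s == y)]andbC.
  by clear; lia_ind.
- move=> s; rewrite /addw h2 /ind.
  by case: eqP => [->|_] /=; rewrite ?(negbTE nuy) ?(negbTE nuz) ?andbF //=;
     case: eqP => [->|_] /=; rewrite ?(negbTE nyz) ?andbF.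
- move=> s t; rewrite /addw; have := h3 s t.
  have [/andP[/eqP -> /eqP ->]|_] := boolP ((s == u) && (t == y)).
    by rewrite ?eqxx ?(negbTE nuy) ?(negbTE nuz) ?(negbTE nyz) ?nyu ?nzu ?nzy /= ?andbF /ind /=; move: wy; clear; lia.
  have [/andP[/eqP -> /eqP ->]|_] := boolP ((s == y) && (t == u)).
    by rewrite ?eqxx ?(negbTE nuy) ?(negbTE nuz) ?(negbTE nyz) ?nyu ?nzu ?nzy /= ?andbF /ind /=; move: wy; rewrite h1; clear; lia.
  have [/andP[/eqP -> /eqP ->]|_] := boolP ((s == u) && (t == z)).
    by rewrite ?eqxx ?(negbTE nuy) ?(negbTE nuz) ?(negbTE nyz) ?nyu ?nzu ?nzy /= ?andbF /ind /=; move: wz; clear; lia.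
  have [/andP[/eqP -> /eqP ->]|_] := boolP ((s == z) && (t == u)).
    by rewrite ?eqxx ?(negbTE nuy) ?(negbTE nuz) ?(negbTE nyz) ?nyu ?nzu ?nzy /= ?andbF /ind /=; move: wz; rewrite h1; clear; lia.
  by rewrite /ind /=; case: ifP => _; case: ifP => _; clear; lia.
- move=> A /h8[m hm]; rewrite degE hm; clear; rewrite /ind.
  case: (u \in A); case: (y \in A); case: (z \in A) => /=;
    by [exists m; lia | exists (m - 1); lia].
- move=> A hA hA0 hAV hAex; rewrite degE.
  have [hc|[x ex]] := single_or hA0.
    have hs := hsl A hA hc hAV.
    by move: hs; clear; rewrite /ind; case: (u \in A); case: (y \in A); case: (z \in A) => /=; lia.
  have := h9 A hA hA0 hAV hAex; move: hAex; rewrite ex !inE => hAex.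
  have -> : (u == x) = false by apply/eqP => e; rewrite e eqxx in hAex.
  case: (y =P x) => [<-|_]; first by rewrite nzy /ind /=; clear; lia.
  by case: (z == x); rewrite /ind /=; clear; lia.
Qed.

End Ops.

(** * Removing a vertex and contracting a set *)

Section Contraction.
Variables (k : int) (U : finType).
Hypothesis k_gt0 : 0 < k.
Local Notation K := (2 * k).
Local Notation nrm := (dist_mul k).
Local Notation base := (@base k U).
Local Notation solvable := (@solvable k U).
Implicit Types (A B C V ex : {set U}) (o i rl rh : U -> int) (w : U -> U -> int).

Lemma cutDr w A B C : B \subset C -> cut w A C = cut w A B + cut w A (C :\: B).
Proof. by move=> h; rewrite /cut -smD; apply: eq_sm => x _; apply: sm_sub. Qed.

(** All edges at [u] end in [y], so moving [u] to the side of [y] reduces every cut condition of the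
    smaller instance to one of the larger. *)
Lemma remove_base V w o i rl rh u y :
  base V w o i rl rh [set u] -> u \in V -> y \in V -> u != y -> o u = 0 -> i u = 0 ->
  (forall z, z \in V -> z != y -> w u z = 0) ->
  base (V :\ u) w o i rl rh set0.
Proof.
case=> h1 h2 h3 h4 h5 h6 h7 h8 h9 [q h10] h11 hu hy nuy ou iu hz.
have [rlu rhu] : rl u = 0 /\ rh u = 0.
  case: h11 => [/eqP|[v [_ /set1_inj <-]]]; last by rewrite ou iu; clear; lia.
  by rewrite -cards_eq0 cards1.
have tr A : A \subset V :\ u -> exists A', [/\ A' \subset V, A \subset A', u |: A' = u |: A,
    deg (V :\ u) w o i A = deg V w o i A' & low rl o i A = low rl o i A'].
  move=> hA; have uA : u \notin A by apply/negP => /(subsetP hA); rewrite !inE eqxx.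
  have hAV : A \subset V by apply: subset_trans hA (subD1set _ _).
  case: (boolP (y \in A)) => yA.
    exists (u |: A); have hd : [disjoint [set u] & A] by rewrite disjoints1.
    split; rewrite ?subsetUr ?setUA ?setUid //.
    - by rewrite subUset sub1set hu.
    - rewrite /deg !smU // cutUl // !sm1 ou iu cut1l.
      have -> : V :\: (u |: A) = V :\ u :\: A.
        by apply/setP=> x; rewrite !inE; case: (x == u); case: (x \in A).
      rewrite [X in _ = X + _ + _](_ : _ = cut w A (V :\ u :\: A)); first by clear; lia.
      rewrite [X in X + _](_ : _ = 0) ?add0r // /sm big1 // => x.
      rewrite !inE => /andP[xA /andP[_ xV]]; apply: hz => //.
      by apply: contraNneq xA => ->.
    - by rewrite /low !smU // !sm1 ou iu rlu; clear; lia.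
  exists A; split=> //; rewrite /deg; congr (_ + _ + _).
  rewrite [RHS](cutDr w A (_ : V :\ u :\: A \subset V :\: A)); last first.
    by apply: setSD; apply: subD1set.
  rewrite [X in _ = _ + X](_ : _ = 0) ?addr0 //.
  rewrite /cut /sm big1 // => x xA; rewrite big1 // => z.
  rewrite !inE => /andP[h /andP[zA zV]].
  have -> : z = u by apply/eqP; move: h; rewrite zA zV /= andbT negbK.
  by rewrite h1 hz ?(subsetP hAV) //; apply: contraNneq yA => <-.
split=> //.
- by move=> x; rewrite !inE => /andP[_ /h6].
- by move=> x; rewrite !inE => /andP[_ /h7].
- by move=> A /tr[A' [hA' _ _ -> ->]]; apply: h8.
- move=> A hA hA0 hAV _; have [A' [hA' hs he -> ->]] := tr A hA; apply: h9 => //.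
  + by apply: contraNneq hA0 => e; rewrite e subset0 in hs.
  + apply: contraNneq hAV => e; rewrite e in he; apply/eqP.
    apply/setP=> x; have := congr1 (fun S : {set U} => x \in S) he; rewrite /= !inE.
    have := subsetP hA x; rewrite !inE; case: (x == u) => /=; first by case: (x \in A) => // /(_ isT).
    by move=> _ ->.
  + apply: contraNneq hA0 => e; rewrite e in hs; move: hs; rewrite subset1 => /orP[/eqP e'|//].
    by move: hA; rewrite e' sub1set !inE eqxx.
- by exists q; rewrite -h10 (smD1 _ hu) rlu add0r.
- by left.
Qed.

(** The parity condition at [u] makes the multiplicity of [u y] even; half of the copies are
    directed each way. *)
Lemma solve_remove V w o i rl rh u y :
  base V w o i rl rh [set u] -> u \in V -> y \in V -> u != y -> o u = 0 -> i u = 0 ->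
  (forall z, z \in V -> z != y -> w u z = 0) ->
  solvable (V :\ u) w rl rh -> solvable V w rl rh.
Proof.
case=> h1 h2 h3 h4 h5 h6 h7 h8 h9 _ h11 hu hy nuy ou iu hz [a [ha0 haw han]].
have [rlu rhu] : rl u = 0 /\ rh u = 0.
  case: h11 => [/eqP|[v [_ /set1_inj <-]]]; last by rewrite ou iu; clear; lia.
  by rewrite -cards_eq0 cards1.
have [m hm] : exists m, w u y = 2 * m.
  have [|m] := h8 [set u]; first by rewrite sub1set.
  rewrite deg1 low1 rlu ou iu (@smD1 _ _ y) ?inE 1?eq_sym ?nuy //.
  have -> : sm (w u) (V :\ u :\ y) = 0.
    by rewrite /sm big1 // => z; rewrite !inE => /and3P[zy _ zV]; apply: hz.
  by move=> e; exists m; move: e; clear; lia.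
have m0 : 0 <= m by have := h3 u y; rewrite hm; clear; lia.
exists (fun s t => if s == u then ind (t == y) m else if t == u then ind (s == y) m else a s t).
split.
- by move=> s t; have := ha0 s t; rewrite /ind; do 4?case: ifP => _ //.
- move=> s t hs ht; case: (s =P u) => [->|/eqP su]; case: (t =P u) => [->|/eqP tu].
  + by rewrite h2 (negbTE nuy).
  + by case: (t =P y) => [->|/eqP ty] /=; rewrite /ind ?hm ?hz //; clear; lia.
  + by rewrite h1; case: (s =P y) => [->|/eqP sy] /=; rewrite /ind ?hm ?hz //; clear; lia.
  + by apply: haw; rewrite !inE ?su ?tu.
- move=> x hx; case: (x =P u) => [->|/eqP xu].
    have -> : net (fun s t => if s == u then ind (t == y) m else if t == u then ind (s == y) m else a s t) V u = 0.
      rewrite /net /sm big1 // => t _; rewrite eqxx; case: (t =P u) => [->|_]; clear; lia.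
    by rewrite rlu rhu; split=> //; exists 0; clear; lia.
  have -> : net (fun s t => if s == u then ind (t == y) m else if t == u then ind (s == y) m else a s t) V x = net a (V :\ u) x.
    rewrite /net (smD1 _ hu) eqxx (negbTE xu) subrr add0r.
    by apply: eq_sm => t; rewrite !inE => /andP[/negbTE -> _].
  by apply: han; rewrite !inE xu.
Qed.

(** * Contraction of a set to one of its vertices *)

Section Quotient.
Variables (V B : {set U}) (b0 : U) (w : U -> U -> int).
Hypotheses (hb0 : b0 \in B) (hBV : B \subset V).
Hypothesis w_sym : forall x y, w x y = w y x.

(** The vertex [b0] of [B] stands for the whole of [B], which keeps the quotient on the type [U];
    [qpre] recovers the set of original vertices. *)
Definition qV : {set U} := b0 |: (V :\: B).
Definition qf (f : U -> int) v := if v == b0 then sm f B else f v.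
Definition qw s t := if s == b0 then (if t == b0 then 0 else sm (w t) B)
                     else if t == b0 then sm (w s) B else w s t.
Definition qr r (R : int) v : int := if v == b0 then R else (r v : int).
Definition qpre (A : {set U}) := if b0 \in A then A :|: B else A.

Lemma b0_qV : b0 \in qV. Proof. by rewrite !inE eqxx. Qed.

Lemma qV_sub : qV \subset V.
Proof. by rewrite subUset sub1set (subsetP hBV) //= subDset subsetUr. Qed.

Lemma qpre_sub A : A \subset qV -> qpre A \subset V.
Proof.
move=> h; have hA := subset_trans h qV_sub.
by rewrite /qpre; case: ifP => // _; rewrite subUset hA.
Qed.

Lemma qV_out A x : A \subset qV -> x \in A -> x != b0 -> x \notin B.
Proof. by move=> /subsetP h /h; rewrite !inE => /orP[->//|/andP[]]. Qed.

Lemma sm_qf f A : A \subset qV -> sm (qf f) A = sm f (qpre A).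
Proof.
move=> hA; rewrite /qpre; case: ifP => hb.
  have -> : A :|: B = B :|: (A :\ b0).
    apply/setP=> x; rewrite !inE; case: (x =P b0) => [->|_]; rewrite ?hb0 ?orbT //.
    by rewrite orbC.
  rewrite smU; last first.
    rewrite disjoint_sym disjoints_subset; apply/subsetP=> x; rewrite !inE => /andP[xb xA].
    exact: qV_out hA xA xb.
  rewrite (smD1 _ hb) /qf eqxx; congr (_ + _).
  by apply: eq_sm => x; rewrite !inE => /andP[/negbTE -> _].
by apply: eq_sm => x xA; rewrite /qf; case: eqP => // e; rewrite -e xA in hb.
Qed.

Lemma sm_qr r R A : A \subset qV -> sm (qr r R) A = sm r (qpre A) + ind (b0 \in A) (R - sm r B).
Proof.
move=> hA; rewrite -sm_qf // -sm_ind -smD; apply: eq_sm => x _.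
by rewrite /qr /qf /ind; case: (x == b0); clear; lia.
Qed.

Lemma cut_qw A : A \subset qV -> cut qw A (qV :\: A) = cut w (qpre A) (V :\: qpre A).
Proof.
move=> hA; rewrite /qpre; case: ifP => hb.
  have eE : qV :\: A = V :\: (A :|: B).
    apply/setP=> x; rewrite !inE; case: (x =P b0) => [->|_] /=; last by case: (x \in A).
    by rewrite hb.
  have eA : A :|: B = B :|: (A :\ b0).
    apply/setP=> x; rewrite !inE; case: (x =P b0) => [->|_]; rewrite ?hb0 ?orbT //.
    by rewrite orbC.
  rewrite eE; set E := V :\: (A :|: B).
  rewrite eA cutUl; last first.
    rewrite disjoint_sym disjoints_subset; apply/subsetP=> x; rewrite !inE => /andP[xb xA].
    exact: qV_out hA xA xb.
  have hE x : x \in E -> x != b0.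
    by rewrite !inE => /andP[h _]; apply: contraNneq h => ->; rewrite hb.
  transitivity (sm (qw b0) E + cut qw (A :\ b0) E).
    exact: (smD1 (fun x => sm (qw x) E) hb).
  congr (_ + _).
    rewrite [RHS](cutC _ _ w_sym); apply: eq_sm => t /hE/negbTE ht.
    by rewrite /qw eqxx ht.
  apply: eq_cut => x y hx /hE/negbTE yb; move: hx; rewrite !inE => /andP[/negbTE xb _].
  by rewrite /qw xb yb.
have eE : qV :\: A = b0 |: (V :\: B :\: A).
  by apply/setP=> x; rewrite !inE; case: (x =P b0) => [->|_] //=; rewrite hb.
have eV : V :\: A = B :|: (V :\: B :\: A).
  apply/setP=> x; rewrite !inE; case: (boolP (x \in B)) => [xB|_] //=.
  rewrite (subsetP hBV) // andbT; apply/negP => xA.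
  have xb : x != b0 by apply: contraTneq xA => ->; rewrite hb.
  by have := qV_out hA xA xb; rewrite xB.
rewrite eE eV cutUr; last by rewrite disjoints1 !inE hb0 andbF.
rewrite cutUr; last first.
  by rewrite disjoints_subset; apply/subsetP=> x xB; rewrite !inE xB andbF.
have hAb x : x \in A -> (x == b0) = false by move=> xA; apply/eqP => e; rewrite -e xA in hb.
congr (_ + _).
  by apply: eq_sm => x /hAb xb; rewrite sm1 /qw xb eqxx.
apply: eq_cut => x y /hAb xb; rewrite !inE => /and3P[_ yB _]; rewrite /qw xb.
by case: eqP => // e; rewrite e hb0 in yB.
Qed.

Lemma deg_q o i A : A \subset qV ->
  deg qV qw (qf o) (qf i) A = deg V w o i (qpre A).
Proof. by move=> hA; rewrite /deg cut_qw // !sm_qf. Qed.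

Lemma low_q r R o i A : A \subset qV ->
  low (qr r R) (qf o) (qf i) A = low r o i (qpre A) + ind (b0 \in A) (R - sm r B).
Proof. by move=> hA; rewrite /low sm_qr // !sm_qf //; clear; lia. Qed.

Lemma card_qV : (1 < #|B|)%N -> (#|qV| < #|V|)%N.
Proof.
move=> h; apply: proper_card; rewrite properE qV_sub /=.
have [x /andP[xb xB]] : exists x, (x != b0) && (x \in B).
  move: h; rewrite (cardsD1 b0) hb0 ltnS card_gt0 => /set0Pn[x].
  by rewrite !inE => h; exists x.
apply/negP => /subsetP/(_ x (subsetP hBV _ xB)).
by rewrite !inE (negbTE xb) xB.
Qed.

Lemma outer_base o i rl rh ex R1 R2 : base V w o i rl rh ex -> (1 < #|B|)%N ->
  R1 + sm i B <= sm o B <= R2 + sm i B ->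
  (exists j, R1 = sm rl B + K * j) -> (exists j, R2 = R1 + K * j) ->
  base qV qw (qf o) (qf i) (qr rl R1) (qr rh R2) (if ex \subset B then set0 else ex).
Proof.
case=> h1 h2 h3 h4 h5 h6 h7 h8 h9 [q h10] h11 cB hs [j hj] [j' hj'].
have lowE A : A \subset qV -> low (qr rl R1) (qf o) (qf i) A
   = low rl o i (qpre A) + K * ind (b0 \in A) j.
  by move=> hA; rewrite low_q // hj /ind; case: (b0 \in A); clear; lia.
have qV_in x : x \in qV -> x != b0 -> x \in V by move=> /(subsetP qV_sub).
split=> //.
- by move=> x y; rewrite /qw; case: eqP; case: eqP => // _ _; rewrite w_sym.
- by move=> x; rewrite /qw; case: eqP.
- by move=> x y; rewrite /qw; do 2!case: eqP => // _; apply: sm_ge0.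
- by move=> x; rewrite /qf; case: eqP => // _; apply: sm_ge0.
- by move=> x; rewrite /qf; case: eqP => // _; apply: sm_ge0.
- by move=> x hx; rewrite /qr /qf; case: eqP => // /eqP xb; apply: h6; apply: qV_in.
- move=> x hx; rewrite /qr; case: eqP => [_|/eqP xb]; first by exists j'.
  by apply: h7; apply: qV_in.
- move=> A hA; have [m hm] := h8 _ (qpre_sub hA); exists (m - k * ind (b0 \in A) j).
  by rewrite deg_q // lowE // hm; move: (ind _ _); clear => *; lia.
- move=> A hA hA0 hAV hAex; rewrite deg_q // lowE // nrmMD //; apply: h9.
  + exact: qpre_sub.
  + apply: contraNneq hA0; rewrite /qpre; case: ifP => _ /eqP //.
    by rewrite setU_eq0 => /andP[].
  + apply: contraNneq hAV; rewrite /qpre; case: ifP => hb e; last first.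
      by have := subsetP hBV b0 hb0; rewrite -e hb.
    apply/eqP; apply/setP=> x; apply/idP/idP => [/(subsetP hA)//|].
    rewrite !inE => /orP[/eqP -> //|/andP[xB]]; rewrite -e !inE (negbTE xB) orbF //.
  (* A preimage that contains [B] has at least two elements and cannot be the exempt set. *)
  + apply/eqP => e; case: (boolP (b0 \in A)) => hb.
      have : (1 < #|ex|)%N.
        by rewrite -e /qpre hb; apply: leq_trans cB _; apply: subset_leq_card; apply: subsetUr.
      by case: h11 => [->|[u [_ -> _ _]]]; rewrite ?cards0 ?cards1.
    have eA : ex = A by rewrite -e /qpre (negbTE hb).
    move: hAex; rewrite eA; case: ifP => hs'; rewrite ?eqxx // => _.
    have /set0Pn[x xA] := hA0; have := qV_out hA xA; rewrite (subsetP hs' _ xA).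
    by case: eqP => [e1|_ /(_ isT)//]; rewrite -e1 xA in hb.
- exists (q + j); rewrite sm_qr // /qpre b0_qV /ind.
  have -> : qV :|: B = V.
    apply/setP=> x; rewrite !inE; case: (boolP (x \in B)) => [/(subsetP hBV) ->|]; rewrite ?orbT ?orbF //=.
    by case: eqP => // -> ; rewrite hb0.
  by rewrite h10 hj; clear; lia.
- case: h11 => [->|[u [hu -> el eh]]]; first by left; rewrite sub0set.
  case: ifP; rewrite sub1set => uB; [by left | right; exists u].
  have ub : (u == b0) = false by apply/eqP => e; rewrite e hb0 in uB.
  by rewrite /qr /qf ub; split=> //; rewrite !inE uB hu orbT.
Qed.

(** Once the boundary of [B] is oriented, the outside acts as the root: of the edges from [b] to the
    outside, [p b] leave [b] and [q b] enter it. Each of them still counts for every subset of [B]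
    that contains [b]. *)
Lemma inner_deg o i (p q : U -> int) A : A \subset B ->
  (forall b, b \in B -> p b + q b = sm (w b) (V :\: B)) ->
  deg B w (fun x => o x + q x) (fun x => i x + p x) A = deg V w o i A.
Proof.
move=> hA hpq; rewrite /deg !smD (cutDr w A (_ : B :\: A \subset V :\: A)); last exact: setSD.
have -> : V :\: A :\: (B :\: A) = V :\: B.
  apply/setP=> x; rewrite !inE; case: (boolP (x \in A)) => [/(subsetP hA) ->|_] //=.
have : sm p A + sm q A = cut w A (V :\: B).
  by rewrite -smD; apply: eq_sm => x /(subsetP hA); apply: hpq.
by clear; lia.
Qed.

Lemma inner_low r o i (p q : U -> int) A :
  low (fun x => r x - (p x - q x)) (fun x => o x + q x) (fun x => i x + p x) A = low r o i A.
Proof. by rewrite /low !smB !smD; clear; lia. Qed.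

Lemma inner_base o i rl rh ex (p q : U -> int) : base V w o i rl rh ex ->
  B != V -> (forall x, 0 <= p x) -> (forall x, 0 <= q x) ->
  (forall b, b \in B -> p b + q b = sm (w b) (V :\: B)) ->
  (exists j, sm p B - sm q B = sm rl B + K * j) ->
  base B w (fun x => o x + q x) (fun x => i x + p x) (fun x => rl x - (p x - q x))
    (fun x => rh x - (p x - q x)) (if ex \subset B then ex else set0).
Proof.
case=> h1 h2 h3 h4 h5 h6 h7 h8 h9 h10 h11 nBV hp hq hpq [j hj]; split=> //.
- by move=> x; have := h4 x; have := hq x; clear; lia.
- by move=> x; have := h5 x; have := hp x; clear; lia.
- by move=> x /(subsetP hBV)/h6; clear; lia.
- by move=> x /(subsetP hBV)/h7[m ->]; exists m; clear; lia.
- by move=> A hA; rewrite inner_deg // inner_low; apply: h8; apply: subset_trans hA hBV.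
- move=> A hA hA0 hAB hAex; rewrite inner_deg // inner_low; apply: h9 => //.
  + exact: subset_trans hA hBV.
  + apply: contraNneq nBV => e; rewrite eqEsubset hBV -e //.
  + by apply: contraNneq hAex => e; rewrite -e hA.
- by exists (- j); rewrite !smB; move: hj; clear; lia.
- case: ifP => hex; last by left.
  case: h11 => [->|[u [hu e el eh]]]; [by left | right; exists u].
  split=> //; first by move: hex; rewrite e sub1set.
    by move: el; clear; lia.
  by move: eh; clear; lia.
Qed.

Lemma split_total (f : U -> int) (t : int) A : (forall x, x \in A -> 0 <= f x) ->
  0 <= t <= sm f A -> exists g : U -> int,
  (forall x, x \in A -> 0 <= g x <= f x) /\ sm g A = t.
Proof.
elim: {A}_.+1 {-2}A (ltnSn #|A|) t => // n IH A hn t hf ht.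
have [eA|[x hx]] := set_0Vmem A.
  exists (fun=> 0); split; first by move=> x; rewrite eA inE.
  by move: ht; rewrite eA !sm0; clear; lia.
pose t1 := Order.min t (f x).
have [|||g [hg hs]] := IH (A :\ x) _ (t - t1).
- by move: hn; rewrite (cardsD1 x A) hx.
- by move=> y; rewrite !inE => /andP[_ /hf].
- have : 0 <= sm f (A :\ x) by apply: sm_ge0 => y; rewrite !inE => /andP[_ /hf].
  by move: ht; rewrite (smD1 _ hx) /t1; have := hf x hx; clear; lia.
exists (fun y => if y == x then t1 else g y); split.
- move=> y yA; case: eqP => [->|/eqP yx]; last by apply: hg; rewrite !inE yx.
  by have := hf x hx; move: ht; rewrite /t1; clear; lia.
- rewrite (smD1 _ hx) eqxx -[RHS](subrKC t1) -hs; congr (_ + _).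
  by apply: eq_sm => y; rewrite !inE => /andP[/negbTE ->].
Qed.

(** A solution of the quotient only tells how many edges between [B] and [y] are directed to [y].
    These are distributed over the actual edges, and any distribution is left to the inner instance,
    which therefore has to be solvable for all boundary orientations in question. *)
Lemma glue rl rh R1 R2 : (forall x y, 0 <= w x y) -> (forall x, w x x = 0) ->
  solvable qV qw (qr rl R1) (qr rh R2) ->
  (forall p q : U -> int, (forall x, 0 <= p x) -> (forall x, 0 <= q x) ->
    (forall b, b \in B -> p b + q b = sm (w b) (V :\: B)) ->
    R1 <= sm p B - sm q B <= R2 -> (exists j, sm p B - sm q B = R1 + K * j) ->
    solvable B w (fun x => rl x - (p x - q x)) (fun x => rh x - (p x - q x))) ->
  solvable V w rl rh.
Proof.
move=> w0 wd [a [ha0 haw han]] hin.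
(* Here [f y b] is the number of arcs from [b] to [y]. *)
have [f hf] : exists f : U -> U -> int, forall y, y \in V :\: B ->
    (forall b, b \in B -> 0 <= f y b <= w b y) /\ sm (f y) B = a b0 y.
  apply: (@fin_all_exists _ _ (fun y g => y \in V :\: B ->
    (forall b, b \in B -> 0 <= g b <= w b y) /\ sm g B = a b0 y)) => y.
  case: (boolP (y \in V :\: B)) => hy; last by exists (fun=> 0).
  have hyq : y \in qV by move: hy; rewrite !inE => ->; rewrite orbT.
  have yb : (y == b0) = false by apply/eqP => e; move: hy; rewrite e !inE hb0.
  have [|g hg] := @split_total (fun b => w b y) (a b0 y) B (fun b _ => w0 b y).
    have := haw _ _ b0_qV hyq; rewrite /qw eqxx yb.
    rewrite (eq_sm (g := fun b => w b y)) => [|b _]; last exact: w_sym.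
    by have := ha0 b0 y; have := ha0 y b0; clear; lia.
  by exists g.
pose p x := if x \in B then sm (fun y => f y x) (V :\: B) else 0.
pose q x := if x \in B then sm (fun y => w x y - f y x) (V :\: B) else 0.
have hpq b : b \in B -> p b + q b = sm (w b) (V :\: B).
  by move=> bB; rewrite /p /q bB -smD; apply: eq_sm => y _; clear; lia.
have p0 x : 0 <= p x.
  rewrite /p; case: ifP => // xB; apply: sm_ge0 => y /hf[h _].
  by have := h x xB; clear; lia.
have q0 x : 0 <= q x.
  rewrite /q; case: ifP => // xB; apply: sm_ge0 => y /hf[h _].
  by have := h x xB; clear; lia.
have netb : net a qV b0 = sm p B - sm q B.
  rewrite /net /qV smU ?disjoints1 ?inE ?hb0 // sm1 subrr add0r.
  transitivity (sm (fun y => sm (fun b => f y b - (w b y - f y b)) B) (V :\: B)).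
    apply: eq_sm => y hy; have [h1 h2] := hf y hy.
    have hyq : y \in qV by move: hy; rewrite !inE => ->; rewrite orbT.
    have yb : (y == b0) = false by apply/eqP => e; move: hy; rewrite e !inE hb0.
    have := haw _ _ b0_qV hyq; rewrite /qw eqxx yb smB smB h2.
    rewrite (eq_sm (g := fun b => w b y)) => [|b _]; last exact: w_sym.
    by clear; lia.
  rewrite -smB /sm exchange_big /=; apply: eq_bigr => b bB.
  by rewrite /p /q bB -smB.
have [h1 [j hj]] := han b0 b0_qV; rewrite netb /qr eqxx in h1 hj.
have [a' [ha'0 ha'w ha'n]] := hin p q p0 q0 hpq h1 (ex_intro _ j hj).
exists (fun s t => if (s \in V) && (t \in V) then
    if s \in B then (if t \in B then a' s t else f t s)
    else (if t \in B then w s t - f s t else a s t) else 0).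
split.
- move=> s t; case: (boolP (s \in V)) => // sV; case: (boolP (t \in V)) => //= tV.
  case: (boolP (s \in B)) => sB; case: (boolP (t \in B)) => tB //=.
    by have [|h _] := hf t; rewrite ?inE ?tB // ; have := h s sB; clear; lia.
  have [|h _] := hf s; first by rewrite inE sB.
  by have := h t tB; rewrite w_sym; clear; lia.
- move=> s t sV tV; rewrite sV tV /=.
  case: (boolP (s \in B)) => sB; case: (boolP (t \in B)) => tB //=.
  + exact: ha'w.
  + by rewrite w_sym; clear; lia.
  + by clear; lia.
  + rewrite haw ?inE ?sB ?tB ?sV ?tV ?orbT // /qw.
    have -> : (s == b0) = false by apply/eqP => e; rewrite e hb0 in sB.
    by have -> : (t == b0) = false by apply/eqP => e; rewrite e hb0 in tB.
move=> x xV; rewrite /net.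
set g := (X in sm X V).
have -> : sm g V = if x \in B then net a' B x + (p x - q x) else net a qV x.
  rewrite (sm_sub g hBV); case: ifP => xB.
    congr (_ + _).
      by apply: eq_sm => y yB; rewrite /g xV xB yB (subsetP hBV _ yB).
    rewrite /p /q xB -smB; apply: eq_sm => y; rewrite inE => /andP[/negbTE yB yV].
    by rewrite /g xV yV xB yB /= [w y x]w_sym.
  have hx : x \in V :\: B by rewrite inE xB.
  have xb : (x == b0) = false by apply/eqP => e; rewrite e hb0 in xB.
  have [hx1 hx2] := hf x hx.
  rewrite /net /qV smU ?disjoints1 ?inE ?hb0 // sm1; congr (_ + _).
    have hxq : x \in qV by rewrite !inE xB xV orbT.
    have := haw _ _ b0_qV hxq; rewrite /qw eqxx xb -hx2.
    move=> e; have -> : a x b0 = sm (w x) B - sm (f x) B by move: e; clear; lia.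
    rewrite -!smB; apply: eq_sm => y yB.
    by rewrite /g xV (subsetP hBV _ yB) xB yB.
  apply: eq_sm => y; rewrite inE => /andP[/negbTE yB yV].
  by rewrite /g xV yV xB yB.
case: ifP => xB.
  by have [h [j' hj']] := ha'n x xB; split; [move: h; clear; lia | exists j'; rewrite hj'; clear; lia].
have := han x; rewrite !inE xB xV orbT => /(_ isT); rewrite /qr.
by have -> : (x == b0) = false by apply/eqP => e; rewrite e hb0 in xB.
Qed.

End Quotient.
End Contraction.

(** * Contraction of tight sets *)

Section Tight.
Variables (k : int) (U : finType).
Hypothesis k_gt0 : 0 < k.
Local Notation K := (2 * k).
Local Notation nrm := (dist_mul k).
Local Notation base := (@base k U).
Local Notation rooted := (@rooted k U).
Local Notation dom := (@dom k U).
Local Notation solvable := (@solvable k U).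
Implicit Types (A B C V ex : {set U}) (o i rl rh p q : U -> int) (w : U -> U -> int).

Lemma eq_dom V o i rl rl' : {in V, rl =1 rl'} -> dom V o i rl -> dom V o i rl'.
Proof.
move=> e [h|[x [hx h1 h2]]]; [by left | right; exists x; split=> //].
by rewrite -e.
Qed.

Lemma qpre_qV V B b0 : b0 \in B -> B \subset V -> qpre B b0 (qV V B b0) = V.
Proof.
move=> hb0 hBV; rewrite /qpre b0_qV; apply/setP=> x; rewrite !inE.
case: (boolP (x \in B)) => [/(subsetP hBV) ->|]; rewrite ?orbT ?orbF //=.
by case: eqP => // -> ; rewrite hb0.
Qed.

Lemma sm_qfV V B b0 (f : U -> int) : b0 \in B -> B \subset V ->
  sm (qf B b0 f) (qV V B b0) = sm f V.
Proof. by move=> hb0 hBV; rewrite (@sm_qf _ V) // qpre_qV. Qed.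

Lemma low_le1 o i rl A x : (forall y, y \in A -> rl y + i y <= o y) -> x \in A ->
  low rl o i A <= rl x + i x - o x.
Proof.
move=> h hx; have := @le1_sm U (fun y => o y - rl y - i y) A x.
have -> : sm (fun y => o y - rl y - i y) A = - low rl o i A by rewrite /low !smB; clear; lia.
move=> /(_ _ hx) h'; suff : o x - rl x - i x <= - low rl o i A by clear; lia.
by apply: h' => y /h; clear; lia.
Qed.

Lemma outer_dom V B b0 o i rl l : b0 \in B -> B \subset V -> (forall x, 0 <= o x) ->
  dom V o i rl ->
  (forall x, x \in B -> sm o V - sm i V - K <= o x ->
     rl x + i x - o x < K - (sm o V - sm i V) -> K <= sm o V - sm i V -> l < K - (sm o V - sm i V)) ->
  dom (qV V B b0) (qf B b0 o) (qf B b0 i) (qr b0 rl (l + sm o B - sm i B)).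
Proof.
move=> hb0 hBV ho hd hl; rewrite /dom !sm_qfV //.
have [hN|hN] := ltrP (sm o V - sm i V) K; first by left.
case: hd => [|[x [hx h1 h2]]]; first by move: hN; clear; lia.
right; case: (boolP (x \in B)) => xB.
  exists b0; rewrite b0_qV /qf /qr eqxx; split=> //.
    by apply: le_trans h1 _; apply: le1_sm.
  by have := hl x xB h1 h2 hN; clear; lia.
exists x; have xb : (x == b0) = false by apply/eqP => e; rewrite e hb0 in xB.
by rewrite /qf /qr xb !inE xB hx orbT.
Qed.

(** The residual lower bound [l] for the contracted vertex must be low enough for [dom] in the
    quotient, yet so high that no admissible orientation of the boundary creates a root excess in
    [B] that no vertex can take. *)
Lemma tight_low V B b0 o i rl :
  b0 \in B -> B \subset V -> (forall x, 0 <= o x) -> (forall x, 0 <= i x) ->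
  (forall x, x \in V -> rl x + i x <= o x) ->
  sm o V + sm i V <= K + nrm (sm o V - sm i V) -> dom V o i rl ->
  exists l, [/\ exists j, l = low rl o i B + K * j, l <= 0,
    dom (qV V B b0) (qf B b0 o) (qf B b0 i) (qr b0 rl (l + sm o B - sm i B)) &
    forall p q, (forall x, 0 <= p x) -> (forall x, 0 <= q x) ->
      l <= sm p B - sm q B + sm i B - sm o B ->
      (exists j, sm p B - sm q B + sm i B - sm o B = low rl o i B + K * j) ->
      dom B (fun x => o x + q x) (fun x => i x + p x) (fun x => rl x - (p x - q x))].
Proof.
move=> hb0 hBV ho hi hs hr hd.
have [j [p0 [e p00 p0K]]] := divK k_gt0 (- low rl o i B).
set N := sm o V - sm i V in hr hd *.
have loB : {in B, forall y, rl y + i y <= o y} by move=> y /(subsetP hBV)/hs.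
have hiV : 0 <= sm i V by apply: sm_ge0.
have eps : N < K + k + 1.
  have := nrm_le k_gt0 N 1; have := nrm_le k_gt0 N 2; move: hr hiV k_gt0; rewrite /N; clear; lia.
(* The default is [- p0], the largest nonpositive representative of the demand of [B]; it keeps the
   inner excess below [K]. If the vertex [x] that takes the excess lies in [B] and [- p0] is too
   large for the quotient, the bound is lowered by [K]; an inner excess of at least [K] is then
   exactly [K + p0], and [x] takes it as well. *)
have [/existsP[x /and5P[xB h1 h2 h3 h4]]|hn] := boolP [exists x, [&& x \in B, N - K <= o x,
     rl x + i x - o x < K - N, K <= N & K - N <= - p0]].
  exists (- p0 - K); split.
  - by exists (j - 1); move: e; clear; lia.
  - by move: p00 k_gt0; clear; lia.
  - by apply: outer_dom => // *; rewrite -/N; move: eps p00 k_gt0; clear; lia.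
  - move=> p q hp hq hl [j' hj']; rewrite /dom !smD.
    have [hc|hc] := ltrP (sm o B + sm q B - (sm i B + sm p B)) K; first by left.
    right; exists x; split=> //.
      have -> : sm o B + sm q B - (sm i B + sm p B) = K + p0.
        have e1 : sm p B - sm q B + sm i B - sm o B = - p0 + K * (j' - j).
          by rewrite hj'; move: e; clear; lia.
        have h5 : -1 <= j' - j.
          have [|h5] := lerP (-1) (j' - j) => //.
          by have := @K_mul_le k k_gt0 (j' - j + 1); move: h5 hl e1 k_gt0; clear; lia.
        have h6 : j' - j <= -1.
          have [|h6] := lerP (j' - j) (-1) => //.
          by have := @mulr_ge0 _ K (j' - j); move: h6 hc e1 p0K k_gt0; clear; lia.
        have h7 : j' - j = -1 by move: h5 h6; clear; lia.
        by move: e1; rewrite h7; clear; lia.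
      by have := hq x; move: h1 h4; clear; lia.
    by move: h2 h4 hc hl; clear; lia.
exists (- p0); split.
- by exists j; move: e; clear; lia.
- by move: p00; clear; lia.
- apply: outer_dom => // x xB h1 h2 h3; rewrite ltNge; apply: contra hn => h4.
  by apply/existsP; exists x; rewrite xB h1 h2 h3 h4.
- move=> p q hp hq hl _; left; rewrite !smD.
  by move: hl p0K; clear; lia.
Qed.

Lemma contract_solve V w o i rl rh ex B b0 R1 R2 :
  (forall V', (#|V'| < #|V|)%N -> forall w o i rl rh ex,
     base V' w o i rl rh ex -> rooted V' o i rl rh -> solvable V' w rl rh) ->
  base V w o i rl rh ex -> rooted V o i rl rh ->
  B \subset V -> (1 < #|B|)%N -> b0 \in B ->
  R1 + sm i B <= sm o B <= R2 + sm i B ->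
  (exists j, R1 = sm rl B + K * j) -> (exists j, R2 = R1 + K * j) ->
  dom (qV V B b0) (qf B b0 o) (qf B b0 i) (qr b0 rl R1) ->
  dom (qV V B b0) (qf B b0 i) (qf B b0 o) (qr b0 (fun x => - rh x) (- R2)) ->
  (forall p q, (forall x, 0 <= p x) -> (forall x, 0 <= q x) ->
    (forall b, b \in B -> p b + q b = sm (w b) (V :\: B)) ->
    R1 <= sm p B - sm q B <= R2 -> (exists j, sm p B - sm q B = R1 + K * j) ->
    solvable B w (fun x => rl x - (p x - q x)) (fun x => rh x - (p x - q x))) ->
  solvable V w rl rh.
Proof.
move=> IH hb hr hBV cB hb0 hs hR1 hR2 d1 d2 hin.
apply: (glue hb0 hBV (b_sym hb) (b_w0 hb) (b_diag hb) (R1 := R1) (R2 := R2)) => //.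
apply: (IH _ (card_qV hb0 hBV cB)) (outer_base k_gt0 hb0 hBV (b_sym hb) hb cB hs hR1 hR2) _.
split=> //; first by rewrite !sm_qfV //; apply: r_root hr.
by apply: eq_dom d2 => x _; rewrite /qr; case: eqP.
Qed.

(** The root of the inner instance has degree [deg V w o i B], and its imbalance is minus the demand
    of [B] modulo [K]; tightness is therefore the root condition of the inner instance. *)
Lemma tight_contract V w o i rl rh ex B :
  (forall V', (#|V'| < #|V|)%N -> forall w o i rl rh ex,
     base V' w o i rl rh ex -> rooted V' o i rl rh -> solvable V' w rl rh) ->
  base V w o i rl rh ex -> rooted V o i rl rh ->
  B \subset V -> (1 < #|B|)%N -> B != V ->
  deg V w o i B <= K + nrm (low rl o i B) -> solvable V w rl rh.
Proof.
move=> IH hb hr hBV cB nBV hd.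
have [b0 hb0] : exists b0, b0 \in B by apply/set0Pn; rewrite -card_gt0 ltnW.
have [l [hl1 hl2 hl3 hl4]] := tight_low hb0 hBV (b_o0 hb) (b_i0 hb)
  (fun x hx => proj1 (andP (b_str hb hx))) (r_root hr) (r_out hr).
have hm := rooted_mirror k_gt0 hr; have hbm := base_mirror k_gt0 hb.
have [h [hh1 hh2 hh3 hh4]] := tight_low hb0 hBV (b_i0 hb) (b_o0 hb)
  (fun x hx => proj1 (andP (b_str hbm hx))) (r_root hm) (r_out hm).
have [g hg] := sm_gap k_gt0 (b_gap hb) hBV.
have [j1 e1] := hl1; have [j2 e2] := hh1; rewrite /low smN in e2; rewrite /low in e1.
apply: (contract_solve IH hb hr hBV cB hb0 (R1 := l + sm o B - sm i B)
   (R2 := - h + sm o B - sm i B)) => //.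
- by move: hl2 hh2; clear; lia.
- by exists j1; rewrite e1; clear; lia.
- by exists (g - j1 - j2); rewrite e1 e2 hg; clear; lia.
- have -> // : - (- h + sm o B - sm i B) = h + sm i B - sm o B by clear; lia.
move=> p q p0 q0 hpq hR [j hj].
have cong : exists j, sm p B - sm q B + sm i B - sm o B = low rl o i B + K * j.
  by exists (j1 + j); rewrite /low; move: hj e1; clear; lia.
apply: (IH B) (inner_base hBV hb nBV p0 q0 hpq _) _.
- by apply: proper_card; rewrite properEneq nBV.
- by have [m hm'] := cong; exists m; move: hm'; rewrite /low; clear; lia.
split.
- have := @inner_deg U V B w hBV o i p q B (subxx _) hpq.
  rewrite /deg setDv cut0r add0r => ->.
  apply: le_trans hd _; rewrite lerD2l !smD.
  have [m hm'] := cong.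
  have -> : sm o B + sm q B - (sm i B + sm p B) = - (low rl o i B + K * m).
    by move: hm'; clear; lia.
  by rewrite nrmN // nrmMD.
- by apply: hl4 => //; move: hR; clear; lia.
- have cong' : exists j, sm q B - sm p B + sm o B - sm i B = low (fun x => - rh x) i o B + K * j.
    have [m hm'] := cong; exists (g - m); rewrite /low smN hg.
    by move: hm'; rewrite /low; clear; lia.
  have := hh4 q p q0 p0 _ cong'.
  have h5 : h <= sm q B - sm p B + sm o B - sm i B by move: hR; clear; lia.
  by move=> /(_ h5); apply: eq_dom => x _; clear; lia.
Qed.

End Tight.

(** * Reduction steps of the modular orientation theorem *)

Ltac lia_n := clear; repeat match goal with
  | |- context [dist_mul ?k ?z] => move: (dist_mul k z) => ?
  | |- context [@deg ?U ?V ?w ?o ?i ?A] => move: (@deg U V w o i A) => ?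
  end; lia.

Section Step.
Variables (k : int) (U : finType).
Hypothesis k_gt0 : 0 < k.
Local Notation K := (2 * k).
Local Notation nrm := (dist_mul k).
Local Notation base := (@base k U).
Local Notation rooted := (@rooted k U).
Local Notation dom := (@dom k U).
Local Notation slack := (@slack k U).
Local Notation solvable := (@solvable k U).
Implicit Types (A B C V ex : {set U}) (o i rl rh : U -> int) (w : U -> U -> int).

(** At such a vertex, lowering the demand by one brings it closer to a multiple of [K]. Residue [k]
    belongs to this class and to its mirror image. *)
Definition pos r o i (v : U) := 1 <= ((r v + i v - o v) %% K)%Z <= k.
Definition zero r o i (v : U) := ((r v + i v - o v) %% K)%Z == 0.

Definition hered V := forall V', (#|V'| < #|V|)%N -> forall w o i rl rh ex,
  base V' w o i rl rh ex -> rooted V' o i rl rh -> solvable V' w rl rh.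

Record state V w o i rl rh ex : Prop := State {
  s_base : base V w o i rl rh ex;
  s_slack : slack V w o i rl;
  s_root : rooted V o i rl rh;
  s_card : (1 < #|V|)%N;
  s_IH : forall w' o' i' rl' rh' ex', (mu V w' o' i' < mu V w o i)%N ->
    base V w' o' i' rl' rh' ex' -> rooted V o' i' rl' rh' -> solvable V w' rl' rh'
}.

Lemma modE (z : int) : exists q, z = K * q + (z %% K)%Z /\ 0 <= (z %% K)%Z < K.
Proof.
have [q [p [-> p0 pK]]] := divK k_gt0 z; exists q.
by rewrite mulrC modzMDl modz_small //; move: p0 pK; clear; lia.
Qed.

Lemma state_mirror V w o i rl rh ex : state V w o i rl rh ex ->
  state V w i o (fun x => - rh x) (fun x => - rl x) ex.
Proof.
case=> h1 h2 h3 h4 h5; split=> //.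
- exact: base_mirror.
- by apply: slack_mirror (b_gap h1) h2.
- exact: rooted_mirror.
- by move=> w' o' i' rl' rh' ex'; rewrite (mu_mirror V w); apply: h5.
Qed.

Lemma nrm_congr (z z' q : int) : z' = z + K * q -> nrm z' = nrm z.
Proof. by move=> ->; rewrite nrmMD. Qed.

(** Both residual bounds have the same nonzero residue, so neither is zero and zero lies strictly
    between them. *)
Lemma posP V w o i rl rh ex v : base V w o i rl rh ex -> v \in V -> pos rl o i v ->
  [/\ rl v + i v - o v < 0, 1 <= rh v + i v - o v,
      nrm (rl v + i v - o v - 1) = nrm (rl v + i v - o v) - 1 & 1 <= nrm (rl v + i v - o v)].
Proof.
move=> hb hv; have := b_str hb hv; have [j hj] := b_gap hb hv.
rewrite /pos; have [q []] := modE (rl v + i v - o v).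
set z := (_ %% _)%Z => e hz hs hp.
have n1 : nrm (rl v + i v - o v) = z by rewrite e nrm_near //; move: hp; clear; lia.
have n2 : nrm (rl v + i v - o v - 1) = z - 1.
  by rewrite (_ : _ - 1 = K * q + (z - 1)) ?nrm_near //; move: hp e; clear; lia.
split.
- have [|h] := ltrP (rl v + i v - o v) 0; first by [].
  suff : K * q = 0 by move: h hs e hp; clear; lia.
  apply/eqP; rewrite eq_le K_mul_neg ?K_mul_pos //; move: h hs e hp hz; clear; lia.
- have := @K_mul_pos k k_gt0 (q + j); move: hs e hj hp k_gt0; clear; lia.
- by rewrite n1 n2.
- by rewrite n1; move: hp; clear; lia.
Qed.

Lemma pos_mirrorP V w o i rl rh ex v : base V w o i rl rh ex -> v \in V ->
  pos (fun x => - rh x) i o v ->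
  [/\ rl v + i v - o v <= -1, 0 < rh v + i v - o v,
      nrm (rl v + i v - o v + 1) = nrm (rl v + i v - o v) - 1 & 1 <= nrm (rl v + i v - o v)].
Proof.
move=> hb hv hp; have [h1 h2 h3 h4] := posP (base_mirror k_gt0 hb) hv hp.
have [j hj] := b_gap hb hv.
have e1 : nrm (rl v + i v - o v + 1) = nrm (- rh v + o v - i v - 1).
  by rewrite -(nrmN k_gt0); apply: (@nrm_congr _ _ j); move: hj; clear; lia.
have e2 : nrm (rl v + i v - o v) = nrm (- rh v + o v - i v).
  by rewrite -(nrmN k_gt0); apply: (@nrm_congr _ _ j); move: hj; clear; lia.
rewrite e1 e2; split=> //; move: h1 h2; clear; lia.
Qed.

Lemma trichotomy V w o i rl rh ex v : base V w o i rl rh ex -> v \in V ->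
  [\/ zero rl o i v, pos rl o i v | pos (fun x => - rh x) i o v].
Proof.
move=> hb hv; have [j hj] := b_gap hb hv; rewrite /zero /pos.
have [q [e he]] := modE (rl v + i v - o v).
have [q' [e' he']] := modE (- rh v + o v - i v).
move: e he e' he'; set a := (_ %% _)%Z; set b := (_ %% _)%Z => e he e' he'.
have s : K * (q + q' + j) + (a + b) = 0 by move: e e' hj; clear; lia.
have [h|h] := eqVneq a 0; first by constructor 1; apply/eqP.
have ab : a + b = K.
  have : K * (q + q' + j) + K <= 0.
    have := @K_mul_neg k k_gt0 (q + q' + j + 1); move: he he' s h; clear; lia.
  have : - K < K * (q + q' + j) + K by move: he he' s; clear; lia.
  have := @K_mul_pos k k_gt0 (q + q' + j + 1); move: s; clear; lia.
have [hk|hk] := lerP a k; [constructor 2 | constructor 3]; move: he he' hk h ab; clear; lia.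
Qed.

Lemma muE V w o i rl rh ex : base V w o i rl rh ex ->
  (mu V w o i)%:Z = 2 * cut w V V + 2 * (sm o V + sm i V) + `|sm o V - sm i V|.
Proof.
move=> hb; have h1 : 0 <= cut w V V by apply: cut_ge0 => x y _ _; apply: (b_w0 hb).
have h2 : 0 <= sm o V by apply: sm_ge0 => x _; apply: (b_o0 hb).
have h3 : 0 <= sm i V by apply: sm_ge0 => x _; apply: (b_i0 hb).
by rewrite /mu; move: h1 h2 h3; clear; lia.
Qed.

Lemma set1_neqT V v : (1 < #|V|)%N -> [set v] != V.
Proof. by move=> h; apply: contraTneq h => <-; rewrite cards1. Qed.

Lemma set1_neq0 (v : U) : [set v] != set0.
Proof. by rewrite -card_gt0 cards1. Qed.

Lemma cut_single V w o i rl rh ex v : state V w o i rl rh ex -> v \in V -> [set v] != ex ->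
  K + nrm (rl v + i v - o v) <= deg V w o i [set v].
Proof.
move=> hs hv hex; rewrite -low1; apply: (b_cut (s_base hs)) => //.
- by rewrite sub1set.
- exact: set1_neq0.
- exact: set1_neqT (s_card hs).
Qed.

Lemma step_E V w o i rl rh ex x y ax ay : state V w o i rl rh ex ->
  x \in V -> y \in V -> x != y -> 1 <= w x y ->
  (ax = 0 \/ ax = -1) -> (ay = 0 \/ ay = 1) -> 0 <= o x + ax ->
  (ex = set0 \/ ex = [set x] /\ ax = -1) ->
  rl x + i x - o x - 1 - ax <= 0 <= rh x + i x - o x - 1 - ax ->
  rl y + i y - o y + 1 - ay <= 0 <= rh y + i y - o y + 1 - ay ->
  (ex != [set x] -> K + nrm (rl x + i x - o x - 1 - ax) <= deg V w o i [set x] - 1 + ax) ->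
  K + nrm (rl y + i y - o y + 1 - ay) <= deg V w o i [set y] - 1 + ay ->
  rooted V (addat (addat o x ax) y ay) i
    (addat (addat rl x (-1)) y 1) (addat (addat rh x (-1)) y 1) ->
  solvable V w rl rh.
Proof.
move=> hs hx hy nxy wxy hax hay ho hex lx ly cx cy hr.
have hb := opE_base k_gt0 (s_base hs) (s_slack hs) hx hy nxy wxy hax hay ho hex lx ly cx cy.
apply: (solve_E k_gt0 nxy hx hy); apply: (s_IH hs) (hb) (hr).
have e1 := muE (s_base hs); have e2 := muE hb.
rewrite cut_addw !sm_addat hx hy /ind /= in e2.
move: e1 e2 hax hay; clear; lia.
Qed.

Lemma addat_same (f : U -> int) x c : addat f x c x = f x + c.
Proof. by rewrite /addat eqxx. Qed.

Lemma addat_diff (f : U -> int) x c y : y != x -> addat f x c y = f y.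
Proof. by rewrite /addat /ind => /negbTE ->; rewrite addr0. Qed.

(** Measuring the norm in the root condition against the multiple [K] bounds the root degree by the
    imbalance itself, which leaves no arc to the root. *)
Lemma ins0 V w o i rl rh ex : state V w o i rl rh ex -> K <= sm o V - sm i V ->
  [/\ forall v, v \in V -> i v = 0, sm i V = 0 & sm o V <= K + k].
Proof.
move=> hs hN; have hb := s_base hs.
have i0 : 0 <= sm i V by apply: sm_ge0 => x _; apply: (b_i0 hb).
have h := r_root (s_root hs); have h1 := nrm_le k_gt0 (sm o V - sm i V) 1.
have h2 := nrm_lek k_gt0 (sm o V - sm i V).
have e : sm i V = 0 by move: h h1 hN i0; clear; lia.
split=> // [v hv|]; last by move: h h2 e i0; clear; lia.
have := le1_sm (fun y _ => b_i0 hb y) hv; have := b_i0 hb v; rewrite e; clear; lia.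
Qed.

(** Dropping an arc from [v] to the root lowers the degree of [v] and the norm of its demand by one
    each, so the cut condition at [v] survives. *)
Lemma step_posL V w o i rl rh v : state V w o i rl rh set0 -> v \in V -> pos rl o i v ->
  1 <= i v -> solvable V w rl rh.
Proof.
move=> hs hv hp hi; have hb := s_base hs; have [p1 p2 p3 p4] := posP hb hv hp.
have N_lt : sm o V - sm i V < K.
  by rewrite ltNge; apply/negP => /(ins0 hs)[h _ _]; move: hi; rewrite h.
have hb' : base V w (addat o v 0) (addat i v (-1)) rl rh set0.
  apply: (opL_base k_gt0 hb) => //.
  - by have := b_o0 hb v; clear; lia.
  - by move: hi; clear; lia.
  - by move: p1 p2; clear; lia.
  - move=> A hA vA nA nA0; have [hc|[x ex]] := single_or nA0.
      have := s_slack hs hA hc nA; have := nrm_lip k_gt0 (low rl o i A) (low rl o i A + (-1 - 0)).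
      have -> : `|low rl o i A + (-1 - 0) - low rl o i A| = 1 by clear; lia.
      by lia_n.
    move: vA; rewrite ex inE => /eqP <-; rewrite low1.
    have := cut_single hs hv; rewrite set1_neq0 => /(_ isT).
    have -> : rl v + i v - o v + (-1 - 0) = rl v + i v - o v - 1 by clear; lia.
    by rewrite p3; clear; lia.
  - by left.
apply: (s_IH hs _ hb').
  have e1 := muE hb; have e2 := muE hb'.
  by rewrite !sm_addat hv /ind in e2; move: e1 e2; clear; lia.
split.
- rewrite !sm_addat hv /ind.
  have := nrm_lip k_gt0 (sm o V + 0 - (sm i V + -1)) (sm o V - sm i V).
  by have := r_root (s_root hs); lia_n.
- rewrite /dom !sm_addat hv /ind.
  have [h|h] := ltrP (sm o V + 0 - (sm i V + -1)) K; [by left | right; exists v].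
  by rewrite !addat_same; have ho := b_o0 hb v; split=> //; move: N_lt h p1 ho; clear; lia.
- rewrite /dom !sm_addat hv /ind.
  have [h|h] := ltrP (sm i V + -1 - (sm o V + 0)) K; [by left | right].
  case: (r_in (s_root hs)) => [|[x [hx h1 h2]]]; first by move: h; clear; lia.
  exists x; split=> //; first by rewrite /addat /ind; case: (x == v); move: h1; clear; lia.
  rewrite /addat /ind; case: (x == v); move: h1 h2; clear; lia.
Qed.

(** Directing the edge from [x] to [y] and deleting it moves both demands towards multiples of [K],
    which pays for the lost degrees. *)
Lemma step_edge V w o i rl rh x y : state V w o i rl rh set0 -> x \in V -> y \in V ->
  pos rl o i x -> pos (fun x => - rh x) i o y -> 1 <= w x y -> solvable V w rl rh.
Proof.
move=> hs hx hy px ny wxy; have hb := s_base hs.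
have [ix|ix] := lerP 1 (i x); first exact: step_posL hs hx px ix.
have [oy|oy] := lerP 1 (o y).
  by apply: (solvable_mirror k_gt0 (b_gap hb)); apply: step_posL (state_mirror hs) hy ny oy.
have [p1 p2 p3 p4] := posP hb hx px; have [n1 n2 n3 n4] := pos_mirrorP hb hy ny.
have nxy : x != y by apply: contraTneq wxy => ->; rewrite (b_diag hb).
have e0 (z : int) : z - 1 - 0 = z - 1 by clear; lia.
have e0' (z : int) : z + 1 - 0 = z + 1 by clear; lia.
have cx := cut_single hs hx (set1_neq0 x); have cy := cut_single hs hy (set1_neq0 y).
apply: (step_E (ax := 0) (ay := 0) hs hx hy nxy wxy); rewrite ?e0 ?e0'.
- by left.
- by left.
- by have := b_o0 hb x; clear; lia.
- by left.
- by move: p1 p2; clear; lia.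
- by move: n1 n2; clear; lia.
- by rewrite p3; move: cx; clear; lia.
- by rewrite n3; move: cy; clear; lia.
have nyx : (y == x) = false by rewrite eq_sym (negbTE nxy).
split.
- by rewrite !sm_addat /ind !if_same !addr0; apply: r_root (s_root hs).
- rewrite /dom !sm_addat /ind !if_same !addr0; case: (r_out (s_root hs)) => [|[z [hz h1 h2]]]; first by left.
  have [|h] := ltrP (sm o V - sm i V) K; [by left | right].
  (* The demand of [y] rises, so [y] may no longer qualify for the excess. But [y] has no arc from
     the root, hence the excess is exactly [K] and [x] can replace it. *)
  have [ezy|nzy] := eqVneq z y.
    exists x; split=> //; first by have := b_o0 hb x; rewrite ezy in h1; rewrite /addat /ind !if_same; move: h1 oy; clear; lia.
    by rewrite ezy in h1; rewrite /addat /ind eqxx (negbTE nxy); move: p1 h h1 oy; clear; lia.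
  exists z; split=> //; first by rewrite /addat /ind !if_same; move: h1; clear; lia.
  by rewrite /addat /ind (negbTE nzy) if_same; case: (z == x); move: h2; clear; lia.
- rewrite /dom !sm_addat /ind !if_same !addr0; case: (r_in (s_root hs)) => [|[z [hz h1 h2]]]; first by left.
  have [|h] := ltrP (sm i V - sm o V) K; [by left | right].
  have [ezx|nzx] := eqVneq z x.
    exists y; split=> //; first by have := b_i0 hb y; rewrite ezx in h1; move: h1 ix; clear; lia.
    by rewrite ezx in h1; rewrite /addat /ind eqxx nyx; move: n2 h h1 ix; clear; lia.
  exists z; split=> //.
  by rewrite /addat /ind (negbTE nzx) if_same; case: (z == y); move: h2; clear; lia.
Qed.

End Step.

(** * Exempt vertices, and roots with imbalance below the modulus *)

Section Main.
Variables (k : int) (U : finType).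
Hypothesis k_gt0 : 0 < k.
Local Notation K := (2 * k).
Local Notation nrm := (dist_mul k).
Local Notation base := (@base k U).
Local Notation rooted := (@rooted k U).
Local Notation dom := (@dom k U).
Local Notation slack := (@slack k U).
Local Notation solvable := (@solvable k U).
Local Notation hered := (@hered k U).
Local Notation state := (@state k U).
Local Notation pos := (@pos k U).
Local Notation zero := (@zero k U).
Implicit Types (A B C V ex : {set U}) (o i rl rh : U -> int) (w : U -> U -> int).

Lemma ex_low0 V w o i rl rh u : base V w o i rl rh [set u] ->
  rl u + i u - o u = 0 /\ rh u + i u - o u = 0.
Proof.
move=> hb; case: (b_ex hb) => [/eqP|[v [_ /set1_inj <- h1 h2]]]; last by move: h1 h2; clear; lia.
by rewrite (negbTE (set1_neq0 u)).
Qed.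

Lemma exempt_out V w o i rl rh u : base V w o i rl rh [set u] -> dom V o i rl ->
  sm o V - sm i V < K \/ exists x, [/\ x \in V, x != u, sm o V - sm i V - K <= o x
              & rl x + i x - o x < K - (sm o V - sm i V)].
Proof.
move=> hb [h|[x [hx h1 h2]]]; first by left.
have [|h] := ltrP (sm o V - sm i V) K; [by left | right; exists x; split=> //].
apply: contraTneq h2 => ->; have [e _] := ex_low0 hb.
by rewrite e; move: h; clear; lia.
Qed.

Lemma exempt_cancel V w o i rl rh u : state V w o i rl rh [set u] -> u \in V ->
  1 <= o u -> 1 <= i u -> solvable V w rl rh.
Proof.
move=> hs hu ou iu; have hb := s_base hs; have [l0 h0] := ex_low0 hb.
have hb' : base V w (addat o u (-1)) (addat i u (-1)) rl rh [set u].
  apply: (opL_base k_gt0 hb); try by move: ou iu l0 h0; clear; lia.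
    move=> A hA uA nA nA0; rewrite subrr addr0.
    have hc : (1 < #|A|)%N.
      case: (@single_or _ A) => [|//|[z ez]]; first by apply/set0Pn; exists u.
      by move: uA nA0; rewrite ez inE => /eqP ->; rewrite eqxx.
    by have := s_slack hs hA hc nA; lia_n.
  by right.
apply: (s_IH hs _ hb').
  have e1 := muE hb; have e2 := muE hb'.
  by rewrite !sm_addat hu /ind in e2; move: e1 e2; clear; lia.
have hr := s_root hs.
have eN (a b : int) : a + -1 - (b + -1) = a - b by clear; lia.
split.
- by rewrite !sm_addat hu /ind eN; have := r_root hr; lia_n.
- rewrite /dom !sm_addat hu /ind eN; case: (exempt_out hb (r_out hr)) => [|[x [hx xu h1 h2]]]; first by left.
  by right; exists x; rewrite !addat_diff.
- rewrite /dom !sm_addat hu /ind eN.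
  case: (exempt_out (base_mirror k_gt0 hb) (r_in hr)) => [|[x [hx xu h1 h2]]]; first by left.
  by right; exists x; rewrite !addat_diff.
Qed.

(** The arc from the root to [u] is extended along a free edge [u y] to an arc from the root to
    [y]. *)
Lemma exempt_push V w o i rl rh u : state V w o i rl rh [set u] -> u \in V ->
  1 <= o u -> i u = 0 -> solvable V w rl rh.
Proof.
move=> hs hu ou iu; have hb := s_base hs; have [l0 h0] := ex_low0 hb.
have hr := s_root hs; have [q hq] := b_sum hb.
have eV : V :\: (V :\ u) = [set u].
  by apply/setP=> z; rewrite !inE; case: eqP => [->|_]; rewrite ?hu //= andNb.
have hc : cut w (V :\ u) [set u] = sm (w u) (V :\ u).
  by rewrite (cutC _ _ (b_sym hb)) cut1l.
(* The cut condition for [V :\ u] has the norm of the root condition, so the difference of the two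
   shows at least [o u] free edges at [u]. *)
have [y hy wy] : exists2 y, y \in V :\ u & 0 < w u y.
  apply: sm_pos; rewrite -hc -[X in cut _ _ X]eV.
  have nu : V :\ u != V by apply: contraTneq hu => <-; rewrite !inE eqxx.
  have n0 : V :\ u != set0.
    by rewrite -card_gt0; have := s_card hs; rewrite (cardsD1 u) hu.
  have nx : V :\ u != [set u] by apply/eqP => /setP/(_ u); rewrite !inE eqxx.
  have := b_cut hb (subD1set _ _) n0 nu nx; have := r_root hr.
  rewrite /deg /low; have e1 := smD1 o hu; have e2 := smD1 i hu; have e3 := smD1 rl hu.
  have -> : nrm (sm rl (V :\ u) + sm i (V :\ u) - sm o (V :\ u)) = nrm (sm o V - sm i V).
    rewrite -[RHS](nrmN k_gt0); apply: (@nrm_congr _ k_gt0 _ _ q).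
    by move: e1 e2 e3 l0 hq; clear; lia.
  by move: e1 e2 ou iu; lia_n.
move: hy; rewrite !inE => /andP[yu hy].
have uy : u != y by rewrite eq_sym.
have cy := cut_single hs hy; have ny : [set y] != [set u] by apply: contra yu => /eqP/set1_inj ->.
have := b_str hb hy => sy.
apply: (step_E k_gt0 (ax := -1) (ay := 1) hs hu hy uy); try by move: wy l0 h0 ou; clear; lia.
- by right.
- by move: sy; clear; lia.
- by rewrite eqxx.
- have := cy ny; have -> : rl y + i y - o y + 1 - 1 = rl y + i y - o y by clear; lia.
  by lia_n.
have eN (a : int) : a + -1 + 1 = a by clear; lia.
have e1 x : x != u -> x \in V -> addat (addat rl u (-1)) y 1 x + i x - addat (addat o u (-1)) y 1 x
   = rl x + i x - o x.
  by move=> xu hx; rewrite /addat /ind (negbTE xu); case: (x == y); clear; lia.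
have e2 x : x != u -> x \in V -> - addat (addat rh u (-1)) y 1 x + addat (addat o u (-1)) y 1 x - i x
   = - rh x + o x - i x.
  by move=> xu hx; rewrite /addat /ind (negbTE xu); case: (x == y); clear; lia.
split.
- by rewrite !sm_addat hu hy /ind eN; apply: r_root hr.
- rewrite /dom !sm_addat hu hy /ind eN; case: (exempt_out hb (r_out hr)) => [|[x [hx xu h1 h2]]]; first by left.
  right; exists x; rewrite e1 //; split=> //.
  by rewrite /addat /ind (negbTE xu); case: (x == y); move: h1; clear; lia.
- rewrite /dom !sm_addat hu hy /ind eN.
  case: (exempt_out (base_mirror k_gt0 hb) (r_in hr)) => [|[x [hx xu h1 h2]]]; first by left.
  by right; exists x; rewrite e2.
Qed.

Lemma exempt_solve V w o i rl rh u : hered V -> state V w o i rl rh [set u] -> u \in V ->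
  solvable V w rl rh.
Proof.
move=> IHV hs hu; have hb := s_base hs; have hr := s_root hs.
have [ou|ou] := lerP 1 (o u); have [iu|iu] := lerP 1 (i u).
- exact: exempt_cancel hs hu ou iu.
- by apply: exempt_push hs hu ou _; have := b_i0 hb u; move: iu; clear; lia.
- apply: (solvable_mirror k_gt0 (b_gap hb)); apply: (exempt_push (state_mirror k_gt0 hs) hu iu).
  by have := b_o0 hb u; move: ou; clear; lia.
have o0 : o u = 0 by have := b_o0 hb u; move: ou; clear; lia.
have i0 : i u = 0 by have := b_i0 hb u; move: iu; clear; lia.
have [/existsP[y /existsP[z /and5P[hy hz yz wy wz]]]|hn] :=
  boolP [exists y, exists z, [&& y \in V, z \in V, y != z, 1 <= w u y & 1 <= w u z]].
  have uy : u != y by apply: contraTneq wy => <-; rewrite (b_diag hb).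
  have uz : u != z by apply: contraTneq wz => <-; rewrite (b_diag hb).
  apply: (solve_lift k_gt0 hu hy hz uy uz yz (b_w0 hb) wy wz).
  have hb' := lift_base hb (s_slack hs) hu hy hz uy uz yz wy wz.
  apply: (s_IH hs _ hb' hr).
  have e1 := muE hb; have e2 := muE hb'; rewrite !cut_addw hu hy hz /ind /= in e2.
  by move: e1 e2; clear; lia.
have [y [hy uy hyz]] : exists y, [/\ y \in V, u != y & forall z, z \in V -> z != y -> w u z = 0].
  have [/existsP[y /andP[hy wy]]|hn'] := boolP [exists y, (y \in V) && (1 <= w u y)].
    exists y; split=> //; first by apply: contraTneq wy => <-; rewrite (b_diag hb).
    move=> z hz zy; move: hn => /existsPn/(_ y)/existsPn/(_ z).
    rewrite hy hz eq_sym zy wy /=; have := b_w0 hb u z; clear; lia.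
  have : (0 < #|V :\ u|)%N by have := s_card hs; rewrite (cardsD1 u) hu.
  rewrite card_gt0 => /set0Pn[y]; rewrite !inE => /andP[yu hy].
  exists y; split=> // [|z hz _]; first by rewrite eq_sym.
  move: hn' => /existsPn/(_ z); rewrite hz /=; have := b_w0 hb u z; clear; lia.
apply: (solve_remove hb hu hy uy o0 i0 hyz).
apply: (IHV _ _ _ _ _ _ _ _ (remove_base hb hu hy uy o0 i0 hyz)).
  by rewrite [X in (_ < X)%N](cardsD1 u) hu.
have eo := smD1 o hu; have ei := smD1 i hu; rewrite o0 add0r in eo; rewrite i0 add0r in ei.
split.
- by rewrite -eo -ei; apply: r_root hr.
- rewrite /dom -eo -ei; case: (exempt_out hb (r_out hr)) => [|[x [hx xu h1 h2]]]; first by left.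
  by right; exists x; rewrite !inE xu.
- rewrite /dom -eo -ei.
  case: (exempt_out (base_mirror k_gt0 hb) (r_in hr)) => [|[x [hx xu h1 h2]]]; first by left.
  by right; exists x; rewrite !inE xu.
Qed.

(** Fixing the demand of [u] at zero disqualifies [u] from taking a root excess, so another vertex
    must be available for it. *)
Lemma zero_solve V w o i rl rh u : hered V -> state V w o i rl rh set0 -> u \in V ->
  zero rl o i u ->
  (sm o V - sm i V < K \/ exists x, [/\ x \in V, x != u, sm o V - sm i V - K <= o x
              & rl x + i x - o x < K - (sm o V - sm i V)]) ->
  - K < sm o V - sm i V ->
  solvable V w rl rh.
Proof.
move=> IHV hs hu hz hd hN; have hb := s_base hs; have hr := s_root hs.
have [q [e _]] := modE k_gt0 (rl u + i u - o u); rewrite (eqP hz) addr0 in e.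
have hb' := exempt_base k_gt0 hb hu (ex_intro _ q e).
have [j hj] := b_gap hb hu; have su := b_str hb hu.
apply: (solvable_weaken k_gt0 _ (exempt_solve IHV _ hu)); last first.
  split.
  - exact: hb'.
  - move=> A hA hc nA; have := s_slack hs hA hc nA; congr (_ + _ + _ <= _).
    apply: (@nrm_congr _ k_gt0 _ _ (ind (u \in A) q)).
    by rewrite /low !sm_addat /ind; case: (u \in A); move: e; clear; lia.
  - split; first exact: r_root hr.
    + case: hd => [|[x [hx xu h1 h2]]]; first by left.
      by right; exists x; rewrite addat_diff.
    + by left; move: hN; clear; lia.
  - exact: s_card hs.
  - exact: s_IH hs.
move=> x hx; rewrite /addat /ind; case: eqP => [->|_]; last by rewrite !addr0; split=> //; exists 0; clear; lia.
split; [move: su; clear; lia | move: su; clear; lia | exists (- q)].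
by move: e; clear; lia.
Qed.

(** A vertex [x] has degree above [K] but fewer than [K] root arcs, hence a free edge [u x]. It
    becomes an arc from the root to [x]: nothing changes at [x], and the demand of [u] drops. If the
    root excess thereby reaches [K], then [u] can take it. *)
Lemma all_pos_solve V w o i rl rh : state V w o i rl rh set0 -> `|sm o V - sm i V| < K ->
  (forall v, v \in V -> pos rl o i v) -> solvable V w rl rh.
Proof.
move=> hs hN hp; have hb := s_base hs; have hr := s_root hs.
have [/existsP[v /andP[hv iv]]|hn] := boolP [exists v, (v \in V) && (1 <= i v)].
  exact: step_posL hs hv (hp v hv) iv.
have i0 v : v \in V -> i v = 0.
  by move=> hv; move: hn => /existsPn/(_ v); rewrite hv /=; have := b_i0 hb v; clear; lia.
have iV : sm i V = 0 by rewrite /sm big1.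
have [x hx] : exists x, x \in V by apply/set0Pn; rewrite -card_gt0 ltnW // (s_card hs).
have cx := cut_single hs hx (set1_neq0 x); have [p1 p2 p3 p4] := posP k_gt0 hb hx (hp x hx).
have ox := le1_sm (fun y _ => b_o0 hb y) hx; have sx := b_str hb hx.
have [u hu wu] : exists2 u, u \in V :\ x & 0 < w x u.
  apply: sm_pos; move: cx; rewrite deg1 i0 // => cx.
  rewrite i0 // in p4; move: cx p4 ox hN; rewrite iV; lia_n.
move: hu; rewrite !inE => /andP[ux hu].
have cu := cut_single hs hu (set1_neq0 u); have [u1 u2 u3 u4] := posP k_gt0 hb hu (hp u hu).
apply: (step_E k_gt0 (ax := 0) (ay := 1) hs hu hx ux); try by move: u1 u2 sx; clear; lia.
- by rewrite (b_sym hb); move: wu; clear; lia.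
- by have := b_o0 hb u; clear; lia.
- by left.
- have -> : rl u + i u - o u - 1 - 0 = rl u + i u - o u - 1 by clear; lia.
  by rewrite u3; move: cu; lia_n.
- have -> : rl x + i x - o x + 1 - 1 = rl x + i x - o x by clear; lia.
  by move: cx; lia_n.
have oV : 0 <= sm o V by apply: sm_ge0 => y _; apply: (b_o0 hb).
split.
- rewrite !sm_addat hu hx /ind iV.
  by have := nrm_ge0 k_gt0 (sm o V + 0 + 1 - 0); move: hN oV; rewrite iV; lia_n.
- rewrite /dom !sm_addat hu hx /ind iV.
  have [|h] := ltrP (sm o V + 0 + 1 - 0) K; [by left | right; exists u; split=> //].
    by rewrite /addat /ind eqxx (negbTE ux) iV in hN *; have := b_o0 hb u; move: hN; clear; lia.
  by rewrite /addat /ind eqxx (negbTE ux); rewrite iV in hN; move: hN u1; clear; lia.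
- by left; rewrite !sm_addat hu hx /ind; move: hN; clear; lia.
Qed.

(* If both residue classes are nonempty and no local step applies, each of them
   meets at least [K] root arcs, which is more than there are. *)
Lemma caseI V w o i rl rh : hered V -> state V w o i rl rh set0 ->
  `|sm o V - sm i V| < K -> solvable V w rl rh.
Proof.
move=> IHV hs hN; have hb := s_base hs; have hr := s_root hs.
have [/existsP[v /andP[hv zv]]|hn] := boolP [exists v, (v \in V) && zero rl o i v].
  apply: (zero_solve IHV hs hv zv); first by left; move: hN; clear; lia.
  by move: hN; clear; lia.
have hz v : v \in V -> zero rl o i v = false.
  by move=> hv; move: hn => /existsPn/(_ v); rewrite hv /= => /negbTE.
pose W := [set v in V | pos rl o i v].
have WV : W \subset V by apply/subsetP=> v; rewrite inE => /andP[].
have WP v : v \in W -> v \in V /\ pos rl o i v by rewrite inE => /andP.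
have WN v : v \in V :\: W -> v \in V /\ pos (fun x => - rh x) i o v.
  rewrite !inE => /andP[h hv]; split=> //; move: h; rewrite hv /=.
  by case: (trichotomy k_gt0 hb hv) => [|->|->]; rewrite ?hz.
have [eW|nW] := eqVneq W V.
  by apply: (all_pos_solve hs hN) => v; rewrite -eW => /WP[].
have [eW|nW0] := eqVneq W set0.
  apply: (solvable_mirror k_gt0 (b_gap hb)).
  apply: (all_pos_solve (state_mirror k_gt0 hs)); first by move: hN; clear; lia.
  by move=> v hv; have [] := WN v; rewrite ?eW ?inE.
have [/existsP[v /andP[hv iv]]|hi] := boolP [exists v, (v \in W) && (1 <= i v)].
  by have [hv' pv] := WP v hv; apply: step_posL hs hv' pv iv.
have [/existsP[v /andP[hv ov]]|ho] := boolP [exists v, (v \in V :\: W) && (1 <= o v)].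
  have [hv' pv] := WN v hv; apply: (solvable_mirror k_gt0 (b_gap hb)).
  by apply: step_posL (state_mirror k_gt0 hs) hv' pv ov.
have [/existsP[x /existsP[y /and3P[hx hy wxy]]]|he] :=
  boolP [exists x, exists y, [&& x \in W, y \in V :\: W & 1 <= w x y]].
  have [hx' px] := WP x hx; have [hy' ny] := WN y hy.
  exact: step_edge hs hx' hy' px ny wxy.
have iW : sm i W = 0.
  rewrite /sm big1 // => v hv; move: hi => /existsPn/(_ v); rewrite hv /=.
  by have := b_i0 hb v; clear; lia.
have oW : sm o (V :\: W) = 0.
  rewrite /sm big1 // => v hv; move: ho => /existsPn/(_ v); rewrite hv /=.
  by have := b_o0 hb v; clear; lia.
have cW : cut w W (V :\: W) = 0.
  rewrite /cut /sm big1 // => x hx; rewrite big1 // => y hy.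
  move: he => /existsPn/(_ x)/existsPn/(_ y); rewrite hx hy /=.
  by have := b_w0 hb x y; clear; lia.
have h1 := b_cut hb WV nW0 nW nW0.
have n2 : V :\: W != set0.
  by rewrite setD_eq0; apply: contra nW => h; rewrite eqEsubset WV.
have n3 : V :\: W != V.
  apply: contraNneq nW0 => e; rewrite -subset0; apply/subsetP=> x xW.
  by have := subsetP WV x xW; rewrite -e inE xW.
have h2 := b_cut hb (subsetDl V W) n2 n3 n2.
have eD : V :\: (V :\: W) = W by rewrite setDDr setDv set0U; apply/setIidPr.
rewrite /deg eD (cutC _ _ (b_sym hb)) cW oW in h2; rewrite /deg cW iW in h1.
have := r_root hr; have := sm_sub o WV; have := sm_sub i WV.
have := nrm_lek k_gt0 (sm o V - sm i V).
have := nrm_ge0 k_gt0 (low rl o i W); have := nrm_ge0 k_gt0 (low rl o i (V :\: W)).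
by move: h1 h2; rewrite iW oW; move: k_gt0; lia_n.
Qed.

End Main.

(** * Roots with imbalance at least the modulus, and the modular orientation theorem *)

Section Excess.
Variables (k : int) (U : finType).
Hypothesis k_gt0 : 0 < k.
Local Notation K := (2 * k).
Local Notation nrm := (dist_mul k).
Local Notation base := (@base k U).
Local Notation rooted := (@rooted k U).
Local Notation dom := (@dom k U).
Local Notation slack := (@slack k U).
Local Notation solvable := (@solvable k U).
Local Notation hered := (@hered k U).
Local Notation state := (@state k U).
Local Notation pos := (@pos k U).
Local Notation zero := (@zero k U).
Implicit Types (A B C V ex : {set U}) (o i rl rh : U -> int) (w : U -> U -> int).

Lemma nrm_in (z : int) : 0 <= z <= K -> nrm z = Order.min z (K - z).
Proof.
move=> h; have [hz|hz] := ltrP z K.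
  by have := @nrmE k 0 z; rewrite mulr0 add0r; apply; move: h hz; clear; lia.
have -> : z = K * 1 + 0 by move: h hz; clear; lia.
by rewrite nrmE; move: k_gt0; clear; lia.
Qed.

(* Exchanging [r] arcs leaving the root at [x] for [r - y] arcs entering it
   decreases the measure. If this violates the cut condition, a minimal violating
   set is contracted and the exchange is made in the inner instance, where the
   violation turns into the root condition. *)
Lemma relabel_solve V w o i rl rh x (r y : int) : hered V -> state V w o i rl rh set0 ->
  x \in V -> 0 < r -> r <= o x -> 0 <= y -> y <= r ->
  rl x + i x - o x + (2 * r - y) <= 0 <= rh x + i x - o x + (2 * r - y) ->
  K + nrm (rl x + i x - o x + (2 * r - y)) <= deg V w o i [set x] - y ->
  sm o V + sm i V - y <= K + nrm (sm o V - sm i V - (2 * r - y)) ->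
  0 <= sm o V - sm i V - (2 * r - y) < K ->
  K <= sm o V - sm i V -> sm o V - sm i V - K <= o x ->
  rl x + i x - o x < K - (sm o V - sm i V) ->
  solvable V w rl rh.
Proof.
move=> IHV hs hx r0 rox y0 yr hl hc hD hN hNK ox Lx; have hb := s_base hs; have hr := s_root hs.
have rr : (r - y) - (- r) = 2 * r - y by clear; lia.
have ry : - r + (r - y) = - y by clear; lia.
pose bad A := [&& A \subset V, x \in A, A != V &
  deg V w o i A - y < K + nrm (low rl o i A + (2 * r - y))].
have [/existsP[B0 hB0]|hn] := boolP [exists A, bad A]; last first.
  have hb' : base V w (addat o x (- r)) (addat i x (r - y)) rl rh set0.
    apply: (opL_base k_gt0 hb).
    - by move: rox; clear; lia.
    - by have := b_i0 hb x; move: yr; clear; lia.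
    - by move: hl; clear; lia.
    - move=> A hA xA nA _; move: hn => /existsPn/(_ A); rewrite /bad hA xA nA /= -leNgt.
      by rewrite rr ry.
    - by left.
  apply: (s_IH hs _ hb').
    have e1 := muE hb; have e2 := muE hb'; rewrite !sm_addat hx /ind in e2.
    by move: e1 e2 hN y0 r0 yr hNK; clear; lia.
  have eN : sm o V + - r - (sm i V + (r - y)) = sm o V - sm i V - (2 * r - y) by clear; lia.
  split.
  - by rewrite !sm_addat hx /ind eN; move: hD; lia_n.
  - by left; rewrite !sm_addat hx /ind; move: hN; clear; lia.
  - by left; rewrite !sm_addat hx /ind; move: hN; clear; lia.
case: (arg_minnP (fun A : {set U} => #|A|) hB0) => B /and4P[hBV xB nB hB] hmin.
have cB : (1 < #|B|)%N.
  case: (@single_or _ B) => [|//|[z ez]]; first by apply/set0Pn; exists x.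
  by move: xB hB; rewrite ez inE => /eqP <-; rewrite low1; move: hc; lia_n.
have [j hj] := sm_gap k_gt0 (b_gap hb) hBV.
have sB z : z \in B -> rl z + i z <= o z <= rh z + i z by move=> /(subsetP hBV)/(b_str hb).
apply: (contract_solve k_gt0 IHV hb hr hBV cB xB (R1 := sm rl B) (R2 := sm rh B)).
- by rewrite -!smD !sm_le // => z /sB; clear; lia.
- by exists 0; clear; lia.
- by exists j.
- right; exists x; rewrite b0_qV !sm_qfV // /qf /qr eqxx; split=> //.
    by apply: le_trans ox _; apply: le1_sm xB => z _; apply: (b_o0 hb).
  have := @low_le1 U o i rl B x (fun z hz => proj1 (andP (sB z hz))) xB.
  by rewrite /low; move: Lx; clear; lia.
- by left; rewrite !sm_qfV //; move: hNK k_gt0; clear; lia.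
move=> p q p0 q0 hpq hR [m hm].
have hbi : base B w (fun z => o z + q z) (fun z => i z + p z)
    (fun z => rl z - (p z - q z)) (fun z => rh z - (p z - q z)) set0.
  have := inner_base hBV hb nB p0 q0 hpq (ex_intro _ m hm).
  by rewrite sub0set.
pose o' := addat (fun z => o z + q z) x (- r); pose i' := addat (fun z => i z + p z) x (r - y).
have hb' : base B w o' i' (fun z => rl z - (p z - q z)) (fun z => rh z - (p z - q z)) set0.
  apply: (opL_base k_gt0 hbi).
  - by have := q0 x; move: rox; clear; lia.
  - by have := b_i0 hb x; have := p0 x; move: yr; clear; lia.
  - by move: hl; clear; lia.
  - move=> A hA xA nA _; rewrite inner_low (inner_deg hBV) // rr ry leNgt.
    apply/negP => hbad.
    have /hmin : bad A.
      rewrite /bad (subset_trans hA hBV) xA hbad andbT /=.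
      by apply: contra nA => /eqP e; rewrite eqEsubset hA e.
    by rewrite leqNgt proper_card // properEneq nA.
  - by left.
apply: (IHV B (proper_card _) _ _ _ _ _ _ hb'); first by rewrite properEneq nB.
have eo : sm o' B = sm o B + sm q B - r by rewrite /o' sm_addat xB smD.
have ei : sm i' B = sm i B + sm p B + (r - y) by rewrite /i' sm_addat xB smD.
have eD := inner_deg hBV o i (subxx B) hpq.
rewrite {1}/deg setDv cut0r add0r !smD in eD.
have eN : nrm (sm o' B - sm i' B) = nrm (low rl o i B + (2 * r - y)).
  rewrite -(nrmN k_gt0); apply: (@nrm_congr _ k_gt0 _ _ m).
  by rewrite eo ei /low; move: hm; clear; lia.
have o0 : 0 <= sm o' B by apply: sm_ge0 => z _; apply: (b_o0 hb').
have i0 : 0 <= sm i' B by apply: sm_ge0 => z _; apply: (b_i0 hb').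
(* The violated cut condition bounds the inner root degree strictly, and by parity with a margin of
   two. An imbalance of [K] or more would then leave a negative number of arcs in one direction. *)
have small : `|sm o' B - sm i' B| < K.
  have [t ht] := nrm_par k_gt0 (sm o' B - sm i' B).
  have h1 := nrm_le k_gt0 (sm o' B - sm i' B) 1.
  have h2 := nrm_le k_gt0 (sm o' B - sm i' B) (-1).
  rewrite -eN in hB.
  have hD' : sm o' B + sm i' B < K + nrm (sm o' B - sm i' B).
    by move: hB; rewrite -eD eo ei; lia_n.
  have : sm o' B + sm i' B + 2 <= K + nrm (sm o' B - sm i' B).
    by move: hD' ht; move: (sm o' B) (sm i' B) (nrm _) => a b c; clear; lia.
  by move: h1 h2 o0 i0; move: (sm o' B) (sm i' B) (nrm _) => a b c; clear; lia.
split.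
- by rewrite eN; move: hB; rewrite -eD eo ei; lia_n.
- by left; move: small; clear; lia.
- by left; move: small; clear; lia.
Qed.

Lemma pos_half V w o i rl rh ex v q : base V w o i rl rh ex -> v \in V ->
  rl v + i v - o v = K * q + k -> pos (fun x => - rh x) i o v.
Proof.
move=> hb hv e; have [j hj] := b_gap hb hv; rewrite /pos.
have -> : - rh v + o v - i v = (- q - j - 1) * K + k by move: e hj; clear; lia.
by rewrite modzMDl modz_small; move: k_gt0; clear; lia.
Qed.

(** The set [W] of vertices with residue above [k] has no root arcs and no edge to a vertex with
    residue in [[1, k]]. If it is nonempty, its at least [K + 1] boundary edges all go to [x], which
    must have residue zero; the degree of [x] is then large enough to cancel an arc from the root at
    [x] against an edge from [x] into [W]. *)
Lemma all_but_pos V w o i rl rh x : state V w o i rl rh set0 -> K <= sm o V - sm i V ->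
  x \in V -> zero rl o i x = false \/ 1 <= o x /\ rl x + i x - o x < 0 ->
  (sm o V - sm i V = K \/ sm o V - sm i V - K <= o x /\ rl x + i x - o x < K - (sm o V - sm i V)) ->
  (forall v, v \in V -> v != x -> zero rl o i v = false) ->
  (forall v, v \in V -> pos (fun x => - rh x) i o v -> o v = 0) ->
  (forall u v, u \in V -> v \in V -> pos rl o i u -> pos (fun x => - rh x) i o v -> w u v = 0) ->
  solvable V w rl rh \/ forall v, v \in V -> v != x -> pos rl o i v.
Proof.
move=> hs hN hx zx wx zV nego posneg; have hb := s_base hs; have hr := s_root hs.
have [i0 iV oV] := ins0 k_gt0 hs hN.
pose W := [set v in V | (~~ pos rl o i v) && ~~ zero rl o i v].
have WV : W \subset V by apply/subsetP=> v; rewrite inE => /andP[].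
have WN v : v \in W -> v \in V /\ pos (fun x => - rh x) i o v.
  rewrite inE => /and3P[hv /negbTE hp /negbTE hz]; split=> //.
  by case: (trichotomy k_gt0 hb hv); rewrite ?hp ?hz.
have [W0|nW0] := eqVneq W set0.
  right=> v hv vx; apply/negPn/negP => hp.
  suff : v \in W by rewrite W0 inE.
  by rewrite inE hv hp zV.
have oW : sm o W = 0 by rewrite /sm big1 // => v /WN[hv /nego ->].
have iW : sm i W = 0 by rewrite /sm big1 // => v /WN[hv _]; rewrite i0.
have nW : W != V.
  by apply: contraTneq hN => e; rewrite -e oW iW; move: k_gt0; clear; lia.
have hW : K + 1 <= deg V w o i W.
  have [hc|[z ez]] := single_or nW0.
    have := s_slack hs WV hc nW; have := nrm_ge0 k_gt0 (low rl o i W); lia_n.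
  have := b_cut hb WV nW0 nW nW0; have [hz nz] : z \in V /\ pos (fun x => - rh x) i o z.
    by apply: WN; rewrite ez set11.
  by have [_ _ _] := pos_mirrorP k_gt0 hb hz nz; rewrite ez low1; lia_n.
have cW0 a b : a \in W -> b \in V :\: W -> zero rl o i b = false -> w a b = 0.
  move=> /WN[ha na]; rewrite !inE => /andP[h hB] zb; rewrite (b_sym hb); apply: posneg => //.
  by move: h; rewrite hB zb /= andbT negbK.
have cWx a b : a \in W -> b \in V :\: W -> b != x -> w a b = 0.
  by move=> ha hB bx; apply: cW0 => //; apply: zV bx; move: hB; rewrite inE => /andP[].
have eW : deg V w o i W = cut w W (V :\: W) by rewrite /deg oW iW; clear; lia.
have [zx'|zx'] := boolP (zero rl o i x); last first.
  suff : cut w W (V :\: W) = 0 by move: hW; rewrite eW => h1 h2; move: h1 h2 k_gt0; clear; lia.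
  rewrite /cut /sm big1 // => a ha; rewrite big1 // => b hB; apply: cW0 => //.
  have [->|bx] := eqVneq b x; first exact/negbTE.
  by apply: zV bx; move: hB; rewrite inE => /andP[].
have {zx} [ox Lx] : 1 <= o x /\ rl x + i x - o x < 0 by case: zx => //; rewrite zx'.
left.
have xW : x \in V :\: W by rewrite !inE zx' andbF hx.
have cutx : cut w W (V :\: W) = sm (w x) W.
  apply: eq_sm => a ha; rewrite (smD1 _ xW) (b_sym hb) [X in _ + X](_ : _ = 0) ?addr0 //.
  by rewrite /sm big1 // => b /setD1P[bx hB]; apply: cWx.
have dx : K + 1 + o x <= deg V w o i [set x].
  rewrite deg1 i0 // addr0 lerD2r; apply: le_trans hW _; rewrite eW cutx.
  have WVx : W \subset V :\ x.
    by apply/subsetP=> v hv; rewrite !inE (subsetP WV) // andbT; apply: contraTneq hv => ->; rewrite !inE zx' !andbF.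
  by rewrite (sm_sub _ WVx) lerDl; apply: sm_ge0 => v _; apply: (b_w0 hb).
have [y yW wy] : exists2 y, y \in W & 0 < w x y.
  by apply: sm_pos; rewrite -cutx -eW; move: hW k_gt0; clear; lia.
have [hy ny] := WN y yW; have [n1 n2 n3 n4] := pos_mirrorP k_gt0 hb hy ny.
have xy : x != y by apply: contraTneq wy => <-; rewrite (b_diag hb).
have cy := cut_single hs hy (set1_neq0 y); have sx := b_str hb hx.
have nx : nrm (rl x + i x - o x) = 0.
  have [q [e _]] := modE k_gt0 (rl x + i x - o x); rewrite (eqP zx') in e.
  by rewrite e nrm_near ?normr0 // ltW.
have ey : rl y + i y - o y + 1 - 0 = rl y + i y - o y + 1 by clear; lia.
have ex : rl x + i x - o x - 1 - -1 = rl x + i x - o x by clear; lia.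
have xyF : (y == x) = false by rewrite eq_sym (negbTE xy).
apply: (step_E k_gt0 (ax := -1) (ay := 0) hs hx hy xy); rewrite ?ey ?ex ?n3 ?nx //.
- by right.
- by left.
- by move: ox; clear; lia.
- by left.
- by move: sx; clear; lia.
- by move: n1 n2; clear; lia.
- by move: dx ox; lia_n.
- by move: cy; lia_n.
split.
- rewrite !sm_addat hx hy /ind iV.
  have := nrm_lip k_gt0 (sm o V + -1 + 0 - 0) (sm o V - 0); have := r_root hr.
  by rewrite iV; lia_n.
- rewrite /dom !sm_addat hx hy /ind.
  case: wx => [e|[o1 l1]]; first by left; move: e k_gt0; clear; lia.
  right; exists x; split=> //; rewrite /addat /ind eqxx (negbTE xy); first by move: o1; clear; lia.
  by move: l1; clear; lia.
- by left; rewrite !sm_addat hx hy /ind; move: hN k_gt0; clear; lia.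
Qed.

(** When the local steps fail, every vertex other than the [x] taking the excess has residue in
    [[1, k]], and [x] has residue [p < k]. What remains is to trade an edge at [x] for a root arc,
    or to relabel root arcs at [x]. *)
Lemma caseII V w o i rl rh : hered V -> state V w o i rl rh set0 ->
  K <= sm o V - sm i V -> solvable V w rl rh.
Proof.
move=> IHV hs hN; have hb := s_base hs; have hr := s_root hs.
have [i0 iV oV] := ins0 k_gt0 hs hN.
case: (r_out hr) => [|[x [hx ox Lx]]]; first by move: hN; clear; lia.
have NK : - K < sm o V - sm i V by move: hN k_gt0; clear; lia.
have [/existsP[u /and3P[hu ux zu]]|hz] := boolP [exists u, [&& u \in V, u != x & zero rl o i u]].
  apply: (zero_solve k_gt0 IHV hs hu zu) => //.
  by right; exists x; rewrite eq_sym.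
have zV v : v \in V -> v != x -> zero rl o i v = false.
  by move=> hv vx; move: hz => /existsPn/(_ v); rewrite hv vx /= => /negbTE.
have [/existsP[v /and3P[hv nv ov]]|ho] :=
  boolP [exists v, [&& v \in V, pos (fun x => - rh x) i o v & 1 <= o v]].
  apply: (solvable_mirror k_gt0 (b_gap hb)).
  exact: (step_posL k_gt0 (state_mirror k_gt0 hs) hv nv ov).
have nego v : v \in V -> pos (fun x => - rh x) i o v -> o v = 0.
  move=> hv nv; move: ho => /existsPn/(_ v); rewrite hv nv /=.
  by have := b_o0 hb v; clear; lia.
have [/existsP[u /existsP[v /and5P[hu hv pu nv wuv]]]|he] := boolP [exists u, exists v,
    [&& u \in V, v \in V, pos rl o i u, pos (fun x => - rh x) i o v & 1 <= w u v]].
  exact: (step_edge k_gt0 hs hu hv pu nv wuv).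
have posneg u v : u \in V -> v \in V -> pos rl o i u -> pos (fun x => - rh x) i o v -> w u v = 0.
  move=> hu hv pu nv; move: he => /existsPn/(_ u)/existsPn/(_ v); rewrite hu hv pu nv /=.
  by have := b_w0 hb u v; clear; lia.
(* Without root arcs at [x] the excess is exactly [K], so any other vertex can take it: its residual
   lower bound is nonzero, hence negative. *)
have [/andP[zx o0]|hzx] := boolP (zero rl o i x && (o x < 1)).
  have o0' : o x = 0 by have := b_o0 hb x; move: o0; clear; lia.
  have : (0 < #|V :\ x|)%N by have := s_card hs; rewrite (cardsD1 x) hx.
  rewrite card_gt0 => /set0Pn[v]; rewrite !inE => /andP[vx hv].
  apply: (zero_solve k_gt0 IHV hs hx zx) => //; right; exists v; split=> //.
    by have := b_o0 hb v; move: ox; rewrite o0'; clear; lia.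
  have eN : sm o V - sm i V = K by move: ox hN; rewrite o0'; clear; lia.
  rewrite eN subrr; have := zV v hv vx; rewrite /zero; have := b_str hb hv.
  have [->|hl] := eqVneq (rl v + i v - o v) 0; first by rewrite mod0z eqxx.
  by move=> h _; move: h hl; clear; lia.
have [||//|allpos] := all_but_pos hs hN hx _ _ zV nego posneg.
- case: (boolP (zero rl o i x)) => [zx|/negbTE]; [right | by left].
  by move: hzx Lx hN; rewrite zx /=; clear; lia.
- by right.
have cx := cut_single hs hx (set1_neq0 x); rewrite deg1 i0 // in cx.
have sx := b_str hb hx; have [j hj] := b_gap hb hx.
have nb : o x < k -> exists2 u, u \in V :\ x & 0 < w x u.
  move=> h; apply: sm_pos; have := nrm_ge0 k_gt0 (rl x + 0 - o x); move: cx h k_gt0; lia_n.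
have [nx|nx] := boolP (pos (fun x => - rh x) i o x).
  have [|u] := nb; first by rewrite nego.
  rewrite !inE => /andP[ux hu]; rewrite (b_sym hb) posneg ?ltxx //; exact: allpos.
have [q [p [e p0 pk]]] : exists q p, [/\ rl x + i x - o x = K * q + p, 0 <= p & p < k].
  have [q [e hp]] := modE k_gt0 (rl x + i x - o x); exists q, ((rl x + i x - o x) %% K)%Z; split=> //.
    by move: hp; clear; lia.
  rewrite lt_neqAle; apply/andP; split; first by apply: contra nx => /eqP ep; rewrite ep in e; apply: pos_half hb hx e.
  case: (trichotomy k_gt0 hb hx) => [/eqP ->||]; [by rewrite ltW | by case/andP | by rewrite (negbTE nx)].
have q0 : K * q <= - K.
  apply: K_mul_le => //; rewrite leNgt; apply/negP => q1.
  have : 0 <= K * q by rewrite mulr_ge0; move: q1 k_gt0; clear; lia.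
  by move: Lx hN e p0; clear; lia.
have H0 : - (K * (q + j)) < K.
  by move: sx hj e pk k_gt0; clear; lia.
have H1 : 0 <= K * (q + j) by apply: K_mul_pos => //; move: H0; clear; lia.
have nLx : nrm (rl x + i x - o x) = p.
  by rewrite e nrm_near //; move: p0 pk; clear; lia.
set N := sm o V - sm i V in hN ox Lx NK *.
have eN : N = sm o V by rewrite /N iV; clear; lia.
(* With few root arcs at [x] there is a free edge at [x], to be replaced by an arc from the root. As
   [N - K <= o x < k - p], the new excess [N + 1] is still nearest to [K]. *)
have [op|op] := ltrP (o x) (k - p).
  have [|u] := nb; first by move: op p0; clear; lia.
  rewrite !inE => /andP[ux hu] wu.
  have cu := cut_single hs hu (set1_neq0 u).
  have [u1 u2 u3 u4] := posP k_gt0 hb hu (allpos u hu ux).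
  have e1 : rl u + i u - o u - 1 - 0 = rl u + i u - o u - 1 by clear; lia.
  have e2 : rl x + i x - o x + 1 - 1 = rl x + i x - o x by clear; lia.
  apply: (step_E k_gt0 (ax := 0) (ay := 1) hs hu hx ux); rewrite ?e1 ?e2 ?u3.
  - by rewrite (b_sym hb); move: wu; clear; lia.
  - by left.
  - by right.
  - by have := b_o0 hb u; clear; lia.
  - by left.
  - by move: u1 u2; clear; lia.
  - by move: sx; clear; lia.
  - by move: cu; lia_n.
  - by have := cut_single hs hx (set1_neq0 x); lia_n.
  split.
  - rewrite !sm_addat hu hx /ind iV -eN.
    have -> : nrm (N + 0 + 1 - 0) = N + 1 - K.
      have -> : N + 0 + 1 - 0 = K * 1 + (N + 1 - K) by clear; lia.
      by rewrite nrm_near //; move: ox op hN p0; clear; lia.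
    by clear; lia.
  - rewrite /dom !sm_addat hu hx /ind iV -eN; right; exists x; split=> //.
      by rewrite addat_same addat_diff 1?eq_sym //; move: ox; clear; lia.
    have xu : x != u by rewrite eq_sym.
    by rewrite !addat_same !addat_diff //; move: e q0 pk p0 op ox; clear; lia.
  - by left; rewrite !sm_addat hu hx /ind iV -eN; move: hN k_gt0; clear; lia.
(* The bound [N - K <= r] serves the root condition. From [k - p <= r <= k] the new residue
   [p + 2 r] is within [p] of [K], so the norm at [x] does not grow; what exceeds [K] is avoided by
   dropping [y <= p] of the arcs altogether. *)
pose r := Order.max (N - K) (k - p).
pose y := Order.max 0 (p + 2 * r - K).
have [rE rp rO] : [/\ N - K <= r, k - p <= r & r <= k].
  by rewrite /r; move: eN oV p0; clear => *; split; lia.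
have rox : r <= o x by rewrite /r; move: ox op; clear; lia.
have hy : (y = 0 /\ p + 2 * r <= K) \/ (y = p + 2 * r - K /\ 0 < y).
  by rewrite /y; clear; lia.
have y0 : 0 <= y by rewrite /y; clear; lia.
move: rE rp rO rox hy y0; clearbody r y => rE rp rO rox hy y0.
apply: (relabel_solve (r := r) (y := y) IHV hs hx); rewrite -?/N //.
- by move: rp pk; clear; lia.
- by move: hy rO p0 pk rp; clear; lia.
- by move: hy e q0 hj H1 p0 pk rp; clear; lia.
- have -> : rl x + i x - o x + (2 * r - y) = K * q + (p + 2 * r - y) by rewrite e; clear; lia.
  rewrite addrC [K * q + _]addrC nrmMD // nrm_in; last by move: hy p0 pk rp rO; clear; lia.
  have := cut_single hs hx (set1_neq0 x); rewrite nLx.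
  by move: hy p0 pk rp rO; lia_n.
- rewrite iV addr0 -eN.
  have [[-> h]|[ey h]] := hy.
    have -> : N - (2 * r - 0) = - (2 * r - (N - K)) + K * 1 by clear; lia.
    rewrite nrmMD // nrmN // nrm_in; last by move: h p0 pk rp rO rE hN; clear; lia.
    by move: h p0 pk rp rO rE hN; clear; lia.
  have -> : N - (2 * r - y) = N - K + p by rewrite ey; clear; lia.
  by rewrite nrm_in; move: ey h p0 pk rp rO rE hN; clear; lia.
- by move: hy hN p0 pk rp rO rE; clear; lia.
Qed.

Theorem mod_orientation V w o i rl rh ex : base V w o i rl rh ex -> rooted V o i rl rh ->
  solvable V w rl rh.
Proof.
elim: {V}_.+1 {-2}V (ltnSn #|V|) w o i rl rh ex => // n IHn V hV w o i rl rh ex hb hr.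
have IHV : hered V.
  move=> V' hV' *; apply: IHn; eauto; exact: leq_trans hV' hV.
elim: {w o i}_.+1 {-2}w {-2}o {-2}i (ltnSn (mu V w o i)) rl rh ex hb hr
  => // m IHm w o i hm rl rh ex hb hr.
have [hV1|hV1] := leqP #|V| 1.
  have [V0|[x hx]] := set_0Vmem V.
    exists (fun x y => Order.max 0 (w x y)); split; last by move=> x; rewrite V0 inE.
      by move=> *; clear; lia.
    by move=> x y; rewrite V0 inE.
  have eV : V = [set x] by apply/eqP; rewrite eq_sym eqEcard sub1set hx cards1.
  have [q hq] := b_sum hb; have [j hj] := b_gap hb hx; have sx := b_str hb hx.
  rewrite eV sm1 in hq.
  exists (fun _ _ => 0); split=> //.
    by move=> s t; rewrite eV !inE => /eqP -> /eqP ->; rewrite (b_diag hb).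
  move=> z; rewrite eV inE => /eqP ->; rewrite /net sm1 subrr hq; split; last first.
    by exists (- q); clear; lia.
  have o0 := b_o0 hb x; have i0 := b_i0 hb x.
  have h1 := r_out hr; have h2 := r_in hr; rewrite /dom eV !sm1 in h1 h2.
  (* The two [dom] conditions put [rl x] and [- rh x] below [K]; being multiples of [K] they are
     nonpositive, and the empty orientation is a solution. *)
  have h3 : rl x < K.
    case: h1 => [h|[s [/set1P -> h h']]]; first by move: h sx; clear; lia.
    by move: h'; clear; lia.
  have h4 : - rh x < K.
    case: h2 => [h|[s [/set1P -> h h']]]; first by move: h sx; clear; lia.
    by move: h'; clear; lia.
  rewrite -hq; apply/andP; split; first by rewrite hq; apply: K_mul_neg => //; rewrite -hq.
  have e : rh x = K * (q + j) by rewrite hj hq; clear; lia.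
  by rewrite e; apply: K_mul_pos => //; rewrite -e; move: h4; clear; lia.
have [/existsP[B /and4P[hBV cB nB hB]]|hn] := boolP [exists B : {set U},
    [&& B \subset V, (1 < #|B|)%N, B != V & deg V w o i B <= K + nrm (low rl o i B)]].
  exact: (tight_contract k_gt0 IHV hb hr hBV cB nB hB).
(* The norm and the degree both have the parity of [low], so a set that is not tight has a margin of
   two. *)
have hsl : slack V w o i rl.
  move=> A hA cA nA; move: hn => /existsPn/(_ A); rewrite hA cA nA /= -ltNge.
  have [a ha] := nrm_par k_gt0 (low rl o i A); have [b hB] := b_par hb hA.
  by move: ha hB; lia_n.
have hs : state V w o i rl rh ex.
  split=> // w' o' i' rl' rh' ex' hm'; apply: IHm.
  exact: leq_trans hm' hm.
case: (b_ex hb) => [eex|[u [hu eex _ _]]]; last by rewrite eex in hs; apply: exempt_solve IHV hs hu.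
rewrite eex in hs.
have [h|h] := ltrP `|sm o V - sm i V| K; first exact: caseI IHV hs h.
have [h'|h'] := lerP 0 (sm o V - sm i V); first by apply: caseII IHV hs _; move: h h'; clear; lia.
apply: (solvable_mirror k_gt0 (b_gap hb)); apply: caseII IHV (state_mirror k_gt0 hs) _.
by move: h h'; clear; lia.
Qed.

End Excess.

(** * Selecting one of two values at each vertex *)

Section Selection.
Variable U : finType.
Implicit Types (A B C R : {set U}) (w a : U -> U -> int) (x y s : U -> int).

Lemma net_cut a w A : (forall u v, 0 <= a u v) -> (forall u v, a u v + a v u = w u v) ->
  `|sm (net a setT) A| <= cut w A (~: A).
Proof.
move=> ha haw.
have -> : sm (net a setT) A = cut (fun u v => a u v - a v u) A (~: A).
  transitivity (cut (fun u v => a u v - a v u) A A + cut (fun u v => a u v - a v u) A (~: A)).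
    rewrite -cutUr ?setUCr //.
    by rewrite disjoints_subset setCK.
  rewrite [X in X + _](_ : _ = 0) ?add0r // /cut.
  rewrite (eq_bigr (fun u => sm (a u) A - sm (fun v => a v u) A)) => [|u _]; last exact: smB.
  by rewrite sumrB [X in _ - X]exchange_big subrr.
have h u v : - w u v <= a u v - a v u <= w u v.
  by have := ha u v; have := ha v u; have := haw u v; clear; lia.
rewrite ler_norml; apply/andP; split.
  by rewrite /cut -smN; apply: sm_le => u _; rewrite -smN; apply: sm_le => v _; case/andP: (h u v).
by apply: sm_le => u _; apply: sm_le => v _; case/andP: (h u v).
Qed.

Lemma sm_net a : sm (net a setT) setT = 0.
Proof.
rewrite /sm /net (eq_bigr (fun u => sm (a u) setT - sm (fun v => a v u) setT)) => [|u _]; last exact: smB.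
by rewrite sumrB [X in _ - X]exchange_big subrr.
Qed.

(** After halving, a net outdegree is congruent to [m v] modulo [2 d] and lies in [[m v, M v]], so
    it is one of the two ends. The error [e] shifts the bounds at [z] and is balanced there by root
    arcs, so all residual demands stay even; as net outdegrees sum to zero, the selected values sum
    to [- e]. *)
Lemma class_select (d : int) w (m M : U -> int) (z : U) (e : int) : 0 < d ->
  (forall u v, w u v = w v u) -> (forall u, w u u = 0) -> (forall u v, 0 <= w u v) ->
  (forall A, A != set0 -> A != setT -> 3 * d <= cut w A (~: A)) ->
  (forall v, m v <= 0 <= M v) -> (forall v, M v = m v \/ M v = m v + 2 * d) ->
  `|e| < 2 * d -> (exists q, sm m setT + e = 2 * d * q) ->
  exists x : U -> int, [/\ forall v, x v = m v \/ x v = M v, sm x setT = - e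
    & forall A, z \notin A -> `|sm x A| <= cut w A (~: A)].
Proof.
move=> d0 wC w0 wp wc hm hM he [q hq].
pose w2 u v := 2 * w u v.
pose rl v := 2 * m v + ind (v == z) (2 * e); pose rh v := 2 * M v + ind (v == z) (2 * e).
pose o v := ind (v == z) (2 * Order.max e 0); pose i v := ind (v == z) (2 * Order.max (- e) 0).
have k0 : 0 < 2 * d by move: d0; clear; lia.
have cut2 A B : cut w2 A B = 2 * cut w A B.
  by rewrite /cut mulr_sumr; apply: eq_bigr => u _; apply: smM.
have lowE A : low rl o i A = 2 * sm m A.
  rewrite /low /o /i /rl !sm_ind smD smM sm_ind /ind; clear -he.
  by case: (z \in A); lia.
have hb : base (2 * d) setT w2 o i rl rh set0.
  split.
  - by move=> u v; rewrite /w2 wC.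
  - by move=> u; rewrite /w2 w0.
  - by move=> u v; have := wp u v; rewrite /w2; clear; lia.
  - by move=> v; rewrite /o /ind; case: ifP => _; clear; lia.
  - by move=> v; rewrite /i /ind; case: ifP => _; clear; lia.
  - by move=> v _; have := hm v; rewrite /o /i /rl /rh /ind; case: ifP => _; clear; lia.
  - move=> v _; rewrite /rl /rh; case: (hM v) => ->; [exists 0 | exists 1]; clear; lia.
  - move=> A _; rewrite lowE /deg cut2 /o /i !sm_ind.
    exists (cut w A (setT :\: A) + ind (z \in A) (Order.max e 0) + ind (z \in A) (Order.max (- e) 0) - sm m A).
    by rewrite /ind; case: (z \in A); clear; lia.
  - move=> A _ A0 AT _; rewrite lowE /deg cut2 setTD.
    have := wc A A0 AT; have := nrm_lek k0 (2 * sm m A).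
    have : 0 <= sm o A by apply: sm_ge0 => v _; rewrite /o /ind; case: ifP => _; clear; lia.
    have : 0 <= sm i A by apply: sm_ge0 => v _; rewrite /i /ind; case: ifP => _; clear; lia.
    by move: d0; lia_n.
  - by exists q; rewrite /rl smD smM sm_ind inE /ind; move: hq; clear; lia.
  - by left.
have hr : rooted (2 * d) setT o i rl rh.
  have N1 : sm o setT = 2 * Order.max e 0 by rewrite /o sm_ind inE.
  have N2 : sm i setT = 2 * Order.max (- e) 0 by rewrite /i sm_ind inE.
  split; rewrite /dom N1 N2; try by left; move: he; clear; lia.
  set N := (X in dist_mul _ X); have := nrm_ge0 k0 N; rewrite {}/N.
  by move: he; lia_n.
have [a [ha haw han]] := mod_orientation k0 hb hr.
have haw' u v : a u v + a v u = w2 u v by apply: haw; rewrite inE.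
have [x hx] : exists x : U -> int, forall v, net a setT v = 2 * x v + ind (v == z) (2 * e)
    /\ (x v = m v \/ x v = M v).
  apply: (@fin_all_exists U _ (fun v (t : int) => net a setT v = 2 * t + ind (v == z) (2 * e)
    /\ (t = m v \/ t = M v))) => v.
  have [h [j hj]] := han v (in_setT v).
  have hj' : 0 <= 2 * d * j <= M v - m v.
    by move: h; rewrite hj /rl /rh; clear; move: (ind _ _) => *; lia.
  exists (m v + 2 * d * j); split; first by rewrite hj /rl; clear; lia.
  have [j0|j0] := lerP j 0.
    left; have : 2 * d * j <= 0 by rewrite mulr_ge0_le0 // ltW.
    by move: hj'; clear; lia.
  right; have := K_mul_ge d0 j0; case: (hM v) => hMv; rewrite hMv in hj' *.
    by move: hj' d0; clear; lia.
  by move: hj'; clear; lia.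
exists x; split.
- by move=> v; case: (hx v).
- have := sm_net a; rewrite (eq_sm (g := fun v => 2 * x v + ind (v == z) (2 * e))) => [|v _]; last by case: (hx v).
  by rewrite smD smM sm_ind inE /ind; clear; lia.
- move=> A zA; have := net_cut A ha haw'; rewrite cut2.
  rewrite (eq_sm (g := fun v => 2 * x v + ind (v == z) (2 * e))) => [|v _]; last by case: (hx v).
  by rewrite smD smM sm_ind (negbTE zA) /ind; clear; lia.
Qed.

Fixpoint ntrees (n : nat) : nat := if n is n'.+1 then (ntrees n' + 3 * n)%N else 0%N.

Lemma ntreesE n : (2 * ntrees n = 3 * (n * n.+1))%N.
Proof. by elim: n => //= n; lia. Qed.

(** The classes are taken in increasing order of [d]: the error inherited from the earlier ones is
    at most [d - 1], and with the new error, at most [d], it stays below the [2 d] allowed by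
    [class_select]. *)
Lemma chain_select (wt : nat -> U -> U -> int) (N : nat) (m M : U -> int) (dl : U -> nat) (z : U) :
  (forall j u v, wt j u v = wt j v u) -> (forall j u, wt j u u = 0) ->
  (forall j u v, 0 <= wt j u v) ->
  (forall j A, (j < N)%N -> A != set0 -> A != setT -> 1 <= cut (wt j) A (~: A)) ->
  (forall v, m v <= 0 <= M v) -> (forall v, M v = m v + 2 * (dl v)%:Z) ->
  forall n, (ntrees n <= N)%N ->
  exists x : U -> int, [/\ forall v, (dl v <= n)%N -> x v = m v \/ x v = M v,
    forall v, (n < dl v)%N -> x v = 0, `|sm x setT| <= n%:Z
    & forall A, z \notin A -> `|sm x A| <= \sum_(0 <= j < ntrees n) cut (wt j) A (~: A)].
Proof.
move=> wC w0 wp wc hm hM; elim=> [|n IHn] hN.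
  exists (fun=> 0); split=> //; last by move=> A _; rewrite /sm big1 // normr0 big_nil.
    move=> v; rewrite leqn0 => /eqP hv; have := hm v; have := hM v; rewrite hv; clear.
    by left; lia.
  by rewrite /sm big1.
have [|x [x1 x2 x3 x4]] := IHn; first by apply: leq_trans hN; rewrite /= leq_addr.
pose d : int := n.+1%:Z; have d0 : 0 < d by [].
pose m' v := if dl v == n.+1 then m v else 0.
pose M' v := if dl v == n.+1 then M v else 0.
pose w u v := \sum_(ntrees n <= j < ntrees n.+1) wt j u v.
have cutw A B : cut w A B = \sum_(ntrees n <= j < ntrees n.+1) cut (wt j) A B.
  rewrite /cut /sm [RHS]exchange_big; apply: eq_bigr => u _ /=.
  by rewrite exchange_big.
have [q hq hq'] := nrm_ex d0 (sm x setT + sm m' setT).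
(* The totals reachable by this class agree modulo [2 d]; [E] is the representative nearest to zero
   and becomes the new total. *)
pose E := sm x setT + sm m' setT - 2 * d * q.
have hE : `|E| <= d by rewrite /E -hq.
have [||||||||y [y1 y2 y3]] := @class_select d w m' M' z (sm x setT - E) d0.
- by move=> u v; apply: eq_bigr => j _; apply: wC.
- by move=> u; apply: big1.
- by move=> u v; apply: sumr_ge0.
- move=> A A0 AT; rewrite cutw.
  have : \sum_(ntrees n <= j < ntrees n.+1) (1 : int) <= \sum_(ntrees n <= j < ntrees n.+1) cut (wt j) A (~: A).
    rewrite big_nat_cond [X in _ <= X]big_nat_cond; apply: ler_sum => j /andP[/andP[_ hj] _].
    by apply: wc => //; apply: leq_trans hj hN.
  rewrite sumr_const_nat /= addKn; apply: le_trans.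
  by rewrite natz /d; clear; lia.
- by move=> v; rewrite /m' /M'; case: ifP.
- by move=> v; rewrite /m' /M'; case: eqP => [e|]; [right; rewrite hM e | left].
- by move: x3 hE; rewrite /d; clear; lia.
- by exists q; rewrite /E; clear; lia.
exists (fun v => x v + y v); split.
- move=> v; rewrite leq_eqVlt => /orP[/eqP e|].
    by rewrite x2 ?e // add0r; have := y1 v; rewrite /m' /M' e eqxx.
  rewrite ltnS => hv; have := y1 v; rewrite /m' /M'.
  have -> : (dl v == n.+1) = false by apply/eqP => e; move: hv; rewrite e ltnn.
  by case=> ->; rewrite addr0; apply: x1.
- move=> v hv; rewrite x2 ?(ltnW hv) // add0r; have := y1 v; rewrite /m' /M'.
  by rewrite gtn_eqF //; case.
- by rewrite smD y2; move: hE; rewrite /d; clear; lia.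
- move=> A zA; rewrite smD; apply: le_trans (ler_normD _ _) _.
  rewrite (@big_cat_nat _ _ _ (ntrees n)) //=; last by rewrite leq_addr.
  by apply: lerD; [apply: x4 | have := y3 A zA; rewrite cutw].
Qed.

(** * Zero-sum-free families of bounded integers *)

Section ZeroSumFree.
Variables (k : int) (s : U -> int) (R : {set U}).
Hypothesis k_gt0 : 1 <= k.
Hypothesis s_k : forall v, v \in R -> `|s v| <= k.
Hypothesis zsf : forall C, C \subset R -> C != set0 -> sm s C != 0.

Definition pp v : int := Order.max (s v) 0.
Definition np v : int := Order.max (- s v) 0.

Lemma sm_parts A : sm s A = sm pp A - sm np A.
Proof. by rewrite -smB; apply: eq_sm => v _; rewrite /pp /np; clear; lia. Qed.

Lemma card_bound A (f : U -> int) : (forall v, v \in A -> f v <= k) ->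
  sm f A <= k * (#|[set v in A | 0 < f v]|)%:Z.
Proof.
move=> h; rewrite (sm_sub f (_ : [set v in A | 0 < f v] \subset A)); last first.
  by apply/subsetP=> v; rewrite inE => /andP[].
have h1 : sm f [set v in A | 0 < f v] <= k * (#|[set v in A | 0 < f v]|)%:Z.
  have <- : sm (fun=> k) [set v in A | 0 < f v] = k * (#|[set v in A | 0 < f v]|)%:Z.
    by rewrite /sm sumr_const -mulr_natr natz.
  by apply: sm_le => v; rewrite inE => /andP[/h].
have h2 : sm f (A :\: [set v in A | 0 < f v]) <= 0.
  apply: sumr_le0 => v; rewrite !inE => /andP[hn hv]; move: hn.
  by rewrite hv /= -leNgt.
by move: h1 h2; clear; lia.
Qed.

(* Prefix sums of a greedy walk are pairwise distinct and stay in the window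
   [1 - b, a], so the walk makes at most [2k - 2] steps before the elements of
   one sign are exhausted. *)
Lemma greedy (a b : int) B (S : seq int) : a + b = 2 * k - 1 ->
  (forall v, v \in R -> - b <= s v <= a) ->
  B \subset R -> uniq S -> size S = #|B|.+1 -> 1 - b <= sm s B <= a ->
  (forall t, t \in S -> 1 - b <= t <= a /\ exists2 C : {set U}, C \subset B & sm s C = t) ->
  sm pp R <= k * (k - 1) \/ sm np R <= k * (k - 1).
Proof.
move=> ab sab; elim: {B}_.+1 {-2}B S (ltnSn #|R :\: B|) => // n IHn B S hn BR uS sS hB hS.
have grow v : v \in R :\: B -> 1 - b <= sm s B + s v <= a ->
    sm pp R <= k * (k - 1) \/ sm np R <= k * (k - 1).
  rewrite inE => /andP[vB vR] hv.
  have eB : sm s (v |: B) = sm s B + s v by rewrite smU ?disjoints1 // sm1 addrC.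
  apply: (IHn (v |: B) (sm s (v |: B) :: S)).
  - rewrite ltnS in hn; apply: leq_trans hn.
    rewrite [X in (_ < X)%N](cardsD1 v) inE vB vR add1n ltnS; apply/subset_leq_card/subsetP => y.
    by rewrite !inE negb_or => /andP[/andP[-> ->] ->].
  - by rewrite subUset sub1set vR.
  (* A repeated sum would leave a zero-sum difference, nonempty because it contains [v]. *)
  - rewrite /= uS andbT; apply/negP => /hS[_ [C CB eC]].
    have : sm s (v |: B :\: C) == 0.
      rewrite smU ?disjoints1 ?inE ?(negbTE vB) ?andbF // sm1.
      by move: eC; rewrite eB (sm_sub _ CB); clear; lia.
    apply/negP/zsf; last by apply/set0Pn; exists v; rewrite !inE eqxx.
    rewrite subUset sub1set vR /=; apply: subset_trans (subsetDl _ _) BR.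
  - by rewrite /= sS cardsU1 vB.
  - by rewrite eB.
  - move=> t; rewrite inE => /orP[/eqP -> |/hS[h1 [C h2 h3]]].
      by split; [rewrite eB | exists (v |: B)].
    by split=> //; exists C => //; apply: subset_trans h2 (subsetUr _ _).
have cB : (#|B|)%:Z <= 2 * k - 2.
  pose L : seq int := [seq (1 - b) + j%:Z | j <- iota 0 (absz (a + b)%R)].
  have : (size S <= size L)%N.
    apply: uniq_leq_size => // t /hS[ht _]; apply/mapP; exists (absz (t - (1 - b))%R).
      by rewrite mem_iota; move: ht; clear; lia.
    by move: ht; clear; lia.
  by rewrite size_map size_iota sS ab; move: k_gt0; clear; lia.
have npc : (#|[set v in B | 0 < pp v]%R| + #|[set v in B | 0 < np v]%R| <= #|B|)%N.
  rewrite -cardsUI (_ : _ :&: _ = set0) ?cards0 ?addn0.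
    by apply/subset_leq_card/subsetP => v; rewrite !inE => /orP[] /andP[].
  apply/setP => v; rewrite !inE /pp /np; case: (v \in B) => //=; clear; lia.
have p1 : sm pp B <= k * (#|[set v in B | 0 < pp v]|)%:Z.
  by apply: card_bound => v /(subsetP BR)/s_k; rewrite /pp; clear; lia.
have p2 : sm np B <= k * (#|[set v in B | 0 < np v]|)%:Z.
  by apply: card_bound => v /(subsetP BR)/s_k; rewrite /np; clear; lia.
have small : sm pp B <= k * (k - 1) \/ sm np B <= k * (k - 1).
  have [h|h] : (#|[set v in B | 0 < pp v]|)%:Z <= k - 1 \/ (#|[set v in B | 0 < np v]|)%:Z <= k - 1.
    by move: npc cB; clear; lia.
  - by left; apply: le_trans p1 _; rewrite ler_wpM2l //; move: k_gt0; clear; lia.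
  - by right; apply: le_trans p2 _; rewrite ler_wpM2l //; move: k_gt0; clear; lia.
have eB := sm_parts B.
(* The next element has the sign opposite to the current sum. If none is left, the total of that
   sign over [R] is attained in [B], where it is the smaller of the two totals. *)
have [hs|hs] := lerP (sm s B) 0.
  have [/existsP[v /andP[vR sv]]|hnv] := boolP [exists v, (v \in R :\: B) && (0 < s v)].
    apply: (grow _ vR); have := sab v; rewrite !inE in vR; case/andP: vR => _ -> /(_ isT).
    by move: hB hs sv; clear; lia.
  left; rewrite (sm_sub _ BR) [X in _ + X](_ : _ = 0) ?addr0; last first.
    rewrite /sm big1 // => v hv; move: hnv => /existsPn/(_ v); rewrite hv /= /pp; clear; lia.
  by case: small; move: eB hs; clear; lia.
have [/existsP[v /andP[vR sv]]|hnv] := boolP [exists v, (v \in R :\: B) && (s v < 0)].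
  apply: (grow _ vR); have := sab v; rewrite !inE in vR; case/andP: vR => _ -> /(_ isT).
  by move: hB hs sv; clear; lia.
right; rewrite (sm_sub _ BR) [X in _ + X](_ : _ = 0) ?addr0; last first.
  rewrite /sm big1 // => v hv; move: hnv => /existsPn/(_ v); rewrite hv /= /np; clear; lia.
by case: small; move: eB hs; clear; lia.
Qed.

(** The values [k] and [- k] cannot both occur, since they form a zero-sum pair; this gives
    [a + b = 2 k - 1] instead of [2 k]. *)
Lemma zsf_bound : sm pp R <= k * (k - 1) \/ sm np R <= k * (k - 1).
Proof.
have go (a b : int) : a + b = 2 * k - 1 -> 0 <= a -> 1 <= b -> (forall v, v \in R -> - b <= s v <= a) ->
   sm pp R <= k * (k - 1) \/ sm np R <= k * (k - 1).
  move=> ab a0 b1 sab; apply: (@greedy a b set0 [:: 0] ab sab); rewrite ?sub0set ?cards0 ?sm0 //.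
    by move: a0 b1; clear; lia.
  move=> t; rewrite inE => /eqP ->; split; first by move: a0 b1; clear; lia.
  by exists set0; rewrite ?sm0.
have [/existsP[v /andP[vR /eqP sv]]|hn] := boolP [exists v, (v \in R) && (s v == k)].
  have hno u : u \in R -> - (k - 1) <= s u.
    move=> uR; have := s_k uR; suff : s u != - k by clear; lia.
    apply/eqP => su; have uv : u != v.
      by apply/eqP => e; move: su; rewrite e sv; move: k_gt0; clear; lia.
    have := @zsf [set u; v]; rewrite subUset !sub1set uR vR => /(_ isT).
    have n0 : [set u; v] != set0 by apply/set0Pn; exists u; rewrite !inE eqxx.
    by move=> /(_ n0); rewrite smU ?disjoints1 ?inE // !sm1 su sv addNr eqxx.
  (* For [k = 1] the window with [b = k - 1] would miss the initial sum zero; there are then no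
     negative values at all. *)
  have [k1|k1] := lerP k 1.
    right; rewrite /sm big1; first by rewrite mulr_ge0; move: k_gt0; clear; lia.
    by move=> u /hno; rewrite /np; move: k1; clear; lia.
  apply: (go k (k - 1)); try by move: k_gt0 k1; clear; lia.
  by move=> u uR; rewrite hno //; have := s_k uR; clear; lia.
apply: (go (k - 1) k); try by move: k_gt0; clear; lia.
move=> u uR; have := s_k uR; move: hn => /existsPn/(_ u); rewrite uR /=; clear; lia.
Qed.

End ZeroSumFree.

(** A smallest set of replacements with the right total contains no nonempty zero-sum part. One sign
    then contributes at most [k (k - 1)], and the other differs from it by half of the required
    correction. *)
Lemma repair (k : int) x y s : 1 <= k -> (forall v, y v = x v + 2 * s v) ->
  (forall v, `|s v| <= k) ->
  exists x' : U -> int, [/\ forall v, x' v = x v \/ x' v = y v, sm x' setT = sm y setT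
    & forall A, `|sm x' A - sm x A| <= 2 * (k * (k - 1)) + `|sm y setT - sm x setT|].
Proof.
move=> k1 hy hs.
pose good (R : {set U}) := sm s R == sm s setT.
have good0 : good setT by rewrite /good.
case: (arg_minnP (fun A : {set U} => #|A|) good0) => R /eqP hR hmin.
have zsf C : C \subset R -> C != set0 -> sm s C != 0.
  move=> CR C0; apply/eqP => e; have : good (R :\: C).
    by rewrite /good -hR (sm_sub _ CR) e add0r.
  move/hmin; rewrite leqNgt proper_card // properE subsetDl /=.
  have /set0Pn[v vC] := C0; apply/negP => /subsetP/(_ v (subsetP CR _ vC)).
  by rewrite inE vC.
have hb := zsf_bound k1 (fun v _ => hs v) zsf.
have eR := sm_parts s R.
exists (fun v => if v \in R then y v else x v); split.
- by move=> v; case: ifP; [right | left].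
- have d v : (if v \in R then y v else x v) = x v + 2 * (if v \in R then s v else 0).
    by case: ifP => _; rewrite ?hy ?mulr0 ?addr0.
  rewrite (eq_sm (g := fun v => x v + 2 * (if v \in R then s v else 0))) => [|v _]; last exact: d.
  rewrite [RHS](eq_sm (g := fun v => x v + 2 * s v)) => [|v _]; last exact: hy.
  rewrite !smD !smM -hR; congr (_ + 2 * _); rewrite /sm [RHS]big_mkcond.
  by apply: eq_big => v; rewrite ?inE.
- move=> A; rewrite -smB.
  rewrite (eq_sm (g := fun v => 2 * (if v \in R then s v else 0))) => [|v _]; last first.
    by case: ifP => _; rewrite ?hy; clear; lia.
  rewrite smM -smB (eq_sm (f := fun v => y v - x v) (g := fun v => 2 * s v)) => [|v _]; last first.
    by rewrite hy; clear; lia.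
  rewrite smM -hR.
  have h1 : sm (fun v => if v \in R then s v else 0) A <= sm (pp s) R.
    rewrite /sm [X in _ <= X]big_mkcond [X in X <= _]big_mkcond; apply: ler_sum => v _.
    by rewrite /pp; case: (v \in A); case: (v \in R); clear; lia.
  have h2 : - sm (np s) R <= sm (fun v => if v \in R then s v else 0) A.
    rewrite -smN /sm [X in X <= _]big_mkcond [X in _ <= X]big_mkcond; apply: ler_sum => v _.
    by rewrite /np; case: (v \in A); case: (v \in R); clear; lia.
  have h3 : 0 <= sm (pp s) R by apply: sm_ge0 => v _; rewrite /pp; clear; lia.
  have h4 : 0 <= sm (np s) R by apply: sm_ge0 => v _; rewrite /np; clear; lia.
  by move: hb eR h1 h2 h3 h4; move: (k * _) => kk; clear; lia.
Qed.

End Selection.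

(** * Orientations with prescribed net outdegrees *)

Section Orientation.
Variables (U E : finType) (p q : E -> U).
Implicit Types (A B : {set U}) (H F : {set E}) (T : U -> int).

Definition crs A (e : E) : int :=
  ind ((p e \in A) && (q e \in ~: A)) 1 + ind ((q e \in A) && (p e \in ~: A)) 1.

Definition wgt H (u v : U) : int := \sum_(e in H) addw (fun _ _ => 0) (p e) (q e) 1 u v.

Lemma cut_wgt H A : cut (wgt H) A (~: A) = sm (crs A) H.
Proof.
transitivity (sm (fun e => cut (addw (fun _ _ => 0) (p e) (q e) 1) A (~: A)) H).
  rewrite /cut /wgt /sm [RHS]exchange_big; apply: eq_bigr => u _ /=.
  by rewrite exchange_big.
apply: eq_sm => e _; rewrite cut_addw [X in X + _ + _](_ : _ = 0) ?add0r //.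
by rewrite /cut big1 // => u _; rewrite /sm big1.
Qed.

Lemma crs_ge0 A e : 0 <= crs A e.
Proof. by rewrite /crs /ind; case: ifP => _; case: ifP => _; clear; lia. Qed.

Lemma crsC A e : crs (~: A) e = crs A e.
Proof. by rewrite /crs setCK addrC ![(_ \in ~: A) && _]andbC. Qed.

Lemma wgtC H u v : wgt H u v = wgt H v u.
Proof.
apply: eq_bigr => e _; rewrite /addw [(v == p e) && _]andbC [(v == q e) && _]andbC.
by move: (ind _ _) (ind _ _) => a b; clear; lia.
Qed.

Lemma wgt_ge0 H u v : 0 <= wgt H u v.
Proof. by apply: sumr_ge0 => e _; rewrite /addw /ind; case: ifP => _; case: ifP => _; clear; lia. Qed.

Lemma crs_uncross A B e : crs (A :&: B) e + crs (A :|: B) e <= crs A e + crs B e.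
Proof.
rewrite /crs /ind !inE.
by case: (p e \in A); case: (q e \in A); case: (p e \in B); case: (q e \in B) => /=; clear; lia.
Qed.

Lemma smUI (f : U -> int) A B : sm f A + sm f B = sm f (A :&: B) + sm f (A :|: B).
Proof.
have -> : A :|: B = B :|: (A :\: (A :&: B)).
  by apply/setP=> x; rewrite !inE; case: (x \in A); case: (x \in B).
rewrite smU; last first.
  by rewrite disjoints_subset; apply/subsetP=> x; rewrite !inE; case: (x \in A); case: (x \in B).
by rewrite (sm_sub f (subsetIl A B)); clear; lia.
Qed.

Definition sgn F e : int := if e \in F then 1 else -1.

(* If neither orientation of [e] preserves the cut condition, there are two
   tight sets separating the ends of [e] in opposite directions; uncrossing
   them gains the contribution of [e] itself. *)
Lemma orientation H T : (forall e, e \in H -> p e != q e) -> sm T setT = 0 ->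
  (forall A, sm T A <= sm (crs A) H) ->
  (forall A, exists m, sm (crs A) H = sm T A + 2 * m) ->
  exists2 F : {set E}, F \subset H &
    forall v, T v = sm (fun e => sgn F e * (ind (p e == v) 1 - ind (q e == v) 1)) H.
Proof.
elim: {H}_.+1 {-2}H (ltnSn #|H|) T => // n IHn H hn T hpq T0 hT hpar.
have [H0|[e he]] := set_0Vmem H.
  exists set0; rewrite ?sub0set // => v; rewrite H0 sm0.
  (* As the total is zero, the condition on the complement is the reverse inequality. *)
  have := hT [set v]; have := hT (setT :\ v); have := smD1 T (in_setT v).
  by rewrite H0 !sm0 sm1 T0; clear; lia.
have hpe := hpq e he.
have qp : (q e == p e) = false by rewrite eq_sym (negbTE hpe).
pose T1 (c : int) := addat (addat T (p e) (- c)) (q e) c.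
have smT1 c A : sm (T1 c) A = sm T A + ind (p e \in A) (- c) + ind (q e \in A) c.
  by rewrite /T1 !sm_addat.
(* The value [c = 1] directs [e] from [p e] to [q e] and puts it into [F]. *)
have step c : (c = 1 \/ c = -1) -> (forall A, sm (T1 c) A <= sm (crs A) (H :\ e)) ->
  exists2 F : {set E}, F \subset H &
    forall v, T v = sm (fun e => sgn F e * (ind (p e == v) 1 - ind (q e == v) 1)) H.
  move=> hc hle; have [||||| F FH hF] := IHn (H :\ e) _ (T1 c).
  - by move: hn; rewrite (cardsD1 e H) he.
  - by move=> e' /setD1P[_ /hpq].
  - by rewrite smT1 T0 !inE /ind; clear; lia.
  - exact: hle.
  - move=> A; have [m hm] := hpar A; rewrite smT1 (smD1 _ he) in hm *.
    move: hm; rewrite /crs !inE; case: (p e \in A); case: (q e \in A) => /= hm.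
    + by exists m; move: hm; rewrite /ind; clear; lia.
    + by case: hc => ->; [exists m | exists (m - 1)]; move: hm; rewrite /ind; clear; lia.
    + by case: hc => ->; [exists (m - 1) | exists m]; move: hm; rewrite /ind; clear; lia.
    + by exists m; move: hm; rewrite /ind; clear; lia.
  have eF : e \notin F by apply/negP => /(subsetP FH); rewrite !inE eqxx.
  exists (if c == 1 then e |: F else F).
    have FH' : F \subset H by apply: subset_trans FH (subD1set _ _).
    by case: ifP => // _; rewrite subUset sub1set he.
  move=> v; rewrite (smD1 _ he).
  have -> : sm (fun e' => sgn (if c == 1 then e |: F else F) e' * (ind (p e' == v) 1 - ind (q e' == v) 1)) (H :\ e)
     = T1 c v.
    rewrite hF; apply: eq_sm => e' /setD1P[ee' _]; congr (_ * _).
    by rewrite /sgn; case: (c == 1); rewrite ?inE ?(negbTE ee').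
  have -> : sgn (if c == 1 then e |: F else F) e = c.
    by rewrite /sgn; case: hc => ->; rewrite ?inE ?eqxx ?(negbTE eF).
  rewrite /T1 /addat ![v == _]eq_sym; clear; rewrite /ind.
  by case: (p e == v); case: (q e == v); lia.
have [/existsP[A /and3P[qA pA tA]]|h1] := boolP [exists A : {set U},
    [&& q e \in A, p e \notin A & sm T A == sm (crs A) H]]; last first.
  apply: (step 1); first by left.
  (* By parity, a cut that is not tight has a margin of two, enough for an edge directed against the
     demand. *)
  move=> A; have [m hm] := hpar A; have := hT A; move: h1 => /existsPn/(_ A).
  move: hm; rewrite smT1 (smD1 _ he) /crs !inE /ind.
  by case: (p e \in A); case: (q e \in A) => /=; clear; lia.
have [/existsP[B /and3P[pB qB tB]]|h1] := boolP [exists A : {set U},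
    [&& p e \in A, q e \notin A & sm T A == sm (crs A) H]]; last first.
  apply: (step (-1)); first by right.
  move=> B; have [m hm] := hpar B; have := hT B; move: h1 => /existsPn/(_ B).
  move: hm; rewrite smT1 (smD1 _ he) /crs !inE /ind.
  by case: (p e \in B); case: (q e \in B) => /=; clear; lia.
have := hT (A :&: B); have := hT (A :|: B); have := smUI T A B.
rewrite (eqP tA) (eqP tB) !(smD1 _ he).
have h : sm (crs (A :&: B)) (H :\ e) + sm (crs (A :|: B)) (H :\ e)
      <= sm (crs A) (H :\ e) + sm (crs B) (H :\ e).
  by rewrite -!smD; apply: sm_le => e' _; apply: crs_uncross.
have -> : crs A e = 1 by rewrite /crs !inE (negbTE pA) qA.
have -> : crs B e = 1 by rewrite /crs !inE (negbTE qB) pB.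
have -> : crs (A :&: B) e = 0 by rewrite /crs !inE (negbTE pA) (negbTE qB) !andbF.
have -> : crs (A :|: B) e = 0 by rewrite /crs !inE pB qA !orbT.
by move: h; clear; lia.
Qed.

End Orientation.

(** * The factor *)

Section Graph.
Variables (G : mgraph) (X Y : {set vertex G}).
Hypothesis hXY : bipartition X Y.
Local Notation V := (vertex G).
Local Notation Eb := (edges_between X Y).
Implicit Types (e : edge G) (S F H J : factor G) (A : {set V}) (v : V).

Definition src e := if (ends e).1 \in X then (ends e).1 else (ends e).2.
Definition snk e := if (ends e).1 \in X then (ends e).2 else (ends e).1.
Definition inc v e : int := ind ((ends e).1 == v) 1 + ind ((ends e).2 == v) 1.

Lemma in_Y v : (v \in Y) = (v \notin X).
Proof.
have [hU hd] := hXY; apply/idP/idP => [vY|vX].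
  by apply/negP => vX; move: hd => /pred0P/(_ v); rewrite /= vX vY.
by have := in_setT v; rewrite -hU inE (negbTE vX).
Qed.

Lemma between_ends e : e \in Eb ->
  [/\ src e \in X, snk e \notin X & ends e = (src e, snk e) \/ ends e = (snk e, src e)].
Proof.
rewrite inE !in_Y /src /snk; case: (ends e) => a b /=.
by case aX: (a \in X); case bX: (b \in X) => //= _; split; rewrite ?aX ?bX //; auto.
Qed.

Lemma src_neq_snk e : e \in Eb -> src e != snk e.
Proof. by case/between_ends => h1 h2 _; apply: contraNneq h2 => <-. Qed.

Lemma inc_between e v : e \in Eb -> inc v e = ind (src e == v) 1 + ind (snk e == v) 1.
Proof. by case/between_ends => _ _; rewrite /inc => -[] -> //=; rewrite addrC. Qed.

Lemma card_sm S (P : pred (edge G)) :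
  (#|[set e in S | P e]|)%:Z = sm (fun e => ind (P e) 1) S.
Proof.
have <- : sm (fun=> 1) [set e in S | P e] = (#|[set e in S | P e]|)%:Z.
  by rewrite /sm sumr_const natz.
rewrite /sm [LHS]big_mkcond [RHS]big_mkcond; apply: eq_bigr => e _.
by rewrite inE /ind; case: (e \in S); case: (P e).
Qed.

Lemma degreeE S v : (degree S v)%:Z = sm (inc v) S.
Proof. by rewrite /degree PoszD !card_sm -smD. Qed.

Lemma sm_inc S A : sm (fun v => sm (inc v) S) A
  = sm (fun e => ind ((ends e).1 \in A) 1 + ind ((ends e).2 \in A) 1) S.
Proof.
rewrite /sm exchange_big; apply: eq_bigr => e _ /=.
rewrite -!sm_ind -smD; apply: eq_sm => v _; rewrite /inc.
by rewrite ![(v == _)]eq_sym.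
Qed.

(** Edges with both ends in [A] count twice in the degree sum and not at all in the cut. *)
Lemma sm_crs_parity H A : H \subset Eb -> exists m,
  sm (crs src snk A) H = sm (fun v => sm (inc v) H) A + 2 * m.
Proof.
move=> hH; rewrite sm_inc; exists (- sm (fun e => ind ((src e \in A) && (snk e \in A)) 1) H).
rewrite mulrN -smM -smB; apply: eq_sm => e /(subsetP hH)/between_ends[_ _ h].
have -> : ind ((ends e).1 \in A) 1 + ind ((ends e).2 \in A) 1
   = ind (src e \in A) 1 + ind (snk e \in A) 1 by case: h => -> //=; rewrite addrC.
by rewrite /crs !inE /ind; case: (src e \in A); case: (snk e \in A).
Qed.

Lemma sm_crs_ge0 A H : 0 <= sm (crs src snk A) H.
Proof. by apply: sm_ge0 => e _; apply: crs_ge0. Qed.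

Lemma connected_crs H A : H \subset Eb -> connected H -> A != set0 -> A != setT ->
  1 <= sm (crs src snk A) H.
Proof.
move=> hH hc /set0Pn[x xA] AT; rewrite leNgt; apply/negP => h.
have cl : closed (adjacent H) (mem A).
  move=> a b /existsP[e /andP[eH jo]].
  have := le1_sm (fun e' _ => crs_ge0 src snk A e') eH.
  have [_ _ he] := between_ends (subsetP hH _ eH).
  have {}jo : (a = src e /\ b = snk e) \/ (a = snk e /\ b = src e).
    by case/orP: jo => /eqP; case: he => -> [-> ->]; auto.
  move: h; rewrite /crs !inE; case: jo => -[-> ->];
    by case: (src e \in A); case: (snk e \in A) => //=; rewrite /ind /=; move: (sm _ _) => t; clear; lia.
case/negP: AT; rewrite -subTset; apply/subsetP => y _.
by have := closed_connect cl (hc x y) => /=; rewrite xA => <-.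
Qed.

Section Trees.
Variables (N : nat) (T : 'I_N -> factor G).
Hypothesis T_tree : forall i, spanning_tree (T i).
Hypothesis T_sub : forall i, T i \subset Eb.
Hypothesis T_disj : forall i j, i != j -> [disjoint T i & T j].

(** Indexing by all naturals, with an empty default, allows sums over intervals of trees. *)
Definition tree (j : nat) : factor G := if insub j is Some i then T i else set0.

Lemma tree_sub j : tree j \subset Eb.
Proof. by rewrite /tree; case: insub => [i|]; rewrite ?sub0set. Qed.

Lemma tree_crs j A : (j < N)%N -> A != set0 -> A != setT -> 1 <= sm (crs src snk A) (tree j).
Proof.
move=> hj; apply: connected_crs (tree_sub j) _.
by rewrite /tree insubT; case: (T_tree (Sub j hj)).
Qed.

Lemma trees_crs n A : (n <= N)%N -> A != set0 -> A != setT ->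
  \sum_(0 <= j < n) sm (crs src snk A) (tree j) + (N%:Z - n%:Z) <= sm (crs src snk A) Eb.
Proof.
move=> hn A0 AT.
have h1 : \sum_(0 <= j < N) sm (crs src snk A) (tree j) <= sm (crs src snk A) Eb.
  rewrite big_mkord (eq_bigr (fun i : 'I_N => sm (crs src snk A) (T i))) => [|i _]; last first.
    by rewrite /tree valK.
  have <- : sm (crs src snk A) (\bigcup_i T i) = \sum_(i < N) sm (crs src snk A) (T i).
    by apply: partition_disjoint_bigcup.
  have hs : \bigcup_i T i \subset Eb by apply/bigcupsP.
  by rewrite (sm_sub _ hs) lerDl sm_crs_ge0.
have h2 : N%:Z - n%:Z <= \sum_(n <= j < N) sm (crs src snk A) (tree j).
  have -> : N%:Z - n%:Z = \sum_(n <= j < N) (1 : int).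
    by rewrite sumr_const_nat natz subzn.
  rewrite big_nat_cond [X in _ <= X]big_nat_cond; apply: ler_sum => j /andP[/andP[_ hj] _].
  exact: tree_crs.
by apply: le_trans h1; rewrite [X in _ <= X](@big_cat_nat _ _ _ n) //= lerD2l.
Qed.

End Trees.

Lemma sm_sgn F H (u : edge G -> int) : F \subset H ->
  sm (fun e => sgn F e * u e) H = 2 * sm u F - sm u H.
Proof.
move=> FH; rewrite !(sm_sub _ FH).
have -> : sm (fun e => sgn F e * u e) F = sm u F.
  by apply: eq_sm => e eF; rewrite /sgn eF mul1r.
have -> : sm (fun e => sgn F e * u e) (H :\: F) = - sm u (H :\: F).
  by rewrite -smN; apply: eq_sm => e; rewrite inE /sgn => /andP[/negbTE -> _]; rewrite mulN1r.
by clear; lia.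
Qed.

Lemma orientation_degree F v : F \subset Eb ->
  sm (fun e => sgn F e * (ind (src e == v) 1 - ind (snk e == v) 1)) Eb
  = if v \in X then 2 * sm (inc v) F - sm (inc v) Eb else sm (inc v) Eb - 2 * sm (inc v) F.
Proof.
move=> FE; rewrite sm_sgn // !smB.
have h H : H \subset Eb -> if v \in X then
     sm (fun e => ind (src e == v) 1) H = sm (inc v) H /\ sm (fun e => ind (snk e == v) 1) H = 0
   else sm (fun e => ind (src e == v) 1) H = 0 /\ sm (fun e => ind (snk e == v) 1) H = sm (inc v) H.
  move=> hH.
  have e1 : sm (inc v) H = sm (fun e => ind (src e == v) 1) H + sm (fun e => ind (snk e == v) 1) H.
    by rewrite -smD; apply: eq_sm => e /(subsetP hH)/inc_between ->.
  case: ifP => vX; rewrite e1.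
    have -> : sm (fun e => ind (snk e == v) 1) H = 0.
      rewrite /sm big1 // => e /(subsetP hH)/between_ends[_ h _].
      by rewrite /ind; case: eqP => // ev; rewrite ev vX in h.
    by rewrite addr0.
  have -> : sm (fun e => ind (src e == v) 1) H = 0.
    rewrite /sm big1 // => e /(subsetP hH)/between_ends[h _ _].
    by rewrite /ind; case: eqP => // ev; rewrite ev vX in h.
  by rewrite add0r.
have := h F FE; have := h Eb (subxx _); case: ifP => _ [-> ->] [-> ->]; clear; lia.
Qed.

Definition inner (Z : {set V}) : factor G := [set e | ((ends e).1 \in Z) && ((ends e).2 \in Z)].

Lemma inner_inc0 Z v S : S \subset inner Z -> v \notin Z -> sm (inc v) S = 0.
Proof.
move=> hS vZ; rewrite /sm big1 // => e /(subsetP hS); rewrite inE /inc /ind => /andP[h1 h2].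
by case: eqP => [e1|_]; [rewrite e1 (negbTE vZ) in h1|]; case: eqP => // e2; rewrite e2 (negbTE vZ) in h2.
Qed.

Lemma sm_inc_setT S : sm (fun v => sm (inc v) S) setT = 2 * (#|S|)%:Z.
Proof.
rewrite sm_inc (eq_sm (g := fun=> 2)) => [|e _]; last by rewrite !inE.
by rewrite /sm sumr_const -[LHS]mulr_natr [X in _ * X = _]natz.
Qed.

Lemma sm_edges (u : edge G -> int) :
  sm u setT = sm u Eb + sm u (inner X) + sm u (inner Y).
Proof.
rewrite (sm_sub u (subsetT Eb)) -addrA; congr (_ + _); rewrite -smU; last first.
  by rewrite disjoints_subset; apply/subsetP=> e; rewrite !inE !in_Y => /andP[-> ->].
congr (sm u _); apply/setP=> e; rewrite !inE !in_Y.
by case: ((ends e).1 \in X); case: ((ends e).2 \in X).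
Qed.

Lemma inc_ge0 v e : 0 <= inc v e.
Proof. by rewrite /inc /ind; case: ifP => _; case: ifP => _. Qed.

Lemma between_sum : sm (fun v => sm (inc v) Eb) X = sm (fun v => sm (inc v) Eb) (~: X).
Proof.
rewrite !sm_inc; apply: eq_sm => e /between_ends[h1 h2 h3].
by case: h3 => -> /=; rewrite !inE h1 h2 (negbTE h2).
Qed.

End Graph.

(** * Assembling the factor *)

Lemma subset_of_card (E : finType) (S : {set E}) (j : nat) : (j <= #|S|)%N ->
  exists2 J : {set E}, J \subset S & #|J| = j.
Proof.
move=> hj; exists [set e in take j (enum S)].
  by apply/subsetP=> e; rewrite inE => /mem_take; rewrite mem_enum.
rewrite cardsE; have /card_uniqP -> : uniq (take j (enum S)) by rewrite take_uniq ?enum_uniq.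
by rewrite size_takel // -cardE.
Qed.

Unset Implicit Arguments.

Theorem theorem3p5 (k : nat) (G : mgraph) (g f : vertex G -> int)
    (X Y : {set vertex G})
    (hgf : forall v : vertex G,
       (g v)%:~R <= (degree [set: edge G] v)%:R / 2 :> rat
       /\ (degree [set: edge G] v)%:R / 2 <= (f v)%:~R :> rat)
    (hk : forall v : vertex G, `|f v - g v| <= k%:Z)
    (hXY : bipartition X Y)
    (htree : tree_connected (4 * k ^ 2 + 2 * k)%N (edges_between X Y))
    (he : (edges_in X)%:Z + (edges_in Y)%:Z <= k%:Z - 1)
    (hex : exists h : vertex G -> int,
       [/\ forall v : vertex G, h v = g v \/ h v = f v,
           (2 %| \sum_(v : vertex G) h v)%Z,
           \sum_(v in X) h v - \sum_(v in Y) h v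
             <= 2 * (edges_in X)%:Z + 1
         & 0 <= \sum_(v in X) h v - \sum_(v in Y) h v]) :
  exists F : factor G,
    forall v : vertex G,
      (degree F v)%:Z = g v \/ (degree F v)%:Z = f v.
Proof.
case: hex => h [hh /dvdzP[r hr] hup hlo].
have [z _|V0] := pickP (fun _ : vertex G => true); last first.
  by exists set0 => v; have := V0 v.
have k1 : (1 <= k)%N by move: he; clear; lia.
have eY : Y = ~: X by apply/setP => v; rewrite (in_Y hXY) inE.
pose d v := sm (inc v) [set: edge G].
have hd v : 2 * g v <= d v <= 2 * f v.
  have [h1 h2] := hgf v; rewrite /d -degreeE.
  rewrite ler_pdivlMr // in h1; rewrite ler_pdivrMr // in h2.
  have e1 (t : int) : t%:~R * 2 = (2 * t)%:~R :> rat by rewrite intrM mulrC.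
  rewrite e1 (_ : (degree _ _)%:R = ((degree [set: edge G] v)%:Z)%:~R) // ler_int in h1.
  rewrite e1 (_ : (degree _ _)%:R = ((degree [set: edge G] v)%:Z)%:~R) // ler_int in h2.
  by rewrite h1 h2.
(* The number of edges inside [X] that the factor will use. The difference of the two sums of [h] is
   even, so its odd upper bound gives [j <= edges_in X]. *)
pose j := absz (r - sm h Y).
have hsum : sm h X + sm h Y = r * 2.
  rewrite -hr -[RHS]/(\sum_(v | true) h v) (bigID (mem X)) /=; congr (_ + _).
  by apply: eq_bigl => v; rewrite (in_Y hXY).
rewrite -!/(sm h _) in hup hlo.
have hj : sm h X - sm h Y = 2 * j%:Z by rewrite /j; move: hsum hlo; clear; lia.
have jX : (j <= #|inner X|)%N by rewrite -/(edges_in X); move: hj hup; clear; lia.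
have [J JX cJ] := subset_of_card jX.
pose dX v := sm (inc v) (inner X); pose dY v := sm (inc v) (inner Y).
pose dJ v := sm (inc v) J; pose db v := sm (inc v) (edges_between X Y).
have hdE v : d v = db v + dX v + dY v by rewrite /d (sm_edges hXY).
have dX0 v : v \notin X -> dX v = 0 by move=> vX; apply: inner_inc0 (subxx _) vX.
have dJ0 v : v \notin X -> dJ v = 0 by move=> vX; apply: inner_inc0 JX vX.
have dY0 v : v \in X -> dY v = 0.
  by move=> vX; apply: inner_inc0 (subxx _) _; rewrite (in_Y hXY) vX.
have dJX v : 0 <= dJ v <= dX v.
  rewrite /dX (sm_sub _ JX) lerDl !sm_ge0 // => e _; exact: inc_ge0.
have dY_ge0 v : 0 <= dY v by apply: sm_ge0 => e _; apply: inc_ge0.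
have sX : sm dX setT = 2 * (edges_in X)%:Z by apply: sm_inc_setT.
have sY : sm dY setT = 2 * (edges_in Y)%:Z by apply: sm_inc_setT.
have sJ : sm dJ setT = 2 * j%:Z by rewrite (sm_inc_setT J) cJ.
have setTX (u : vertex G -> int) : sm u setT = sm u X + sm u (~: X).
  by rewrite (sm_sub u (subsetT X)) setTD.
(* The shift of the net outdegrees when the edges of [J] join the factor and all other edges inside
   [X] or [Y] stay out. *)
pose c v := if v \in X then dX v - 2 * dJ v else - dY v.
have hc A : `|sm c A| <= 2 * k%:Z - 2.
  have cb v : - (dX v + dY v) <= c v <= dX v + dY v.
    by rewrite /c; have := dJX v; have := dY_ge0 v; case: ifP => _; clear; lia.
  have b1 : sm (fun v => dX v + dY v) A <= sm (fun v => dX v + dY v) setT.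
    rewrite (sm_sub _ (subsetT A)) lerDl; apply: sm_ge0 => v _.
    by have := dJX v; have := dY_ge0 v; clear; lia.
  have b2 : sm c A <= sm (fun v => dX v + dY v) A by apply: sm_le => v _; case/andP: (cb v).
  have b3 : - sm (fun v => dX v + dY v) A <= sm c A.
    by rewrite -smN; apply: sm_le => v _; case/andP: (cb v).
  by move: b1 b2 b3; rewrite [X in _ <= X]smD sX sY; move: he; clear; lia.
(* The net outdegree that degree [t v] would mean if every edge at [v] were oriented;
   [g v <= d v / 2 <= f v] puts zero between the two options. *)
pose opt (t : vertex G -> int) v := if v \in X then 2 * t v - d v else d v - 2 * t v.
pose m v := if v \in X then opt g v else opt f v.
pose M v := if v \in X then opt f v else opt g v.
pose y := opt h.
have smc : sm c setT = 2 * (edges_in X)%:Z - 4 * j%:Z - 2 * (edges_in Y)%:Z.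
  have -> : sm c setT = sm (fun v => dX v - 2 * dJ v - dY v) setT.
    apply: eq_sm => v _; rewrite /c; case: ifP => vX; first by rewrite dY0 // subr0.
    by rewrite dX0 ?vX // dJ0 ?vX //; clear; lia.
  by rewrite !smB smM sX sY sJ; clear; lia.
(* This is where the size of [J] matters: it makes the shifted demands of [h] sum to zero. *)
have smy : sm y setT = - sm c setT.
  have e1 : sm y X = 2 * sm h X - (sm db X + sm dX setT).
    rewrite (setTX dX) (_ : sm dX (~: X) = 0) ?addr0; last first.
      by rewrite /sm big1 // => v; rewrite inE => /dX0.
    rewrite -smD -smM -smB; apply: eq_sm => v vX.
    by rewrite /y /opt vX hdE dY0 // addr0.
  have e2 : sm y (~: X) = sm db (~: X) + sm dY setT - 2 * sm h Y.
    rewrite (setTX dY) (_ : sm dY X = 0) ?add0r; last first.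
      by rewrite /sm big1 // => v /dY0.
    rewrite eY -smD -smM -smB; apply: eq_sm => v; rewrite inE => vX.
    by rewrite /y /opt (negbTE vX) hdE dX0 // addr0.
  have e3 : sm db X = sm db (~: X) by apply: between_sum.
  by rewrite setTX e1 e2 e3 smc sX sY; move: hj; clear; lia.
have hmM v : m v <= 0 <= M v.
  by have := hd v; rewrite /m /M /opt; case: (v \in X); clear; lia.
pose dl v := absz (f v - g v).
have hdl v : M v = m v + 2 * (dl v)%:Z.
  by have := hd v; rewrite /m /M /opt /dl; case: (v \in X); clear; lia.
have dlk v : (dl v <= k)%N by have := hk v; rewrite /dl; clear; lia.
have [T [hT1 hT2 hT3]] := htree.
set N := (4 * k ^ 2 + 2 * k)%N in T hT1 hT2 hT3.
have tk : (ntrees k <= N)%N by have := ntreesE k; rewrite /N; clear; lia.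
pose wt i := wgt (src X) (snk X) (tree T i).
have cutE i A : cut (wt i) A (~: A) = sm (crs (src X) (snk X) A) (tree T i) by apply: cut_wgt.
have [||||x [x1 _ x3 x4]] := @chain_select _ wt N m M dl z _ _ _ _ hmM hdl k tk.
- by move=> i u v; apply: wgtC.
- move=> i u; apply: big1 => e eT.
  have := src_neq_snk hXY (subsetP (tree_sub hT2 i) _ eT); rewrite /addw /ind ![u == _]eq_sym.
  by case: (src X e =P u) => [<-|_]; rewrite ?andbF //= eq_sym => /negbTE ->.
- by move=> i u v; apply: wgt_ge0.
- by move=> i A hi A0 AT; rewrite cutE; apply: (tree_crs hXY hT1 hT2 hi).
have yM v : y v = m v \/ y v = M v.
  by rewrite /y /m /M /opt; case: (hh v) => ->; case: (v \in X); auto.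
have [s hs] : exists s : vertex G -> int, forall v, y v = x v + 2 * s v /\ `|s v| <= k%:Z.
  apply: (@fin_all_exists _ _ (fun v (t : int) => y v = x v + 2 * t /\ `|t| <= k%:Z)) => v.
  have := x1 v (dlk v); have := yM v; have := hdl v; have := dlk v; clear => dk e [->|->] [->|->].
  + by exists 0; lia.
  + by exists (- (dl v)%:Z); lia.
  + by exists (dl v)%:Z; lia.
  + by exists 0; lia.
have k1' : 1 <= k%:Z by move: k1; clear; lia.
have [x' [x'1 x'2 x'3]] := repair k1' (fun v => (hs v).1) (fun v => (hs v).2).
have [h' hh'] : exists h' : vertex G -> int, forall v, (h' v = g v \/ h' v = f v) /\ x' v = opt h' v.
  apply: (@fin_all_exists _ _ (fun v (t : int) => (t = g v \/ t = f v) /\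
     x' v = if v \in X then 2 * t - d v else d v - 2 * t)) => v.
  have : x' v = m v \/ x' v = M v.
    by case: (x'1 v) => ->; [apply: x1 | apply: yM].
  by rewrite /m /M /opt; case: (v \in X) => -[->|->]; [exists (g v) | exists (f v) | exists (f v) | exists (g v)]; auto.
pose T' v := x' v + c v.
have T'E v : T' v = if v \in X then 2 * (h' v - dJ v) - db v else db v - 2 * h' v.
  rewrite /T' (hh' v).2 /opt /c hdE; case: ifP => vX; first by rewrite dY0 //; clear; lia.
  by rewrite dX0 ?vX //; clear; lia.
have sT : sm T' setT = 0 by rewrite smD x'2 smy addNr.
have bound (A : {set vertex G}) : z \notin A -> `|sm T' A| <= sm (crs (src X) (snk X) A) (edges_between X Y).
  move=> zA; have AT : A != setT by apply: contraNneq zA => ->; rewrite inE.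
  have [->|A0] := eqVneq A set0; first by rewrite sm0 normr0; apply: sm_crs_ge0.
  have b1 := x4 A zA; rewrite (eq_bigr _ (fun i _ => cutE i A)) in b1.
  have b2 := trees_crs hXY hT1 hT2 hT3 tk A0 AT.
  have b3 := x'3 A; have b4 := hc A; have b5 := hc setT.
  (* Of [5 k - 4], the total left by the selection takes [k], the total of [c] to be matched takes
     [2 k - 2], and [c] on [A] itself takes [2 k - 2]. The inequality amounts to
     [(2 k - 5) ^ 2 + 7 >= 0]. *)
  have b6 : 2 * (k%:Z * (k%:Z - 1)) + 5 * k%:Z - 4 <= N%:Z - (ntrees k)%:Z.
    have e1 : N%:Z = 4 * (k%:Z * k%:Z) + 2 * k%:Z by rewrite /N -mulnn PoszD !PoszM.
    have e2 : 2 * (ntrees k)%:Z = 3 * (k%:Z * k%:Z) + 3 * k%:Z.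
      by have := ntreesE k; rewrite mulnS; clear; lia.
    have e3 : 0 <= (2 * k%:Z - 5) * (2 * k%:Z - 5) by rewrite -expr2 sqr_ge0.
    by move: e1 e2 e3; move: (Posz N) (Posz (ntrees k)); clear; nia.
  rewrite smy in b3; rewrite smD.
  move: b1 b2 b3 b4 b5 b6 x3; move: (\sum_(_ <= _ < _) _) (sm (crs _ _ _) _) (k%:Z * _) => a1 a2 a3.
  by clear; lia.
(* The selection controls only sets avoiding [z]; the others follow by complement, since [T'] sums
   to zero. *)
have le_crs (A : {set vertex G}) : sm T' A <= sm (crs (src X) (snk X) A) (edges_between X Y).
  have [zA|zA] := boolP (z \in A); last by have := bound A zA; clear; lia.
  have := bound (~: A); rewrite inE zA => /(_ isT).
  rewrite (eq_sm (fun e _ => crsC (src X) (snk X) A e)).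
  by have := sm_sub T' (subsetT A); rewrite setTD sT; clear; lia.
have par (A : {set vertex G}) : exists q, sm (crs (src X) (snk X) A) (edges_between X Y) = sm T' A + 2 * q.
  have [q ->] := sm_crs_parity hXY A (subxx (edges_between X Y)).
  exists (q - sm (fun v => if v \in X then h' v - dJ v - db v else - h' v) A).
  have -> : sm T' A = sm db A + 2 * sm (fun v => if v \in X then h' v - dJ v - db v else - h' v) A.
    by rewrite -smM -smD; apply: eq_sm => v _; rewrite T'E; case: ifP => _; clear; lia.
  by rewrite -/db; clear; lia.
have [F FE hF] := orientation (fun e => @src_neq_snk _ _ _ hXY e) sT le_crs par.
exists (F :|: J) => v.
have FJ : [disjoint F & J].
  rewrite disjoints_subset; apply/subsetP => e /(subsetP FE).
  rewrite !inE; apply: contraL => /(subsetP JX); rewrite inE => /andP[a1 a2].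
  by rewrite !(in_Y hXY) a1 a2.
rewrite degreeE smU // -/(dJ v).
have hFv := hF v; rewrite (orientation_degree hXY) // T'E -/(db v) in hFv.
have -> : sm (inc v) F + dJ v = h' v.
  by move: hFv; case: (boolP (v \in X)) => vX; [| rewrite dJ0 //]; clear; lia.
exact: (hh' v).1.
Qed.
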